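(* Let $D\in\mathcal{D}_n$, $n\geq 2$, and let $\varphi\in\mathcal{M}^n$ be a holomorphic map with boundary measure $\mu$. Consider the decomposition $$\mu = g\,d\mathcal{L}^{\mathbb{T}}+\varrho\,d\nu,$$ where $g=(g_1,\ldots,g_n):\mathbb{T}\to\mathbb{R}^n$ and $\varrho=(\varrho_1,\ldots,\varrho_n):\mathbb{T}\to\partial\mathbb{B}_n$ are Borel-measurable maps, $g_1,\ldots,g_n\in L^1(\mathbb{T},\mathcal{L}^{\mathbb{T}})$, and $\nu$ is a positive, finite Borel measure on $\mathbb{T}$ singular to $\mathcal{L}^{\mathbb{T}}$. Then $\varphi(\mathbb{D})\subset D$ and $\varphi$ is a complex geodesic for $D$ if and only if there exists a map $h=(h_1,\ldots,h_n)\in\mathcal{H}^n$, $h\not\equiv 0$, such that the following conditions hold: (i) $h\in\mathcal{H}_+^n$, (ii) $g(\lambda)\in P_D(\bar\lambda h(\lambda))$ for $\mathcal{L}^{\mathbb{T}}$-a.e. $\lambda\in\mathbb{T}$, (iii) $\varrho(\lambda)\in(-\infty,0]^n$ for $\nu$-a.e. $\lambda\in\mathbb{T}$, (iv) $\mathrm{Re}\,\varphi(0)\in\mathrm{Re}\,D$, (v) if $j\in\{1,\ldots,n\}$ is such that $h_j\not\equiv 0$, then $\varrho_j\,d\nu=\alpha_j\delta_{\lambda_j}$ for some $\lambda_j\in\mathbb{T}$ and $\alpha_j\in(-\infty,0]$ such that $\alpha_j h_j(\lambda_j)=0$.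
   Context: $\mathbb{D}$ and $\mathbb{T}$ are the unit disc and the unit circle in $\mathbb{C}$; $\mathcal{L}^{\mathbb{T}}$ is the Lebesgue (arc length) measure on $\mathbb{T}$, of total mass $2\pi$; $\delta_{\lambda_0}$ is the Dirac delta at $\lambda_0\in\mathbb{T}$. $\langle\cdot,\cdot\rangle$ is the standard inner product on $\mathbb{R}^n$, $\mathbb{B}_n$ the open Euclidean unit ball in $\mathbb{R}^n$, $\partial\mathbb{B}_n$ the unit sphere. $\mathcal{O}(X,Y)$ denotes the holomorphic maps from $X$ to $Y$. A tube domain in $\mathbb{C}^n$ is a set $D=\Omega+i\mathbb{R}^n$ with $\Omega\subset\mathbb{R}^n$ a (non-empty) domain; $\Omega$ is called the base of $D$ and denoted $\mathrm{Re}\,D$. A holomorphic map $\varphi:\mathbb{D}\to D$ into a convex domain $D\subset\mathbb{C}^n$ is a complex geodesic for $D$ if there exists a holomorphic $f:D\to\mathbb{D}$ with $f\circ\varphi=\mathrm{id}_{\mathbb{D}}$. A real Borel measure is a finite signed Borel measure. The boundary measure of $\varphi\in\mathcal{O}(\mathbb{D},\mathbb{C}^n)$, if it exists, is the unique $n$-tuple $\mu=(\mu_1,\ldots,\mu_n)$ of real Borel measures on $\mathbb{T}$ such that $\varphi(\lambda)=\frac{1}{2\pi}\int_{\mathbb{T}}\frac{\zeta+\lambda}{\zeta-\lambda}\,d\mu(\zeta)+i\,\mathrm{Im}\,\varphi(0)$ for all $\lambda\in\mathbb{D}$ (componentwise). $\mathcal{M}^n$ is the set of $\varphi\in\mathcal{O}(\mathbb{D},\mathbb{C}^n)$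 admitting a boundary measure. Every $n$-tuple $\mu$ of real Borel measures on $\mathbb{T}$ has a decomposition $\mu=g\,d\mathcal{L}^{\mathbb{T}}+\varrho\,d\nu$ of the form described in the claim, with $\nu$ unique, $\varrho$ unique up to a $\nu$-null set, and $g$ unique up to an $\mathcal{L}^{\mathbb{T}}$-null set. $\mathcal{H}^n:=\{h\in\mathcal{O}(\mathbb{C},\mathbb{C}^n):\bar\lambda h(\lambda)\in\mathbb{R}^n\ \forall\lambda\in\mathbb{T}\}$ and $\mathcal{H}_+^n:=\{h\in\mathcal{O}(\mathbb{C},\mathbb{C}^n):\bar\lambda h(\lambda)\in[0,\infty)^n\ \forall\lambda\in\mathbb{T}\}$. For a convex tube domain $D\subset\mathbb{C}^n$ and $v\in\mathbb{R}^n$: $W_D:=\{v\in\mathbb{R}^n:\sup_{x\in\mathrm{Re}\,D}\langle x,v\rangle<\infty\}$, $P_D(v):=\{p\in\overline{\mathrm{Re}\,D}:\langle x-p,v\rangle<0\text{ for all }x\in\mathrm{Re}\,D\}$. $\mathcal{D}_n$ is the family of all convex tube domains $D\subset\mathbb{C}^n$ such that $\overline{W_D}=[0,\infty)^n$. *)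

(* Defs.v *)
From HB Require Import structures.
From mathcomp Require Import all_boot all_order all_algebra.
From mathcomp Require Import all_classical all_reals all_analysis.
From mathcomp Require Import complex.
From mathcomp Require Import lra.

Set Implicit Arguments.
Unset Strict Implicit.
Unset Printing Implicit Defensive.

Import Order.TTheory GRing.Theory Num.Theory.
Import numFieldNormedType.Exports.

Local Open Scope classical_set_scope.
Local Open Scope ring_scope.

(* [R[i]^o] is the complex plane with its usual topology, as a normed space
   over [R[i]]; C^n is ['rV[R[i]]_n].  In the order of [R[i]], [0 <= z] holds
   iff [z] is real and nonnegative. *)

Notation borel T := (g_sigma_algebraType (@open T)).

Section disc_and_circle.
Variable R : realType.

Definition unit_disc : set R[i]^o := [set z | `|z| < 1].

Definition unit_circle : set R[i]^o := [set z | `|z| = 1].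

Definition circle : Type := set_type unit_circle.

HB.instance Definition _ := Topological.copy circle (set_type unit_circle).

Lemma expi_subproof (t : R) : (cos t +i* sin t)%C \in unit_circle.
Proof. by rewrite inE /unit_circle /= normc_def /= cos2Dsin2 sqrtr1. Qed.

Definition expi (t : R) : circle := SigSub (expi_subproof t).

HB.instance Definition _ := isPointed.Build circle (expi 0).

Definition cval (z : circle) : R[i]^o := set_val z.

Lemma continuous_expi : continuous expi.
Proof.
apply: continuous_comp_initial => t; apply/(@cvgrPdist_lt R[i] R[i]^o) => e e0.
have [er er0 ->] : exists2 er : R, 0 < er & e = er%:C%C.
  exists (complex.Re e); first by move: e0; rewrite ltcE => /andP[].
  by apply/eqP; move: e0; rewrite ltcE eq_complex /= eqxx => /andP[].
have e20 : 0 < er / 2 by rewrite divr_gt0.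
near=> s.
have : `|cos t - cos s| < er / 2.
  by near: s; exact: ((cvgrPdist_lt _ _).1 (@continuous_cos R t)).
have : `|sin t - sin s| < er / 2.
  by near: s; exact: ((cvgrPdist_lt _ _).1 (@continuous_sin R t)).
rewrite !ltr_norml => /andP[? ?] /andP[? ?].
rewrite normc_def ltcR -[ltRHS]ger0_norm ?(ltW er0)// -sqrtr_sqr.
rewrite ltr_sqrt ?exprn_gt0//=; nra.
Unshelve. all: by end_near. Qed.

Lemma measurable_expi :
  measurable_fun setT (expi : measurableTypeR R -> borel circle).
Proof.
apply: measurability; first by [].
move=> _ [U oU <-]; rewrite setTI; apply: measurable_realfun.open_measurable.
by move/continuousP: continuous_expi; exact.
Qed.

(* Arc length: the image of the Lebesgue measure on [0, 2 pi[ under [expi]. *)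
Let lebesgue_02pi :=
  mrestr (@lebesgue_measure R) (measurable_itv `[0, 2 * pi[).

Definition arc_length : set (borel circle) -> \bar R :=
  pushforward lebesgue_02pi (expi : measurableTypeR R -> borel circle).

HB.instance Definition _ := Measure.copy arc_length
  (measure_function_pushforward__canonical__measure_function_Measure
    lebesgue_02pi measurable_expi).
End disc_and_circle.

Arguments unit_disc : clear implicits.
Arguments unit_circle : clear implicits.
Arguments arc_length : clear implicits.

Section charges.
Context d (T : measurableType d) (R : realType).

Definition mutually_singular (mu nu : set T -> \bar R) : Prop :=
  exists A, [/\ measurable A, mu A = 0%E & nu (~` A) = 0%E].

(* Integration against a signed measure through its Jordan decomposition; the
   value does not depend on the Hahn decomposition which is picked. *)
Definition charge_Rintegral (nu : {charge set T -> \bar R}) (f : T -> R) : R :=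
  let P := cid (Hahn_decomposition nu) in
  let N := cid (svalP P) in
  \int[jordan_pos (svalP N)]_x f x - \int[jordan_neg (svalP N)]_x f x.

Definition charge_Cintegral (nu : {charge set T -> \bar R})
    (f : T -> R[i]) : R[i] :=
  (charge_Rintegral nu (fun x => complex.Re (f x)) +i*
   charge_Rintegral nu (fun x => complex.Im (f x)))%C.
End charges.

(* Differentiability is over the scalars [R[i]], that is, in the complex
   sense. *)
Definition holomorphic_on (R : realType) (V W : normedModType R[i])
    (U : set V) (f : V -> W) : Prop :=
  forall z, U z -> differentiable f z.

Section real_vectors.
Context (R : realType) (n : nat).
Implicit Types x v : 'rV[R]_n.

Definition dotv x v : R := \sum_(j < n) x 0 j * v 0 j.

(* The library norm on ['rV[R]_n] is the sup norm. *)
Definition unit_sphere : set 'rV[R]_n := [set x | Num.sqrt (dotv x x) = 1].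

Definition re_vec (z : 'rV[R[i]]_n) : 'rV[R]_n := map_mx (@complex.Re R) z.
End real_vectors.
Arguments unit_sphere : clear implicits.

Section boundary_measures.
Context (R : realType) (n : nat).

Definition is_boundary_measure (phi : R[i]^o -> 'rV[R[i]]_n)
    (mu : 'I_n -> {charge set (borel (circle R)) -> \bar R}) : Prop :=
  forall z, unit_disc R z -> forall j,
    phi z 0 j =
      (2 * pi)^-1%:C%C *
        charge_Cintegral (mu j) (fun w => (cval w + z) / (cval w - z)) +
      'i%C * (complex.Im (phi 0 0 j))%:C%C.

(* mu = g dL + rho dnu *)
Definition is_decomposition
    (mu : 'I_n -> {charge set (borel (circle R)) -> \bar R})
    (g rho : borel (circle R) -> borel 'rV[R]_n)
    (nu : {finite_measure set (borel (circle R)) -> \bar R}) : Prop :=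
  [/\ measurable_fun setT g /\
        (forall j, (arc_length R).-integrable setT (fun w => (g w 0 j)%:E)),
      measurable_fun setT rho /\ (forall w, unit_sphere R n (rho w)),
      mutually_singular nu (arc_length R) &
      forall j (A : set (borel (circle R))), measurable A ->
        mu j A = (\int[arc_length R]_(w in A) (g w 0 j)%:E +
                  \int[nu]_(w in A) (rho w 0 j)%:E)%E].
End boundary_measures.

Section tube_domains.
Context (R : realType) (n : nat).
Implicit Types (D : set 'rV[R[i]]_n) (v : 'rV[R]_n) (h : R[i]^o -> 'rV[R[i]]_n).

Definition real_domain (U : set 'rV[R]_n) : Prop :=
  [/\ U !=set0, open U & connected U].

Definition tube_domain D : Prop :=
  exists2 U, real_domain U & D = [set z | U (re_vec z)].

Definition Re_base D : set 'rV[R]_n := @re_vec R n @` D.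

Definition W_set D : set 'rV[R]_n :=
  [set v | (ereal_sup [set (dotv x v)%:E | x in Re_base D] < +oo)%E].

Definition P_set D v : set 'rV[R]_n :=
  [set p | closure (Re_base D) p /\ forall x, Re_base D x -> dotv (x - p) v < 0].

(* The coefficients of [convex_set] range over the [t : R[i]] such that
   [0 <= t <= 1], i.e., over the real unit interval. *)
Definition family_D D : Prop :=
  [/\ tube_domain D, @convex_set R[i] 'rV[R[i]]_n D &
      closure (W_set D) = [set v | forall j, 0 <= v 0 j]].

Definition complex_geodesic D (phi : R[i]^o -> 'rV[R[i]]_n) : Prop :=
  [/\ holomorphic_on (unit_disc R) phi, phi @` unit_disc R `<=` D &
      exists f : 'rV[R[i]]_n -> R[i]^o,
        [/\ holomorphic_on D f, f @` D `<=` unit_disc R &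
            forall z, unit_disc R z -> f (phi z) = z]].

Definition H_set h : Prop :=
  holomorphic_on setT h /\
  forall z, unit_circle R z -> forall j, z^* * h z 0 j \is Num.real.

Definition H_plus h : Prop :=
  holomorphic_on setT h /\
  forall z, unit_circle R z -> forall j, 0 <= z^* * h z 0 j.
End tube_domains.

(* Main.v *)
(* If [f] is a left inverse of [phi], the maps [f (phi + t i e_j)] for real [t],
   and [f ((1 - t) phi + t z)] for [z] in [D] and [0 <= t <= 1], send the disc to
   itself and are the identity at [t = 0]; hence their derivatives at [t = 0]
   satisfy the boundary inequality for holomorphic vector fields pointing into
   the disc.  As [i e_j] and [- i e_j] are both allowed,
   [h_j = (d f / d z_j) o phi] must be of the form [a + b l + a^* l^2] with [b]
   real.  The inequality for [z] then says that the Poisson integral of the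
   measure [<Re z - mu, l^* h>] is nonpositive, and the
   conditions are read off from its absolutely continuous and singular parts.

   Conversely [phi] maps into [D] by Harnack's inequality applied to supporting
   half-spaces.  If the [h_j] have no common zero on the circle, then for [z] in
   [D] the function [l |-> <z - phi l, h l>] points strictly into the disc near
   the circle, so it has exactly one zero, which depends holomorphically on [z]
   and is the left inverse.  Otherwise all [h_j] are multiples of one
   [(l - l0)^2], a linear combination of the components of [phi] is an affine
   image of the Herglotz kernel at [l0], and inverting that kernel gives the left
   inverse. *)

Require Import Defs.
From HB Require Import structures.
From mathcomp Require Import all_boot all_order all_algebra.
From mathcomp Require Import all_classical all_reals all_analysis.
From mathcomp Require Import complex measurable_realfun.
From mathcomp Require Import ring lra.

Set Implicit Arguments.
Unset Strict Implicit.
Unset Printing Implicit Defensive.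

Import Order.TTheory GRing.Theory Num.Theory.
Import numFieldNormedType.Exports.

Local Open Scope classical_set_scope.
Local Open Scope ring_scope.

(** Neither [f] nor [phi] extends to the circle, so the boundary inequality has to be stated inside
    the disc. From a field one subtracts the tangent field [b - b^* l^2] having the same value at a
    point [m]; the difference divided by [(l - m) (1 - m^* l)] has a removable singularity, and on
    the circle this denominator is a positive multiple of [l], so inwardness becomes a sign of the
    real part. Base points [m] other than 0 are essential: for a field whose opposite is also
    allowed the inequalities become equalities, and comparing different [m] yields the quadratic
    form by algebra, with no power series. In the converse the same quotient replaces the argument
    principle: it shows that a zero is unique and bounds from below the factor left after [l - m] is
    split off. All this needs a maximum principle that tolerates one point of mere continuity; as
    differentiability is only pointwise, it rests on bisection. On the side of measures, the
    exceptional null sets depend on a half-space or on a point of the base; rational points keep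
    their number countable. *)

(** * Bisection of rectangles *)

Section rectangle_bisection.
Context (R : realType).
Implicit Types x y a b w h : R.

Lemma nested_interval_limit (a : nat -> R) (w : R) :
  (forall n, a n <= a n.+1 /\ a n.+1 + w / 2 ^+ n.+1 <= a n + w / 2 ^+ n) ->
  0 <= w -> exists x, forall n, a n <= x <= a n + w / 2 ^+ n.
Proof.
move=> aS w0.
have wn n : 0 <= w / 2 ^+ n by rewrite divr_ge0// exprn_ge0.
have aD n k : a n <= a (n + k)%N /\
    a (n + k)%N + w / 2 ^+ (n + k) <= a n + w / 2 ^+ n.
  elim: k => [|k [IH1 IH2]]; first by rewrite addn0.
  by rewrite addnS; have [h1 h2] := aS (n + k)%N; split; lra.
have am n m : a m <= a n + w / 2 ^+ n.
  have [nm|/ltnW mn] := leqP n m.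
    have := aD n (m - n)%N; rewrite subnKC// => -[_].
    have := wn m; lra.
  have := aD m (n - m)%N; rewrite subnKC// => -[+ _].
  have := wn n; lra.
exists (sup (range a)) => n; apply/andP; split.
  apply: ub_le_sup; last by exists n.
  by exists (a 0%N + w / 2 ^+ 0) => _ [m _ <-]; exact: am.
apply: ge_sup; first by exists (a 0%N), 0%N.
by move=> _ [m _ <-]; exact: am.
Qed.

(** Goursat's argument for an additive function of rectangles: one of four quarters carries at least
    a quarter of the value, so [4 ^+ n] times the value on the nested rectangles stays above the
    initial one, whereas the estimate at their common point bounds it by an arbitrarily small
    multiple of [(w + h) ^+ 2]. *)
Lemma rectangle_bisection (D : R -> R -> R -> R -> R) x0 y0 w h :
  0 <= w -> 0 <= h ->
  (forall x y a b, 0 <= a -> 0 <= b -> x0 <= x -> x + (a + a) <= x0 + w ->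
     y0 <= y -> y + (b + b) <= y0 + h ->
     D x y (a + a) (b + b) =
     D x y a b + D (x + a) y a b + D x (y + b) a b + D (x + a) (y + b) a b) ->
  (forall x y, x0 <= x <= x0 + w -> y0 <= y <= y0 + h -> forall e, 0 < e ->
     exists2 d, 0 < d & forall x' y' a b, 0 <= a <= d -> 0 <= b <= d ->
       x0 <= x' -> x' + a <= x0 + w -> y0 <= y' -> y' + b <= y0 + h ->
       x' <= x <= x' + a -> y' <= y <= y' + b ->
       `|D x' y' a b| <= e * (a + b) ^+ 2) ->
  D x0 y0 w h = 0.
Proof.
move=> w0 h0 Dquarter Dsmall; apply/eqP; rewrite -normr_eq0.
apply: contraT => D0; set del := `|D x0 y0 w h| in D0.
have del0 : 0 < del by rewrite lt_neqAle eq_sym D0 normr_ge0.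
have wn n : 0 <= w / 2 ^+ n by rewrite divr_ge0// exprn_ge0.
have hn n : 0 <= h / 2 ^+ n by rewrite divr_ge0// exprn_ge0.
pose P n (p : R * R) := [/\ del <= 4 ^+ n * `|D p.1 p.2 (w / 2 ^+ n) (h / 2 ^+ n)|,
  x0 <= p.1 /\ p.1 + w / 2 ^+ n <= x0 + w &
  y0 <= p.2 /\ p.2 + h / 2 ^+ n <= y0 + h].
pose Q n (p q : R * R) :=
  [/\ p.1 <= q.1, q.1 + w / 2 ^+ n.+1 <= p.1 + w / 2 ^+ n,
      p.2 <= q.2 & q.2 + h / 2 ^+ n.+1 <= p.2 + h / 2 ^+ n].
have halfS (z : R) n : z / 2 ^+ n = z / 2 ^+ n.+1 + z / 2 ^+ n.+1.
  by rewrite exprS invfM mulrCA; lra.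
have step n p : P n p -> exists q, P n.+1 q /\ Q n p q.
  case: p => x y [/= Dp [xl xr] [yl yr]].
  have := wn n.+1; have := hn n.+1.
  set a := w / 2 ^+ n.+1; set b := h / 2 ^+ n.+1 => b0 a0.
  move: Dp xr yr; rewrite (halfS w) (halfS h) -/a -/b => Dp xr yr.
  have Dq : exists i j : bool,
      `|D x y (a + a) (b + b)| <=
      4 * `|D (x + i%:R * a) (y + j%:R * b) a b|.
    rewrite Dquarter//.
    set A1 := D x y a b; set A2 := D (x + a) y a b.
    set A3 := D x (y + b) a b; set A4 := D (x + a) (y + b) a b.
    have A1234 : `|A1 + A2 + A3 + A4| <= `|A1| + `|A2| + `|A3| + `|A4|.
      by rewrite (le_trans (ler_normD _ _))// lerD2r (le_trans (ler_normD _ _))//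
         lerD2r ler_normD.
    have [h1|h1] := leP `|A1 + A2 + A3 + A4| (4 * `|A1|).
      by exists false, false; rewrite !mul0r !addr0.
    have [h2|h2] := leP `|A1 + A2 + A3 + A4| (4 * `|A2|).
      by exists true, false; rewrite !mul0r !addr0 !mul1r.
    have [h3|h3] := leP `|A1 + A2 + A3 + A4| (4 * `|A3|).
      by exists false, true; rewrite !mul0r !addr0 !mul1r.
    exists true, true; rewrite !mul1r -/A4; lra.
  have [i [j Dij]] := Dq.
  have ia : 0 <= i%:R * a <= a by case: i {Dij} => /=; lra.
  have jb : 0 <= j%:R * b <= b by case: j {Dij} => /=; lra.
  exists (x + i%:R * a, y + j%:R * b).
  have p4 : 0 <= 4 ^+ n :> R by rewrite exprn_ge0.
  split; split => //=.
  - rewrite -/a -/b exprSr -mulrA; apply: (le_trans Dp).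
    by rewrite ler_wpM2l.
  - rewrite -/a; split; lra.
  - rewrite -/b; split; lra.
  - lra.
  - rewrite -/a (halfS w) -/a; lra.
  - lra.
  - rewrite -/b (halfS h) -/b; lra.
(* Dependent choice: the index and the proof of [P] travel with the corner, since a next corner is
   only provided for a pair satisfying [P]. *)
pose F (s : {np : nat * (R * R) | P np.1 np.2}) :
    {np : nat * (R * R) | P np.1 np.2} :=
  let: exist np Pp := s in
  exist _ (np.1.+1, projT1 (cid (step np.1 np.2 Pp)))
    (proj1 (projT2 (cid (step np.1 np.2 Pp)))).
have P0 : P 0%N (x0, y0) by split; rewrite /= ?expr0 ?mul1r ?divr1.
pose s n := iter n F (exist _ (0%N, (x0, y0)) P0).
have s1 n : (projT1 (s n)).1 = n.
  by elim: n => // n; rewrite /s iterS /=; case: (iter _ _ _) => -[m p] /= ? ->.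
pose p n := (projT1 (s n)).2.
have Pn n : P n (p n) by have := projT2 (s n); rewrite s1.
have Qn n : Q n (p n) (p n.+1).
  rewrite /p /s iterS -/(s n).
  have := s1 n; case: (s n) => -[m q] /= Pq <- /=.
  by case: cid => r /= [].
have [x xP] : exists x, forall n, (p n).1 <= x <= (p n).1 + w / 2 ^+ n.
  by apply: nested_interval_limit => // n; have [] := Qn n.
have [y yP] : exists y, forall n, (p n).2 <= y <= (p n).2 + h / 2 ^+ n.
  by apply: nested_interval_limit => // n; have [] := Qn n.
have xI : x0 <= x <= x0 + w.
  by have := xP 0%N; have [_ [h1 h2] _] := Pn 0%N; move=> /andP[? ?]; lra.
have yI : y0 <= y <= y0 + h.
  by have := yP 0%N; have [_ _ [h1 h2]] := Pn 0%N; move=> /andP[? ?]; lra.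
(* Then [e * (w + h) ^+ 2 < del]; the summand 1 keeps the denominator positive for a degenerate
   rectangle. *)
pose e := del / (2 * ((w + h) ^+ 2 + 1)).
have wh0 : 0 < (w + h) ^+ 2 + 1 by rewrite ltr_wpDl// sqr_ge0.
have e0 : 0 < e by rewrite divr_gt0// mulr_gt0.
have [d d0 dP] := Dsmall x y xI yI e e0.
have [n nP] : exists n, (w + h) / 2 ^+ n <= d.
  exists (Num.truncn ((w + h) / d)).+1.
  rewrite ler_pdivrMr ?exprn_gt0// mulrC -ler_pdivrMr//.
  apply: (@le_trans _ _ (Num.truncn ((w + h) / d)).+1%:R).
    by rewrite ltW// truncnS_gt.
  by rewrite -natrX ler_nat ltnW// ltn_expl.
have wd : w / 2 ^+ n <= d by move: nP; rewrite mulrDl; have := hn n; lra.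
have hd : h / 2 ^+ n <= d by move: nP; rewrite mulrDl; have := wn n; lra.
have [D1 [x1 x2] [y1 y2]] := Pn n.
have := dP (p n).1 (p n).2 (w / 2 ^+ n) (h / 2 ^+ n).
rewrite wn wd hn hd => /(_ isT isT x1 x2 y1 y2 (xP n) (yP n)) Dle.
have : del <= e * (w + h) ^+ 2.
  apply: (le_trans D1); rewrite -ler_pdivlMl ?exprn_gt0//; apply: (le_trans Dle).
  rewrite -mulrDl exprMn mulrA [leRHS]mulrC ler_wpM2l//.
    by rewrite mulr_ge0// ?(ltW e0)// sqr_ge0.
  by rewrite exprVn -exprM mulnC exprM (_ : 2 ^+ 2 = 4)// -natrX.
rewrite /e mulrAC ler_pdivlMr ?mulr_gt0//.
have : 0 <= (w + h) ^+ 2 by rewrite sqr_ge0.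
nra.
Qed.
End rectangle_bisection.

(** * Real-valued modulus and conjugation *)

Section complex_modulus.
Context (R : realType).
Implicit Types (z w : R[i]) (a : R).
Local Notation Re := complex.Re.
Local Notation Im := complex.Im.

(** The norm of [R[i]] takes its values in [R[i]]; this real copy lets estimates be closed by real
    arithmetic. *)
Definition cmod z : R := Num.sqrt (Re z ^+ 2 + Im z ^+ 2).

Lemma normc_cmod z : `|z| = (cmod z)%:C%C. Proof. exact: normc_def. Qed.

Lemma cmod_ge0 z : 0 <= cmod z. Proof. exact: sqrtr_ge0. Qed.
Hint Resolve cmod_ge0 : core.

Lemma cmodM z w : cmod (z * w) = cmod z * cmod w.
Proof. by apply: complexI; rewrite rmorphM/= -!normc_cmod normrM. Qed.

Lemma cmodN z : cmod (- z) = cmod z.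
Proof. by apply: complexI; rewrite -!normc_cmod normrN. Qed.

Lemma cmodV z : cmod z^-1 = (cmod z)^-1.
Proof. by apply: complexI; rewrite fmorphV/= -!normc_cmod normfV. Qed.

Lemma cmodX z k : cmod (z ^+ k) = cmod z ^+ k.
Proof. by apply: complexI; rewrite rmorphXn/= -!normc_cmod normrX. Qed.

Lemma cmodD z w : cmod (z + w) <= cmod z + cmod w.
Proof. by rewrite -lecR rmorphD/= -!normc_cmod ler_normD. Qed.

Lemma cmodB z w : cmod (z - w) <= cmod z + cmod w.
Proof. by rewrite -(cmodN w) cmodD. Qed.

Lemma cmodBC z w : cmod (z - w) = cmod (w - z).
Proof. by rewrite -cmodN opprB. Qed.

Lemma cmod_sub z w : cmod z - cmod w <= cmod (z - w).
Proof. by have := cmodD (z - w) w; rewrite subrK; lra. Qed.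

Lemma cmodJ z : cmod z^*%C = cmod z.
Proof. by apply: complexI; rewrite -!normc_cmod normcJ. Qed.

Lemma cmod0 : cmod 0 = 0. Proof. by apply: complexI; rewrite -normc_cmod normr0. Qed.
Lemma cmod1 : cmod 1 = 1. Proof. by apply: complexI; rewrite -normc_cmod normr1. Qed.

Lemma cmod_real a : cmod a%:C%C = `|a|.
Proof. by rewrite /cmod /= expr0n/= addr0 sqrtr_sqr. Qed.

Lemma cmod_i : cmod 'i%C = 1.
Proof. by rewrite /cmod /= expr0n/= add0r expr1n sqrtr1. Qed.

Lemma cmod_eq0 z : (cmod z == 0) = (z == 0).
Proof. by rewrite -[RHS]normr_eq0 normc_cmod -(inj_eq (@complexI R)). Qed.

Lemma cmod_gt0 z : (0 < cmod z) = (z != 0).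
Proof. by rewrite lt_neqAle eq_sym cmod_eq0 cmod_ge0 andbT. Qed.

Lemma sqr_cmod z : cmod z ^+ 2 = Re z ^+ 2 + Im z ^+ 2.
Proof. by rewrite sqr_sqrtr// addr_ge0// sqr_ge0. Qed.

Lemma mulJc z : z * z^*%C = (cmod z ^+ 2)%:C%C.
Proof. by rewrite sqr_cmod; case: z => a b; simpc; apply/eqP; rewrite eq_complex /=; apply/andP; split; apply/eqP; ring. Qed.

Lemma ler_Re_cmod z : `|Re z| <= cmod z.
Proof. by rewrite -lecR -normc_cmod normc_ge_Re. Qed.

Lemma ler_Im_cmod z : `|Im z| <= cmod z.
Proof.
by rewrite /cmod -sqrtr_sqr ler_sqrt ?addr_ge0 ?sqr_ge0// lerDr sqr_ge0.
Qed.

Lemma Re_le_cmod z : Re z <= cmod z.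
Proof. by rewrite (le_trans (ler_norm _)) ?ler_Re_cmod. Qed.

Lemma cmod_le_ReIm z : cmod z <= `|Re z| + `|Im z|.
Proof.
rewrite -(@ler_pXn2r _ 2)// ?nnegrE// ?addr_ge0// sqr_cmod sqrrD !real_normK ?num_real//.
by have := mulr_ge0 (normr_ge0 (Re z)) (normr_ge0 (Im z)); lra.
Qed.

Lemma ReD z w : Re (z + w) = Re z + Re w. Proof. by case: z; case: w. Qed.
Lemma ImD z w : Im (z + w) = Im z + Im w. Proof. by case: z; case: w. Qed.
Lemma ReN z : Re (- z) = - Re z. Proof. by case: z. Qed.
Lemma ImN z : Im (- z) = - Im z. Proof. by case: z. Qed.
Lemma ReB z w : Re (z - w) = Re z - Re w. Proof. by rewrite ReD ReN. Qed.
Lemma ImB z w : Im (z - w) = Im z - Im w. Proof. by rewrite ImD ImN. Qed.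
Lemma ReM z w : Re (z * w) = Re z * Re w - Im z * Im w.
Proof. by case: z; case: w. Qed.
Lemma ImM z w : Im (z * w) = Re z * Im w + Im z * Re w.
Proof. by case: z; case: w. Qed.
Lemma ReZ a z : Re (a%:C%C * z) = a * Re z.
Proof. by rewrite ReM /= mul0r subr0. Qed.
Lemma ImZ a z : Im (a%:C%C * z) = a * Im z.
Proof. by rewrite ImM /= mul0r addr0. Qed.
Lemma ReJ z : Re z^*%C = Re z. Proof. by case: z. Qed.
Lemma ImJ z : Im z^*%C = - Im z. Proof. by case: z. Qed.
Lemma eqcP z w : Re z = Re w -> Im z = Im w -> z = w.
Proof. by case: z; case: w => a b c d /= -> ->. Qed.

Definition ReImE := (ReD, ImD, ReN, ImN, ReM, ImM, ReJ, ImJ).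

Definition cis (t : R) : R[i] := (cos t +i* sin t)%C.

Lemma cmod_cis t : cmod (cis t) = 1.
Proof. by rewrite /cmod /= cos2Dsin2 sqrtr1. Qed.
End complex_modulus.
#[global] Hint Extern 0 (is_true (_ <= cmod _)) => solve [apply: cmod_ge0] : core.

Section conjugation.
Context (R : realType).
Implicit Types (z w : R[i]) (a : R).

Lemma conjCD z w : (z + w)^*%C = z^*%C + w^*%C. Proof. exact: rmorphD. Qed.
Lemma conjCN z : (- z)^*%C = - z^*%C. Proof. exact: rmorphN. Qed.
Lemma conjCM z w : (z * w)^*%C = z^*%C * w^*%C. Proof. exact: rmorphM. Qed.
Lemma conjCX z k : (z ^+ k)^*%C = z^*%C ^+ k. Proof. exact: rmorphXn. Qed.
Lemma conjCV z : (z^-1)^*%C = (z^*%C)^-1. Proof. exact: fmorphV. Qed.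
Lemma conjCi : ('i%C : R[i])^*%C = - 'i%C.
Proof. by apply: eqcP; rewrite /= ?oppr0. Qed.
Lemma conjC1 : (1 : R[i])^*%C = 1. Proof. exact: rmorph1. Qed.

Definition conjCE :=
  (conjCD, conjCN, conjCM, conjCX, conjCV, conjCi, conjC1, @conjc_real R, @conjcK R).

Lemma realCD a b : (a + b)%:C%C = a%:C%C + b%:C%C :> R[i]. Proof. exact: rmorphD. Qed.
Lemma realCN a : (- a)%:C%C = - a%:C%C :> R[i]. Proof. exact: rmorphN. Qed.
Lemma realCM a b : (a * b)%:C%C = a%:C%C * b%:C%C :> R[i]. Proof. exact: rmorphM. Qed.
Lemma realCV a : (a^-1)%:C%C = (a%:C%C)^-1 :> R[i]. Proof. exact: fmorphV. Qed.
Lemma realC1 : 1%:C%C = 1 :> R[i]. Proof. by []. Qed.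

Lemma sqr_cmodE z : (cmod z ^+ 2)%:C%C = z * z^*%C.
Proof. by rewrite mulJc. Qed.
End conjugation.

(** * First-order expansions *)

Section first_order_expansion.

Lemma is_derive_expansion (R : realType) (f : R -> R) (x df : R) :
  is_derive x 1 f df -> forall e : R, 0 < e ->
  exists2 d : R, 0 < d & forall h, `|h| <= d ->
    `|f (x + h) - f x - h * df| <= e * `|h|.
Proof.
move=> [dfx <-] e e0.
have /derivable_nbhs/eqaddoP/(_ e e0) := dfx.
move=> /nbhs_norm0P[d /= d0 dP]; exists (d / 2); first by rewrite divr_gt0.
move=> h hd; have /= := dP h.
rewrite (le_lt_trans hd) ?ltr_pdivrMr ?ltr_pMr ?ltr1n// => /(_ isT).
rewrite -![(_ + _ : _ -> _) _]/(_ + _) -![(- _ : _ -> _) _]/(- _) /cst /=.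
by rewrite opprD addrA [h *: 1]mulr1 (addrC h).
Qed.

Context (R : realType).
Implicit Types (q : R[i] -> R[i]) (l d : R[i]).

(** Complex derivative with real constants: the form used in estimates and for functions, such as
    [slope], that receive a separate value at one point. *)
Definition cexpansion q l d := forall e : R, 0 < e -> exists2 del : R, 0 < del &
  forall l', cmod (l' - l) <= del ->
    cmod (q l' - q l - d * (l' - l)) <= e * cmod (l' - l).

Definition ccontinuous q l := forall e : R, 0 < e -> exists2 del : R, 0 < del &
  forall l', cmod (l' - l) <= del -> cmod (q l' - q l) <= e.

Lemma cexpansion_continuous q l d : cexpansion q l d -> ccontinuous q l.
Proof.
move=> qd e e0; have [del del0 delP] := qd 1 ltr01.
have d1 : 0 < 1 + cmod d by have := cmod_ge0 d; lra.
exists (Num.min del (e / (1 + cmod d))).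
  by rewrite lt_min del0 divr_gt0.
move=> l'; rewrite le_min => /andP[h1 h2].
have := delP _ h1; rewrite mul1r => h3.
rewrite -(subrK (d * (l' - l)) (q l' - q l)) (le_trans (cmodD _ _))//.
rewrite cmodM; move: h2; rewrite ler_pdivlMr//; lra.
Qed.
End first_order_expansion.

(** * Cauchy's theorem on rectangles *)

Section goursat.
Context (R : realType).
Local Notation mu := (@lebesgue_measure R).
Implicit Types (f g : R -> R) (a b c : R).

Definition Int a b f := \int[mu]_(t in `[a, b]) f t.

Lemma integrable_continuous f a b :
  (forall t, a <= t <= b -> {for t, continuous f}) ->
  mu.-integrable `[a, b] (EFin \o f).
Proof.
move=> cf; apply: continuous_compact_integrable; first exact: segment_compact.
by apply: continuous_in_subspaceT => t; rewrite inE/= in_itv/=; exact: cf.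
Qed.

Lemma IntD a b c f : a <= b -> b <= c ->
  (forall t, a <= t <= c -> {for t, continuous f}) ->
  Int a c f = Int a b f + Int b c f.
Proof.
move=> ab bc cf; apply/eqP; rewrite addrC -subr_eq; apply/eqP.
rewrite /Int Rintegral_itvB ?bnd_simp//; last exact: integrable_continuous.
rewrite Rintegral_itv_obnd_cbnd//.
apply: (@integrableS _ _ _ mu `[b, c]%classic) => //.
  by apply: subset_itvr; rewrite bnd_simp.
by apply: integrable_continuous => t /andP[? ?]; apply: cf; lra.
Qed.

Lemma Int_bound a b c M f : a <= b ->
  (forall t, a <= t <= b -> {for t, continuous f}) ->
  (forall t, a <= t <= b -> `|f t - c| <= M) ->
  `|Int a b f - c * (b - a)| <= M * (b - a).
Proof.
move=> ab cf fM.
have mab : fine (mu `[a, b]%classic) = b - a.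
  rewrite lebesgue_measure_itv/= lte_fin; case: ltP => //= ba.
  by apply/eqP; rewrite eq_sym subr_eq0; apply/eqP/le_anti; rewrite ab ba.
have ic r : mu.-integrable `[a, b] (EFin \o (fun=> r : R)).
  by apply: integrable_continuous => t _; exact: cst_continuous.
have cE r : \int[mu]_(t in `[a, b]) r = r * (b - a).
  by rewrite Rintegral_cst// mab.
have intf := integrable_continuous cf.
rewrite -!cE -RintegralB//.
have cfc : forall t, a <= t <= b -> {for t, continuous (fun t => f t - c)}.
  by move=> t tab; apply: continuousB; [exact: cf|exact: cst_continuous].
rewrite (le_trans (le_normr_Rintegral _ _))//; first exact: integrable_continuous.
apply: le_Rintegral => //.
- apply: integrable_continuous => t tab; apply: continuous_comp; first exact: cfc.
  exact: norm_continuous.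
Qed.

Lemma IntB a b f g :
  (forall t, a <= t <= b -> {for t, continuous f}) ->
  (forall t, a <= t <= b -> {for t, continuous g}) ->
  Int a b (fun t => f t - g t) = Int a b f - Int a b g.
Proof. by move=> cf cg; rewrite /Int RintegralB//; exact: integrable_continuous. Qed.

(* [u + i v] has the complex derivative [p + i s] at [x + i y]. *)
Definition cauchy_riemann (u v : R -> R -> R) x y := exists p s : R, forall e : R, 0 < e ->
  exists2 d : R, 0 < d & forall x' y', `|x' - x| <= d -> `|y' - y| <= d ->
    `|u x' y' - u x y - (p * (x' - x) - s * (y' - y))| <=
      e * (`|x' - x| + `|y' - y|) /\
    `|v x' y' - v x y - (s * (x' - x) + p * (y' - y))| <=
      e * (`|x' - x| + `|y' - y|).

Lemma cauchy_riemann_continuous u v x y : cauchy_riemann u v x y ->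
  {for y, continuous (u x)} /\ {for x, continuous (v^~ y)}.
Proof.
move=> [p [s CR]]; have [d d0 dP] := CR 1 ltr01.
have ps0 : 0 < 1 + `|p| + `|s| by have := normr_ge0 p; have := normr_ge0 s; lra.
split; apply/cvgrPdist_le => /= e e0; apply/nbhs_ballP;
  exists (Num.min d (e / (1 + `|p| + `|s|))) => /=;
  rewrite ?lt_min ?d0 ?divr_gt0// => z;
  rewrite /ball/= lt_min distrC => /andP[/ltW zd];
  rewrite ltr_pdivlMr// => zps; rewrite distrC.
  have := dP x z; rewrite subrr normr0 => /(_ (ltW d0) zd)[+ _].
  rewrite mulr0 add0r mul1r add0r opprK => h.
  have := ler_normB (u x z - u x y + s * (z - y)) (s * (z - y)).
  rewrite addrK normrM; have := normr_ge0 p; have := normr_ge0 (z - y); nra.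
have := dP z y; rewrite subrr normr0 => /(_ zd (ltW d0))[_ +].
rewrite mulr0 !addr0 mul1r => h.
have := ler_normD (v z y - v x y - s * (z - x)) (s * (z - x)).
rewrite subrK normrM; have := normr_ge0 p; have := normr_ge0 (z - x); nra.
Qed.

Lemma dist_in_interval (x a t c : R) : x <= t <= x + a -> x <= c <= x + a ->
  `|t - c| <= a.
Proof. by move=> ? ?; rewrite ler_norml; apply/andP; split; lra. Qed.

Lemma subinterval (x0 w x a t : R) : x0 <= x -> x + a <= x0 + w -> x <= t <= x + a ->
  x0 <= t <= x0 + w.
Proof. by move=> ? ? ?; apply/andP; split; lra. Qed.

(** This is the imaginary part of Cauchy's theorem: [v dx + u dy] integrates to 0 along the
    boundary. On a small rectangle the derivative contributes [p * a * b] both to the pair of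
    vertical sides and to the pair of horizontal ones, so only a second-order error is left. *)
Lemma goursat (u v : R -> R -> R) x0 y0 w h : 0 <= w -> 0 <= h ->
  (forall x y, x0 <= x <= x0 + w -> y0 <= y <= y0 + h -> cauchy_riemann u v x y) ->
  Int y0 (y0 + h) (u (x0 + w)) - Int y0 (y0 + h) (u x0) =
  Int x0 (x0 + w) (v^~ (y0 + h)) - Int x0 (x0 + w) (v^~ y0).
Proof.
move=> w0 h0 CR; apply/eqP; rewrite -subr_eq0; apply/eqP.
pose D x y a b := Int y (y + b) (u (x + a)) - Int y (y + b) (u x) -
  (Int x (x + a) (v^~ (y + b)) - Int x (x + a) (v^~ y)).
have cu x y : x0 <= x <= x0 + w -> y0 <= y <= y0 + h -> {for y, continuous (u x)}.
  by move=> xI yI; have [] := cauchy_riemann_continuous (CR x y xI yI).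
have cv x y : x0 <= x <= x0 + w -> y0 <= y <= y0 + h ->
    {for x, continuous (v^~ y)}.
  by move=> xI yI; have [] := cauchy_riemann_continuous (CR x y xI yI).
apply: (@rectangle_bisection R D x0 y0 w h) => //.
  move=> x y a b a0 b0 h1 h2 h3 h4; rewrite /D !addrA.
  have U z : x0 <= z <= x0 + w ->
    Int y (y + b + b) (u z) = Int y (y + b) (u z) + Int (y + b) (y + b + b) (u z).
    move=> zI; apply: IntD; [lra|lra|move=> t tI; apply: cu => //; lra].
  have V z : y0 <= z <= y0 + h ->
    Int x (x + a + a) (v^~ z) =
    Int x (x + a) (v^~ z) + Int (x + a) (x + a + a) (v^~ z).
    move=> zI; apply: IntD; [lra|lra|move=> t tI; apply: cv => //; lra].
  rewrite !U ?V; lra.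
move=> x y xI yI e e0.
(* Half of [e], because the difference of two opposite sides collects two errors. *)
have [p [s /(_ (e / 2))]] := CR x y xI yI.
rewrite divr_gt0// => /(_ isT)[d d0 dP]; exists d => //.
move=> x' y' a b /andP[a0 ad] /andP[b0 bd] h1 h2 h3 h4 h5 h6.
have e20 : 0 <= e / 2 by rewrite ltW// divr_gt0.
have xin t (tI : x' <= t <= x' + a) : x0 <= t <= x0 + w := subinterval h1 h2 tI.
have yin t (tI : y' <= t <= y' + b) : y0 <= t <= y0 + h := subinterval h3 h4 tI.
have x'I : x' <= x' <= x' + a by rewrite lexx lerDl.
have xaI : x' <= x' + a <= x' + a by rewrite lexx lerDl a0.
have y'I : y' <= y' <= y' + b by rewrite lexx lerDl.
have ybI : y' <= y' + b <= y' + b by rewrite lexx lerDl b0.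
have near z t : x' <= z <= x' + a -> y' <= t <= y' + b ->
    `|u z t - u x y - (p * (z - x) - s * (t - y))| <= e / 2 * (a + b) /\
    `|v z t - v x y - (s * (z - x) + p * (t - y))| <= e / 2 * (a + b).
  move=> zI tI; have zx := dist_in_interval zI h5; have ty := dist_in_interval tI h6.
  have [u1 v1] := dP z t (le_trans zx ad) (le_trans ty bd).
  have le2 : e / 2 * (`|z - x| + `|t - y|) <= e / 2 * (a + b).
    by rewrite ler_wpM2l// lerD.
  by split; [exact: le_trans u1 le2|exact: le_trans v1 le2].
have hU : `|Int y' (y' + b) (fun t => u (x' + a) t - u x' t) - p * a * (y' + b - y')|
    <= e * (a + b) * (y' + b - y').
  apply: Int_bound; first by rewrite lerDl.
    by move=> t /yin tI; apply: continuousB; apply: cu => //; exact: xin.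
  move=> t tI; have [A _] := near _ _ xaI tI; have [B _] := near _ _ x'I tI.
  have -> : u (x' + a) t - u x' t - p * a =
    (u (x' + a) t - u x y - (p * (x' + a - x) - s * (t - y))) -
    (u x' t - u x y - (p * (x' - x) - s * (t - y))) by ring.
  by rewrite [e in leRHS]splitr mulrDl; exact: le_trans (ler_normB _ _) (lerD A B).
have hV : `|Int x' (x' + a) (fun t => v t (y' + b) - v t y') - p * b * (x' + a - x')|
    <= e * (a + b) * (x' + a - x').
  apply: Int_bound; first by rewrite lerDl.
    by move=> t /xin tI; apply: continuousB; apply: cv => //; exact: yin.
  move=> t tI; have [_ A] := near _ _ tI ybI; have [_ B] := near _ _ tI y'I.
  have -> : v t (y' + b) - v t y' - p * b =
    (v t (y' + b) - v x y - (s * (t - x) + p * (y' + b - y))) -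
    (v t y' - v x y - (s * (t - x) + p * (y' - y))) by ring.
  by rewrite [e in leRHS]splitr mulrDl; exact: le_trans (ler_normB _ _) (lerD A B).
rewrite /D -IntB; [|by move=> t /yin tI; apply: cu => //; exact: xin..].
rewrite -IntB; [|by move=> t /xin tI; apply: cv => //; exact: yin..].
have -> : e * (a + b) ^+ 2 =
  e * (a + b) * (y' + b - y') + e * (a + b) * (x' + a - x') by ring.
apply: le_trans (lerD hU hV); apply: le_trans (ler_normB _ _).
set A := Int y' _ _; set B := Int x' _ _.
by have -> : A - B = A - p * a * (y' + b - y') - (B - p * b * (x' + a - x')) by ring.
Qed.
End goursat.

(** * Logarithmic polar coordinates *)

Section polar_coordinates.
Context (R : realType).
Local Notation Re := complex.Re.
Local Notation Im := complex.Im.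
Implicit Types (q : R[i] -> R[i]) (c : R[i]) (x y e : R).

(** The exponential of [x + i y]: circles around a centre become vertical segments, and composing
    with it preserves the Cauchy-Riemann equations. *)
Definition polar x y : R[i] := (expR x)%:C%C * cis y.

Lemma cmod_polar x y : cmod (polar x y) = expR x.
Proof. by rewrite cmodM cmod_real cmod_cis mulr1 ger0_norm ?expR_ge0. Qed.

Lemma cisD x y : cis (x + y) = cis x * cis y.
Proof. by rewrite /cis cosD sinD; apply: eqcP => //=; ring. Qed.

Lemma polarD x y a b : polar (x + a) (y + b) = polar x y * polar a b.
Proof. by rewrite /polar expRD cisD rmorphM/=; ring. Qed.

Lemma polar_expansion0 e : 0 < e -> exists2 d : R, 0 < d & forall a b : R,
  `|a| <= d -> `|b| <= d ->
  cmod (polar a b - 1 - (a +i* b)%C) <= e * (`|a| + `|b|).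
Proof.
move=> e0; pose e1 := Num.min (e / 6) 1.
have e10 : 0 < e1 by rewrite lt_min divr_gt0/=.
have e1e : 6 * e1 <= e by rewrite -ler_pdivlMl// mulrC ge_min lexx.
have e11 : e1 <= 1 by rewrite ge_min lexx orbT.
clearbody e1.
have [d1 d10 d1P] := is_derive_expansion (is_derive_expR (0:R)) e10.
have [d2 d20 d2P] := is_derive_expansion (is_derive_cos (0:R)) e10.
have [d3 d30 d3P] := is_derive_expansion (is_derive_sin (0:R)) e10.
exists (Num.min (Num.min d1 e1) (Num.min d2 d3)).
  by rewrite !lt_min d10 e10 d20.
move=> a b; rewrite !le_min => /andP[/andP[a1 a2] _] /andP[_ /andP[b2 b3]].
have := d1P _ a1; have := d2P _ b2; have := d3P _ b3.
rewrite !add0r sin0 cos0 expR0 oppr0 !mulr1 mulr0 !subr0 !addr0.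
set E := expR a; set c := cos b; set s := sin b => hs hc hE.
have c1 : `|c| <= 1 by rewrite ler_norml cos_geN1 cos_le1.
have s1 : `|s| <= 1 by rewrite ler_norml sin_geN1 sin_le1.
apply: (le_trans (cmod_le_ReIm _)).
rewrite /polar /cis -/E -/c -/s !ReImE/=.
have na := normr_ge0 a; have nb := normr_ge0 b.
have H1 : `|E * c - 0 * s - 1 - a| <= e1 * `|a| + 2 * (e1 * `|b|).
  rewrite (_ : _ - a = (E - 1 - a) * c + (1 + a) * (c - 1)); last by ring.
  rewrite (le_trans (ler_normD _ _))// !normrM; apply: lerD.
    by rewrite -[leRHS]mulr1 ler_pM.
  by rewrite ler_pM// (le_trans (ler_normD _ _))// normr1; lra.
have H2 : `|E * s + 0 * c - 0 - b| <= e1 * `|a| + 2 * (e1 * `|b|) + e1 * `|b|.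
  rewrite (_ : _ - b = (E - 1 - a) * s + (1 + a) * (s - b) + a * b); last by ring.
  rewrite (le_trans (ler_normD _ _))// !normrM; apply: lerD; last first.
    by rewrite ler_wpM2r.
  rewrite (le_trans (ler_normD _ _))// !normrM; apply: lerD.
    by rewrite -[leRHS]mulr1 ler_pM.
  by rewrite ler_pM// (le_trans (ler_normD _ _))// normr1; lra.
apply: (le_trans (lerD H1 H2)).
have : 6 * e1 * (`|a| + `|b|) <= e * (`|a| + `|b|).
  by rewrite ler_wpM2r// addr_ge0.
nra.
Qed.

Lemma polar_expansion x y e : 0 < e -> exists2 d : R, 0 < d & forall x' y' : R,
  `|x' - x| <= d -> `|y' - y| <= d ->
  cmod (polar x' y' - polar x y - polar x y * ((x' - x) +i* (y' - y))%C) <=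
    e * (`|x' - x| + `|y' - y|).
Proof.
move=> e0; have E0 := expR_gt0 x.
have [d d0 dP] := polar_expansion0 (divr_gt0 e0 E0); exists d => // x' y' xd yd.
rewrite -{1}(subrKC x x') -{1}(subrKC y y') polarD.
rewrite (_ : _ - _ = polar x y *
  (polar (x' - x) (y' - y) - 1 - ((x' - x) +i* (y' - y))%C)); last by ring.
rewrite cmodM cmod_polar -ler_pdivlMl//.
by rewrite (le_trans (dP _ _ xd yd))// mulrA [_^-1 * e]mulrC.
Qed.

Lemma cauchy_riemann_polar q c x y D : cexpansion q (c + polar x y) D ->
  cauchy_riemann (fun x y => Re (q (c + polar x y)))
                 (fun x y => Im (q (c + polar x y))) x y.
Proof.
move=> qD; set E := polar x y; pose P := D * E.
exists (Re P), (Im P) => e e0.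
have E0 : 0 < cmod E by rewrite cmod_polar expR_gt0.
have K0 : 0 < cmod E + 1 by lra.
have [d1 d10 d1P] := qD (e / 2 / (cmod E + 1)) (divr_gt0 (divr_gt0 e0 (ltr0Sn R 1)) K0).
have D0 : 0 < cmod D + 1 by have := cmod_ge0 D; lra.
pose e2 := Num.min (e / 2 / (cmod D + 1)) 1.
have e20 : 0 < e2 by rewrite lt_min ltr01 !divr_gt0.
have [d2 d20 d2P] := polar_expansion x y e20.
exists (Num.min d2 (d1 / (2 * (cmod E + 1)))).
  by rewrite lt_min d20 divr_gt0// mulr_gt0.
move=> x' y'; rewrite !le_min => /andP[x2 x1] /andP[y2 y1].
have := d2P _ _ x2 y2; rewrite -/E; set E' := polar x' y'.
set h := x' - x in x1 x2 *; set k := y' - y in y1 y2 *; set w := (h +i* k)%C => hE.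
have cw : cmod w <= `|h| + `|k| by exact: cmod_le_ReIm.
have nh := normr_ge0 h; have nk := normr_ge0 k.
have e21 : e2 <= 1 by rewrite ge_min lexx orbT.
have hEE : cmod (E' - E) <= (cmod E + 1) * (`|h| + `|k|).
  rewrite -(subrK (E * w) (E' - E)) (le_trans (cmodD _ _))// cmodM.
  rewrite mulrDl mul1r [leLHS]addrC; apply: lerD; first by rewrite ler_wpM2l.
  by rewrite (le_trans hE)// -[leRHS]mul1r ler_wpM2r// addr_ge0.
have dd : cmod (c + E' - (c + E)) <= d1.
  rewrite (_ : c + E' - (c + E) = E' - E); last by ring.
  apply: (le_trans hEE); move: x1 y1; rewrite !ler_pdivlMr ?mulr_gt0//; nra.
have := d1P _ dd; rewrite (_ : c + E' - (c + E) = E' - E); last by ring.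
move=> hq; set Q' := q (c + E'); set Q := q (c + E).
have main : cmod (Q' - Q - P * w) <= e * (`|h| + `|k|).
  rewrite (_ : _ - _ = (Q' - Q - D * (E' - E)) + D * (E' - E - E * w)); last first.
    by rewrite /P; ring.
  rewrite (le_trans (cmodD _ _))// cmodM.
  have A1 : e / 2 / (cmod E + 1) * cmod (E' - E) <= e / 2 * (`|h| + `|k|).
    rewrite -[e / 2 / _ * _]mulrA ler_wpM2l ?divr_ge0 ?(ltW e0)//.
    by rewrite ler_pdivrMl.
  have A2 : cmod D * cmod (E' - E - E * w) <= e / 2 * (`|h| + `|k|).
    apply: (@le_trans _ _ (cmod D * (e2 * (`|h| + `|k|)))); first by rewrite ler_wpM2l.
    rewrite mulrA ler_wpM2r ?addr_ge0//.
    apply: (@le_trans _ _ ((cmod D + 1) * (e / 2 / (cmod D + 1)))).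
      by apply: ler_pM; rewrite ?(ltW e20)// ?lerDl// ge_min lexx.
    by rewrite mulrC divfK// gt_eqF.
  lra.
split.
- apply: le_trans main; apply: (le_trans _ (ler_Re_cmod _)).
  by rewrite !ReImE/= /Q /Q'.
- apply: le_trans main; apply: (le_trans _ (ler_Im_cmod _)).
  by rewrite !ReImE/= /Q /Q' [X in _ - X]addrC.
Qed.
End polar_coordinates.

(** * Mean value property and maximum principle *)

Section maximum_principle.
Context (R : realType).
Local Notation Re := complex.Re.
Local Notation Im := complex.Im.
Implicit Types (q : R[i] -> R[i]).

(* The singularity at the centre is removable: in logarithmic polar coordinates
   the mean over a circle does not depend on the radius, and the centre is only
   reached in the limit. *)
Lemma mean_value q (c : R[i]) (s : R) : 0 < s ->
  (forall l, 0 < cmod (l - c) <= s -> exists d, cexpansion q l d) ->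
  ccontinuous q c ->
  Int 0 (2 * pi) (fun t => Re (q (c + s%:C%C * cis t))) = 2 * pi * Re (q c).
Proof.
move=> s0 qd qc; set K := 2 * pi.
have K0 : 0 < K :> R by rewrite mulr_gt0// pi_gt0.
pose u x y := Re (q (c + polar x y)); pose v x y := Im (q (c + polar x y)).
have CR x y : x <= ln s -> cauchy_riemann u v x y.
  move=> xs; have [|d dP] := qd (c + polar x y); last exact: cauchy_riemann_polar dP.
  by rewrite addrC addKr cmod_polar expR_gt0/= -(lnK s0) ler_expR.
have same x : x <= ln s -> Int 0 K (u (ln s)) = Int 0 K (u x).
  move=> xs; have xs0 : 0 <= ln s - x by rewrite subr_ge0.
  have vK : v^~ (0 + K) = v^~ 0.
    apply/funext => t; rewrite /v /polar /cis add0r /K mulr_natl.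
    by rewrite -[pi *+ 2]add0r cosD2pi sinD2pi.
  have := @goursat R u v x 0 (ln s - x) K xs0 (ltW K0); rewrite vK subrKC => H.
  have /eqP : Int 0 (0 + K) (u (ln s)) - Int 0 (0 + K) (u x) = 0.
    by rewrite H ?[LHS]subrr// => x' y' /andP[_ xI] _; exact: CR.
  by rewrite subr_eq0 add0r => /eqP.
have -> : (fun t => Re (q (c + s%:C%C * cis t))) = u (ln s).
  by apply/funext => t; rewrite /u /polar lnK.
apply/eqP; rewrite -subr_eq0 -normr_le0; apply/ler_addgt0Pl => e e0; rewrite addr0.
have [d d0 dP] := qc (e / K) (divr_gt0 e0 K0).
pose x := Num.min (ln s) (ln d).
have xs : x <= ln s by rewrite ge_min lexx.
have := @Int_bound R 0 K (Re (q c)) (e / K) (u x) (ltW K0).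
rewrite subr0 divfK ?gt_eqF// (same x xs) [_ * K]mulrC; apply.
  by move=> t _; have [] := cauchy_riemann_continuous (CR x t xs).
move=> t _; rewrite /u -ReB (le_trans (ler_Re_cmod _))//; apply: dP.
by rewrite addrC addKr cmod_polar -(lnK d0) ler_expR ge_min lexx orbT.
Qed.

Lemma Int_le (a b M : R) (f : R -> R) : a <= b ->
  (forall t, a <= t <= b -> {for t, continuous f}) ->
  (forall t, a <= t <= b -> f t <= M) -> Int a b f <= M * (b - a).
Proof.
move=> ab cf fM.
have ic r : (@lebesgue_measure R).-integrable `[a, b] (EFin \o (fun=> r : R)).
  by apply: integrable_continuous => t _; exact: cst_continuous.
have mab : fine ((@lebesgue_measure R) `[a, b]%classic) = b - a.
  rewrite lebesgue_measure_itv/= lte_fin; case: ltP => //= ba.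
  by apply/eqP; rewrite eq_sym subr_eq0; apply/eqP/le_anti; rewrite ab ba.
rewrite -mab -Rintegral_cst//; apply: le_Rintegral => //.
exact: integrable_continuous.
Qed.

Definition rcontinuous (f : R[i] -> R) l := forall e : R, 0 < e ->
  exists2 del : R, 0 < del & forall l', cmod (l' - l) <= del -> `|f l' - f l| <= e.

Lemma annulus_EVT (f : R[i] -> R) (a r : R) : 0 <= r -> a <= r ->
  (forall l, a <= cmod l <= r -> rcontinuous f l) ->
  exists2 l0, a <= cmod l0 <= r & forall l, a <= cmod l <= r -> f l <= f l0.
Proof.
move=> r0 ar cf; pose c (p : R * R) : R[i] := (p.1 +i* p.2)%C.
pose A : set (R * R) := [set p | a <= cmod (c p) <= r].
have cc : continuous (fun p => cmod (c p)).
  move=> p; apply: continuous_comp; last exact: sqrt_continuous.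
  apply: continuousD; apply: (@continuous_comp _ _ _ _ (fun x : R => x ^+ 2));
    [exact: cvg_fst|exact: exprn_continuous|exact: cvg_snd|exact: exprn_continuous].
have cA : compact A.
  apply: (@subclosed_compact _ A (`[- r, r] `*` `[- r, r])).
  - rewrite (_ : A = (fun p => cmod (c p)) @^-1` `[a, r]).
      by apply: preimage_closed; [move=> p _; exact: cc|exact: interval_closed].
    by apply/seteqP; split => p; rewrite /A/= in_itv.
  - by apply: compact_setX; exact: segment_compact.
  - move=> p /andP[_ pr]; split; rewrite /= in_itv/= -ler_norml.
      exact: le_trans (ler_Re_cmod (c p)) pr.
    exact: le_trans (ler_Im_cmod (c p)) pr.
have A0 : A !=set0.
  exists (r, 0); rewrite /A/= /c.
  by rewrite /cmod/= expr0n/= addr0 sqrtr_sqr ger0_norm// ar lexx.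
have [|p pA pmax] := compact_EVT_max A0 cA (_ : {within A, continuous (f \o c)}).
  apply: continuous_in_subspaceT => p /set_mem pA.
  apply/cvgrPdist_le => /= e e0; have [d d0 dP] := cf _ pA e e0.
  have d2 : 0 < d / 2 by rewrite divr_gt0.
  exists (ball p.1 (d / 2), ball p.2 (d / 2)).
    by split; exact: nbhsx_ballx.
  move=> p' [/= h1 h2]; rewrite distrC; apply: dP.
  apply: (le_trans (cmod_le_ReIm _)); rewrite ReB ImB/=.
  move: h1 h2; rewrite /ball/= distrC => h1; rewrite distrC => h2.
  by rewrite (splitr d) lerD// ltW.
exists (c p); first exact/set_mem/pA.
by move=> l lr; have := pmax (Re l, Im l); rewrite /c/=; case: l lr => x y lr; apply; exact/mem_set.
Qed.

Lemma ccontinuous_Re q l : ccontinuous q l -> rcontinuous (fun l => Re (q l)) l.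
Proof.
move=> qc e e0; have [d d0 dP] := qc e e0; exists d => // l' /dP.
by rewrite -ReB; apply: le_trans; exact: ler_Re_cmod.
Qed.

(** The exceptional point [l1], where only continuity is known, makes room for quotients with a
    removable singularity. A multiple of [|z|^2] is added to [Re q]: an interior maximum of the
    strictly subharmonic sum contradicts the mean value property at once, so no connectedness
    argument is needed. *)
Lemma maximum_principle q (l1 : R[i]) (r M : R) : 0 < r ->
  (forall l, cmod l < r -> l != l1 -> exists d, cexpansion q l d) ->
  (forall l, cmod l <= r -> ccontinuous q l) ->
  (forall l, cmod l = r -> Re (q l) <= M) ->
  forall l, cmod l <= r -> Re (q l) <= M.
Proof.
move=> r0 qd qc qM l lr; rewrite leNgt; apply/negP => Mq.
(* With [e * r ^+ 2] equal to half the excess over [M], the perturbation cannot move the maximum to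
   the boundary circle. *)
pose e := (Re (q l) - M) / (2 * r ^+ 2).
have r20 : 0 < r ^+ 2 by rewrite exprn_gt0.
have e0 : 0 < e by rewrite divr_gt0 ?mulr_gt0// subr_gt0.
have er : e * r ^+ 2 = (Re (q l) - M) / 2.
  by rewrite /e; field; rewrite gt_eqF.
clearbody e.
pose W z := Re (q z) + e * cmod z ^+ 2.
have cW z : 0 <= cmod z <= r -> rcontinuous W z.
  move=> /andP[_ zr] e' e'0.
  have e'20 : 0 < e' / 2 by rewrite divr_gt0.
  have [d1 d10 d1P] := ccontinuous_Re (qc z zr) e'20.
  have K0 : 0 < e * (2 * r + 1) by rewrite mulr_gt0//; lra.
  exists (Num.min (Num.min d1 1) (e' / 2 / (e * (2 * r + 1)))).
    by rewrite !lt_min d10 ltr01 divr_gt0.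
  move=> z'; rewrite !le_min => /andP[/andP[z1 z2] z3].
  rewrite (_ : W z' - W z =
    (Re (q z') - Re (q z)) + e * (cmod z' - cmod z) * (cmod z' + cmod z)); last first.
    by rewrite /W; ring.
  rewrite (le_trans (ler_normD _ _))//.
  have A1 := d1P _ z1.
  have A2 : `|cmod z' - cmod z| <= cmod (z' - z).
    have := cmod_sub z' z; have := cmod_sub z z'; rewrite (cmodBC z z') => ? ?.
    by rewrite ler_norml; apply/andP; split; lra.
  have A3 : cmod z' + cmod z <= 2 * r + 1.
    by have := cmod_sub z' z; lra.
  have : `|e * (cmod z' - cmod z) * (cmod z' + cmod z)| <= e' / 2.
    have N : `|cmod z' + cmod z| = cmod z' + cmod z by rewrite ger0_norm ?addr_ge0.
    rewrite 2!normrM N (gtr0_norm e0).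
    move: z3; rewrite ler_pdivlMr// => z3; apply: le_trans z3.
    rewrite -mulrA mulrCA; apply: ler_pM => //; first by rewrite mulr_ge0 ?addr_ge0 ?(ltW e0).
    by rewrite ler_wpM2l// ltW.
  lra.
have [l0 /andP[_ l0r] W0] := annulus_EVT (ltW r0) (ltW r0) cW.
have cl : 0 <= cmod l <= r by rewrite lr cmod_ge0.
have Wl : W l <= W l0 by exact: W0.
have ec : 0 <= e * cmod l ^+ 2 by rewrite mulr_ge0 ?(ltW e0)// sqr_ge0.
have {}l0r : cmod l0 < r.
  rewrite lt_neqAle l0r andbT; apply/eqP => l0E.
  have := qM _ l0E; move: Wl; rewrite /W l0E er; lra.
(* The small disc around [l0] must not contain [l1] except as its centre, where the mean value
   property only asks for continuity. *)
have [s s0 [sr sl1]] : exists2 s : R, 0 < s & cmod l0 + s < r /\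
    (l0 != l1 -> s < cmod (l0 - l1)).
  have r1 : 0 < (r - cmod l0) / 2 by lra.
  have [E|ne] := eqVneq l0 l1.
    by exists ((r - cmod l0) / 2) => //; split => //; lra.
  have n0 : 0 < cmod (l0 - l1) by rewrite cmod_gt0 subr_eq0.
  exists (Num.min ((r - cmod l0) / 2) (cmod (l0 - l1) / 2)).
    by rewrite lt_min r1 divr_gt0.
  split; last by move=> _; rewrite gt_min; apply/orP; right; lra.
  by rewrite -ltrBrDl gt_min; apply/orP; left; lra.
(* As [|z|^2 = 2 Re (l0^* z) - |l0|^2 + |z - l0|^2], adding this linear term turns [Re q] into [W]
   minus [e * |z - l0|^2], up to a constant, and keeps it the real part of a holomorphic
   function. *)
pose b : R[i] := (2 * e)%:C%C * l0^*%C.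
pose Q z := q z + b * z.
have Qd z : 0 < cmod (z - l0) <= s -> exists d, cexpansion Q z d.
  move=> /andP[z1 z2]; have [||d dP] := qd z.
  - by rewrite -(subrK l0 z) (le_lt_trans (cmodD _ _))//; lra.
  - apply/eqP => zl1; move: z2; rewrite zl1 cmodBC => z2.
    have : l0 != l1 by rewrite eq_sym -subr_eq0 -cmod_gt0 -zl1.
    by move=> /sl1; lra.
  exists (d + b) => e' e'0; have [d' d'0 d'P] := dP e' e'0; exists d' => // z' z'd.
  rewrite (_ : _ - _ = q z' - q z - d * (z' - z)); first exact: d'P.
  by rewrite /Q; ring.
have Qc : ccontinuous Q l0.
  move=> e' e'0; have [d d0 dP] := qc _ (ltW l0r) _ (divr_gt0 e'0 (ltr0Sn R 1)).
  have b0 : 0 < cmod b + 1 by have := cmod_ge0 b; lra.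
  exists (Num.min d (e' / 2 / (cmod b + 1))); first by rewrite lt_min d0 !divr_gt0.
  move=> z; rewrite le_min ler_pdivlMr// => /andP[z1 z2].
  rewrite (_ : _ - _ = (q z - q l0) + b * (z - l0)); last by rewrite /Q; ring.
  rewrite (le_trans (cmodD _ _))// cmodM; have := dP _ z1; have := cmod_ge0 (z - l0); lra.
have ReQ z : Re (Q z) = W z + e * cmod l0 ^+ 2 - e * cmod (z - l0) ^+ 2.
  rewrite /Q /W /b !sqr_cmod !ReImE/=; ring.
have := mean_value s0 Qd Qc.
have pi0 : 0 < 2 * pi :> R by rewrite mulr_gt0// pi_gt0.
have cmt t : cmod (l0 + s%:C%C * cis t - l0) = s.
  by rewrite addrC addKr cmodM cmod_cis cmod_real mulr1 gtr0_norm.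
have := @Int_le 0 (2 * pi) (Re (Q l0) - e * s ^+ 2)
  (fun t => Re (Q (l0 + s%:C%C * cis t))) (ltW pi0).
have es : 0 < e * s ^+ 2 by rewrite mulr_gt0// exprn_gt0.
move=> + mv; rewrite mv subr0 => H.
have : 2 * pi * Re (Q l0) <= (Re (Q l0) - e * s ^+ 2) * (2 * pi).
  apply: H.
    move=> t _.
    have [D DP] : exists d, cexpansion Q (l0 + polar (ln s) t) d.
      by apply: Qd; rewrite /polar lnK// cmt s0 lexx.
    have [+ _] := cauchy_riemann_continuous (cauchy_riemann_polar DP).
    by rewrite /polar lnK.
  move=> t _; rewrite ReQ cmt ReQ subrr cmod0 expr0n/= mulr0 subr0.
  have : W (l0 + s%:C%C * cis t) <= W l0.
    apply: W0; rewrite cmod_ge0/= (le_trans (cmodD _ _))//.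
    by rewrite cmodM cmod_cis cmod_real mulr1 gtr0_norm// ltW.
  lra.
by have := mulr_gt0 es pi0; lra.
Qed.

End maximum_principle.

(** * Complex differentiability and difference quotients *)

Section complex_differentiability.
Context (R : realType).
Implicit Types (q : R[i] -> R[i]) (l d : R[i]).

Definition cdifferentiable q l := differentiable (q : R[i]^o -> R[i]^o) (l : R[i]^o).

Lemma gt0_realC (e : R[i]) : 0 < e -> exists2 er : R, 0 < er & e = er%:C%C.
Proof.
by case: e => a b; rewrite ltcE/= => /andP[/eqP-> a0]; exists a.
Qed.

Lemma differentiable_cexpansion q l :
  cdifferentiable q l -> exists d, cexpansion q l d.
Proof.
move=> /derivable1_diffP/derivable_nbhs/eqaddoP dq.
exists ('D_1 (q : R[i]^o -> R[i]^o) l) => e e0.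
have eC0 : 0 < e%:C%C :> R[i] by rewrite ltcR.
move: (dq _ eC0) => /nbhs_norm0P[d0 /= d00 dP].
have [d d_gt0 dE] := gt0_realC d00.
exists (d / 2); first by rewrite divr_gt0.
move=> l' l'd.
have ld : `|l' - l| < d%:C%C.
  by rewrite normc_cmod ltcR (le_lt_trans l'd)// ltr_pdivrMr// ltr_pMr// ltr1n.
rewrite dE in dP; have := dP (l' - l) ld; rewrite /=.
rewrite -![(_ + _ : _ -> _) _]/(_ + _) -![(- _ : _ -> _) _]/(- _) /cst /=.
rewrite [(l' - l) *: 1]mulr1 subrK opprD addrA [_ *: _]mulrC.
by rewrite !normc_cmod -rmorphM/= lecR.
Qed.

Lemma ccontinuousP q l :
  ccontinuous q l <-> {for (l : R[i]^o), continuous (q : R[i]^o -> R[i]^o)}.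
Proof.
split => [qc|qc e e0].
  apply/(@cvgrPdist_le R[i] R[i]^o R[i]^o (nbhs (l : R[i]^o))) => e /gt0_realC[er er0 ->].
  have [d d0 dP] := qc er er0.
  apply/nbhs_ballP; exists d%:C%C => /=; first by rewrite ltcR.
  move=> l' /=; rewrite /ball/= normc_cmod ltcR cmodBC => /ltW/dP.
  by rewrite normc_cmod lecR cmodBC.
have eC0 : 0 < e%:C%C :> R[i] by rewrite ltcR.
have /(@cvgrPdist_le R[i] R[i]^o R[i]^o (nbhs (l : R[i]^o)))/(_ _ eC0)/nbhs_ballP[d0 /= d00 dP] := qc.
have [d d_gt0 dE] := gt0_realC d00.
exists (d / 2); first by rewrite divr_gt0.
move=> l' l'd; rewrite dE in dP.
have ld : `|l - l'| < d%:C%C.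
  by rewrite normc_cmod ltcR cmodBC (le_lt_trans l'd)// ltr_pdivrMr// ltr_pMr// ltr1n.
by have := dP l' ld; rewrite /= normc_cmod lecR cmodBC.
Qed.

Lemma cexpansion_near q1 q2 l d (r : R) : 0 < r ->
  (forall l', cmod (l' - l) <= r -> q1 l' = q2 l') ->
  cexpansion q1 l d -> cexpansion q2 l d.
Proof.
move=> r0 q12 qd e e0; have [del del0 delP] := qd e e0.
exists (Num.min del r); first by rewrite lt_min del0.
move=> l'; rewrite le_min => /andP[l'd l'r].
by rewrite -!q12//; [exact: delP|rewrite subrr cmod0 ltW].
Qed.

Definition slope q l1 d l := if l == l1 then d else (q l - q l1) / (l - l1).

Lemma slope_continuous q l1 d : cexpansion q l1 d -> ccontinuous (slope q l1 d) l1.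
Proof.
move=> qd e e0; have [del del0 delP] := qd e e0; exists del => // l' l'd.
rewrite /slope eqxx; case: eqVneq => [_|ne]; first by rewrite subrr cmod0 ltW.
have n0 : l' - l1 != 0 by rewrite subr_eq0.
rewrite (_ : _ - d = (q l' - q l1 - d * (l' - l1)) / (l' - l1)); last by field.
by rewrite cmodM cmodV ler_pdivrMr ?cmod_gt0// delP.
Qed.

Lemma slope_differentiable q l1 d l : cdifferentiable q l ->
  l != l1 -> exists d', cexpansion (slope q l1 d) l d'.
Proof.
move=> dq ll1; have n0 : l - l1 != 0 by rewrite subr_eq0.
have [|d' d'P] :=
    @differentiable_cexpansion (fun l => (q l - q l1) * (l - l1)^-1) l.
  apply: differentiableM; first by apply: differentiableB.
  by apply: differentiableV => //; apply: differentiableB.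
exists d'; apply: (@cexpansion_near _ _ _ _ (cmod (l - l1) / 2)) d'P.
  by rewrite divr_gt0// cmod_gt0.
move=> l' l'l; rewrite /slope; case: eqVneq => // l'l1; move: l'l.
rewrite l'l1 cmodBC; have : 0 < cmod (l - l1) by rewrite cmod_gt0.
by move=> ? ?; exfalso; clear l'l1; lra.
Qed.

(** The product rule is stated for expansions because [slope] is handled only through them. *)
Lemma cexpansionM q1 q2 l d1 d2 : cexpansion q1 l d1 -> cexpansion q2 l d2 ->
  exists d, cexpansion (fun l => q1 l * q2 l) l d.
Proof.
move=> e1 e2; exists (d1 * q2 l + q1 l * d2) => e e0.
pose K := cmod (q1 l) + cmod (q2 l) + cmod d2 + 1.
have K0 : 0 < K.
  by have := cmod_ge0 (q1 l); have := cmod_ge0 (q2 l); have := cmod_ge0 d2; rewrite /K; lra.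
pose e' := Num.min 1 (e / (3 * K)).
have e'0 : 0 < e' by rewrite lt_min ltr01 divr_gt0// mulr_gt0.
have e'1 : e' <= 1 by rewrite ge_min lexx.
have e'K : K * e' <= e / 3.
  apply: (@le_trans _ _ (K * (e / (3 * K)))).
    by rewrite ler_wpM2l ?(ltW K0)// ge_min lexx orbT.
  by rewrite le_eqVlt; apply/orP; left; apply/eqP; field; rewrite gt_eqF.
clearbody e'.
have [a a0 aP] := e1 e' e'0; have [b b0 bP] := e2 e' e'0.
have [c c0 cP] := cexpansion_continuous e1 e'0.
exists (Num.min a (Num.min b c)); first by rewrite !lt_min a0 b0.
move=> l'; rewrite !le_min => /and3P[/aP ha /bP hb /cP hc].
set D := l' - l in ha hb *.
rewrite (_ : _ - _ = (q1 l' - q1 l - d1 * D) * q2 l +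
  (q1 l' - q1 l) * (q2 l' - q2 l - d2 * D) + q1 l * (q2 l' - q2 l - d2 * D)
   + (q1 l' - q1 l) * (d2 * D)); last by ring.
have cmodD4 (x y z w : R[i]) :
    cmod (x + y + z + w) <= cmod x + cmod y + cmod z + cmod w.
  by have := cmodD (x + y + z) w; have := cmodD (x + y) z; have := cmodD x y; lra.
apply: (le_trans (cmodD4 _ _ _ _)).
rewrite !cmodM.
have D0 := cmod_ge0 D.
have k1 : cmod (q1 l' - q1 l - d1 * D) * cmod (q2 l) <= e' * cmod D * cmod (q2 l).
  by rewrite ler_wpM2r.
have k2 : cmod (q1 l' - q1 l) * cmod (q2 l' - q2 l - d2 * D) <= 1 * (e' * cmod D).
  by rewrite ler_pM// (le_trans hc).
have k3 : cmod (q1 l) * cmod (q2 l' - q2 l - d2 * D) <= cmod (q1 l) * (e' * cmod D).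
  by rewrite ler_wpM2l.
have k4 : cmod (q1 l' - q1 l) * (cmod d2 * cmod D) <= e' * (cmod d2 * cmod D).
  by rewrite ler_wpM2r// mulr_ge0.
have k5 : K * e' * cmod D <= e / 3 * cmod D by rewrite ler_wpM2r.
have k6 : 0 <= e * cmod D by rewrite mulr_ge0 ?(ltW e0).
apply: (@le_trans _ _ (K * e' * cmod D)).
  by rewrite /K; lra.
by lra.
Qed.
End complex_differentiability.

(** * The inequality for self-maps of the disc, and its rigidity *)

Section disc_self_maps.
Context (R : realType).
Local Notation Re := complex.Re.
Local Notation Im := complex.Im.
Implicit Types (psi E F : R[i] -> R[i]) (l m b : R[i]) (r : R).

Lemma le0_vanishing_bound (x K r0 : R) : r0 < 1 ->
  (forall r, r0 < r < 1 -> x <= K * (1 - r)) -> x <= 0.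
Proof.
move=> r01 xK; rewrite leNgt; apply/negP => x0.
pose t := Num.min ((1 - r0) / 2) (x / (2 * (`|K| + 1))).
have K0 : 0 < `|K| + 1 by have := normr_ge0 K; lra.
have t0 : 0 < t by rewrite lt_min !divr_gt0 ?mulr_gt0// subr_gt0.
have t1 : t <= (1 - r0) / 2 by rewrite ge_min lexx.
have tK : t * (2 * (`|K| + 1)) <= x.
  by rewrite -ler_pdivlMr ?mulr_gt0// ge_min lexx orbT.
clearbody t.
have h : x <= K * (1 - (1 - t)) by apply: xK; lra.
have : K * t <= `|K| * t by rewrite ler_wpM2r ?(ltW t0)// ler_norm.
nra.
Qed.

Lemma Re_div_le0 (z w : R[i]) : Re (z * w^*%C) <= 0 -> Re (z / w) <= 0.
Proof.
have [->|w0] := eqVneq w 0; first by rewrite invr0 mulr0.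
have k0 : 0 < (cmod w ^+ 2)^-1 by rewrite invr_gt0 exprn_gt0// cmod_gt0.
move=> h; rewrite (_ : z / w = (cmod w ^+ 2)^-1%:C%C * (z * w^*%C)).
  by rewrite ReZ pmulr_rle0.
rewrite realCV -mulJc; field.
by rewrite w0 conjc_eq0 w0.
Qed.

(* On the circle of radius [r], [(l - m) (r^2 - m^* l) = l |l - m|^2], so the
   sign of the real part of the quotient is that of [Re (l^* F l)]. *)
Lemma circle_denominator (l m : R[i]) r : cmod l = r ->
  (l - m) * ((r ^+ 2)%:C%C - m^*%C * l) = l * (cmod (l - m) ^+ 2)%:C%C.
Proof.
by move=> <-; rewrite -!mulJc rmorphB/=; ring.
Qed.

Lemma ball_denominator_neq0 (l m : R[i]) r : cmod l <= r -> cmod m < r ->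
  (r ^+ 2)%:C%C - m^*%C * l != 0.
Proof.
move=> lr mr; rewrite -cmod_gt0.
have r0 : 0 < r by have := cmod_ge0 m; lra.
have := cmod_sub (r ^+ 2)%:C%C (m^*%C * l).
rewrite cmodM cmodJ cmod_real ger0_norm ?sqr_ge0// => h.
apply: lt_le_trans h; rewrite subr_gt0 expr2.
apply: (@le_lt_trans _ _ (cmod m * r)); first by rewrite ler_wpM2l.
by rewrite ltr_pM2r.
Qed.

(* The quotient of [F] by [(l - m) (r^2 - m^* l)], extended at its removable
   singularity [m]. *)
Definition ball_quotient F m d r l := slope F m d l / ((r ^+ 2)%:C%C - m^*%C * l).

Lemma ball_quotientE F m d r l : F m = 0 -> l != m ->
  ball_quotient F m d r l = F l / ((l - m) * ((r ^+ 2)%:C%C - m^*%C * l)).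
Proof.
by move=> F0 lm; rewrite /ball_quotient /slope (negbTE lm) F0 subr0 invfM mulrA.
Qed.

Lemma differentiable_ball_denominator m r l :
  cdifferentiable (fun l => (r ^+ 2)%:C%C - m^*%C * l) l.
Proof. by apply: differentiableB => //; apply: differentiableM. Qed.

Lemma ball_quotient_differentiable F m d r l : cmod m < r -> cmod l <= r ->
  cdifferentiable F l ->
  l != m -> exists d', cexpansion (ball_quotient F m d r) l d'.
Proof.
move=> mr lr dF lm; have [d1 h1] := slope_differentiable d dF lm.
have [|d2 h2] := @differentiable_cexpansion _
    (fun l => ((r ^+ 2)%:C%C - m^*%C * l)^-1) l.
  by apply: differentiableV; [exact: differentiable_ball_denominator|
     exact: ball_denominator_neq0].
exact: cexpansionM h1 h2.
Qed.

Lemma ball_quotient_continuous F m d r l : cmod m < r -> cmod l <= r ->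
  cdifferentiable F l ->
  cexpansion F m d -> ccontinuous (ball_quotient F m d r) l.
Proof.
move=> mr lr dF Fd; have [->|lm] := eqVneq l m; last first.
  have [d' h'] := ball_quotient_differentiable d mr lr dF lm.
  exact: cexpansion_continuous h'.
apply/ccontinuousP; apply: continuousM.
  exact/ccontinuousP/slope_continuous.
apply: differentiable_continuous; apply: differentiableV.
  exact: differentiable_ball_denominator.
by apply: ball_denominator_neq0 => //; exact: ltW.
Qed.

(** On the unit circle [(l - m) (1 - m^* l)] is a positive multiple of [l], the field [b - b^* l^2]
    is tangent, and [Re (l^* psi l) <= 1]; so the quotient ought to have nonpositive real part
    there. As [psi] has no boundary values, the maximum principle is applied on radii [r < 1], with
    [r^2] instead of 1 in the denominator, and the error is of order [1 - r]. *)
Lemma self_map_generator psi m b l :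
  (forall l, cmod l < 1 -> cdifferentiable psi l) ->
  (forall l, cmod l < 1 -> cmod (psi l) <= 1) ->
  cmod m < 1 -> b - b^*%C * m ^+ 2 = psi m - m ->
  cmod l < 1 -> l != m ->
  Re ((psi l - l - (b - b^*%C * l ^+ 2)) / ((l - m) * (1 - m^*%C * l))) <= 0.
Proof.
move=> dpsi psi1 m1 bE l1 lm.
pose F l := psi l - l - (b - b^*%C * l ^+ 2).
have F0 : F m = 0 by rewrite /F bE subrr.
have dF z : cmod z < 1 -> cdifferentiable F z.
  move=> z1; apply: differentiableB; first by apply: differentiableB => //; exact: dpsi.
  by apply: differentiableB => //; apply: differentiableM => //; apply: differentiableX.
have [d Fd] := differentiable_cexpansion (dF m m1).
pose P := F l / (l - m).
have lm0 : l - m != 0 by rewrite subr_eq0.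
rewrite -/(F l) invfM mulrA -/P; apply: Re_div_le0.
(* For [r > r0] the disc of radius [r] contains [l] and [m], and its boundary keeps the distance
   [(1 - cmod m) / 2] from [m]. Together with [r > 1 / 2] this makes [k] a lower bound of
   [r * cmod (z - m) ^+ 2]. *)
pose r0 := Num.max (cmod l) (Num.max ((1 + cmod m) / 2) (1 / 2)).
have r01 : r0 < 1 by rewrite !gt_max l1 /=; apply/andP; split; lra.
pose k := ((1 - cmod m) / 2) ^+ 2 / 2.
have k0 : 0 < k by rewrite divr_gt0// exprn_gt0// divr_gt0// subr_gt0.
(* The first term pays for replacing [r^2 - m^* l] by [1 - m^* l]; the second is the bound [M] of
   the quotient times the bound 4 of [cmod w ^+ 2]. *)
apply: (@le0_vanishing_bound _ (2 * cmod P + 4 * ((1 + 2 * cmod b) / k)) r0) => //.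
move=> r /andP[+ r1]; rewrite !gt_max => /and3P[lr mr hr].
have r0' : 0 < r by lra.
have mr' : cmod m < r by lra.
pose M := (1 + 2 * cmod b) / k * (1 - r).
have circ z : cmod z = r -> Re (ball_quotient F m d r z) <= M.
  move=> zr; have zm : z != m by apply/eqP => E; move: zr; rewrite E; lra.
  rewrite ball_quotientE// circle_denominator//.
  have cz : 0 < cmod (z - m) ^+ 2 by rewrite exprn_gt0// cmod_gt0 subr_eq0.
  have z0 : z != 0 by rewrite -cmod_gt0 zr.
  rewrite (_ : F z / _ = ((r ^+ 2)^-1 / cmod (z - m) ^+ 2)%:C%C * (F z * z^*%C)); last first.
    rewrite [(r ^- 2 / _)%:C%C]realCM 2!realCV -zr -(mulJc z); field.
    by rewrite !fmorph_eq0 cmod_eq0 subr_eq0 zm z0.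
  rewrite ReZ.
  have num : Re (F z * z^*%C) <= r * ((1 - r) * (1 + 2 * cmod b)).
    have -> : Re (F z * z^*%C) = Re (psi z * z^*%C) - r ^+ 2 -
        (1 - r ^+ 2) * Re (b * z^*%C).
      rewrite /F -zr sqr_cmod !expr2 !ReImE; ring.
    have p1 : Re (psi z * z^*%C) <= r.
      rewrite (le_trans (Re_le_cmod _))// cmodM cmodJ zr -[leRHS]mul1r ler_wpM2r//.
        exact: ltW.
      by apply: psi1; rewrite zr.
    have p2 : - Re (b * z^*%C) <= cmod b * r.
      by rewrite -ReN (le_trans (Re_le_cmod _))// cmodN cmodM cmodJ zr.
    have p3 : (1 - r ^+ 2) * - Re (b * z^*%C) <= (1 - r ^+ 2) * (cmod b * r).
      by rewrite ler_wpM2l//; nra.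
    have p4 : (1 - r ^+ 2) * (cmod b * r) <= 2 * (1 - r) * (cmod b * r).
      rewrite ler_wpM2r ?mulr_ge0 ?(ltW r0')//; nra.
    lra.
  have den : k <= r * cmod (z - m) ^+ 2.
    have h1 : (1 - cmod m) / 2 <= cmod (z - m) by have := cmod_sub z m; lra.
    have h2 : ((1 - cmod m) / 2) ^+ 2 <= cmod (z - m) ^+ 2.
      by rewrite ler_pXn2r ?nnegrE//; lra.
    rewrite /k [leRHS]mulrC.
    by apply: ler_pM => //; [exact: sqr_ge0|lra].
  have pos : 0 <= (1 - r) * (1 + 2 * cmod b).
    by have := cmod_ge0 b; move=> ?; apply: mulr_ge0; lra.
  apply: (@le_trans _ _ ((r ^+ 2)^-1 / cmod (z - m) ^+ 2 *
      (r * ((1 - r) * (1 + 2 * cmod b))))).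
    by rewrite ler_wpM2l// divr_ge0 ?invr_ge0 ?sqr_ge0.
  rewrite [leLHS](_ : _ = (1 - r) * (1 + 2 * cmod b) / (r * cmod (z - m) ^+ 2)); last first.
    by field; rewrite cmod_eq0 subr_eq0 zm gt_eqF.
  rewrite /M (_ : _ * (1 - r) = (1 - r) * (1 + 2 * cmod b) / k); last by field; rewrite gt_eqF.
  rewrite ler_wpM2l// lef_pV2 ?posrE//; exact: lt_le_trans den.
have mp : Re (ball_quotient F m d r l) <= M.
  apply: (@maximum_principle R _ m r M) => //; last exact: ltW.
    move=> z zr zm.
    exact: (ball_quotient_differentiable d mr' (ltW zr) (dF z (lt_trans zr r1)) zm).
  by move=> z zr; exact: (ball_quotient_continuous mr' zr (dF z (le_lt_trans zr r1)) Fd).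
move: mp; rewrite ball_quotientE// invfM [F l * _]mulrA -/P.
set w := (r ^+ 2)%:C%C - m^*%C * l => mp.
have w0 : w != 0 by apply: ball_denominator_neq0; lra.
have w2 : cmod w <= 2.
  rewrite (le_trans (cmodB _ _))// cmodM cmodJ cmod_real ger0_norm ?sqr_ge0//.
  have : cmod m * cmod l <= 1 * 1 by apply: ler_pM => //; lra.
  nra.
have M0 : 0 <= M.
  have b0 := cmod_ge0 b; apply: mulr_ge0; last by lra.
  by apply: divr_ge0; [lra|exact: ltW].
have e1 : Re (P * w^*%C) <= 4 * M.
  rewrite (_ : P * w^*%C = (cmod w ^+ 2)%:C%C * (P / w)); last first.
    by rewrite -mulJc; field.
  rewrite ReZ; apply: (@le_trans _ _ (cmod w ^+ 2 * M)).
    by rewrite ler_wpM2l// sqr_ge0.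
  rewrite ler_wpM2r//; have := cmod_ge0 w; nra.
have wE (p : R[i]) : p * (1 - m^*%C * l)^*%C = p * w^*%C + (1 - r ^+ 2)%:C%C * p.
  by rewrite /w; apply: eqcP; rewrite !ReImE/=; ring.
rewrite wE ReD ReZ.
have e2 : (1 - r ^+ 2) * Re P <= 2 * (1 - r) * cmod P.
  apply: (@le_trans _ _ ((1 - r ^+ 2) * cmod P)).
    by rewrite ler_wpM2l ?Re_le_cmod//; nra.
  by rewrite ler_wpM2r//; nra.
by rewrite /M in e1; lra.
Qed.

(** The argument is algebraic. For [m = 0] the relation says that [E l - (A - A^* l^2)] is
    [i g(l) l] with [g(l)] real. For two points [m], [l] not on one real line through 0 it then
    gives [g l = g m], and all points are linked through [1 / 2] and [i / 2]. *)
Lemma generator_rigidity E :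
  (forall m l b, cmod m < 1 -> cmod l < 1 -> l != m -> b - b^*%C * m ^+ 2 = E m ->
     Re ((E l - (b - b^*%C * l ^+ 2)) / ((l - m) * (1 - m^*%C * l))) = 0) ->
  exists g : R, forall l, cmod l < 1 ->
    E l = E 0 - (E 0)^*%C * l ^+ 2 + 'i%C * g%:C%C * l.
Proof.
move=> Erel; set A := E 0.
pose g l := Im ((E l - (A - A^*%C * l ^+ 2)) / l).
have Eg l : cmod l < 1 -> E l = A - A^*%C * l ^+ 2 + 'i%C * (g l)%:C%C * l.
  move=> l1; have [->|l0] := eqVneq l 0; first by rewrite expr0n/= !mulr0 subr0 addr0.
  have := Erel 0 l A; rewrite conjc0 mul0r !subr0 mulr1 cmod0 ltr01 l1 l0.
  rewrite expr0n/= mulr0 subr0 => /(_ isT isT isT erefl) Re0.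
  have : (E l - (A - A^*%C * l ^+ 2)) / l = 'i%C * (g l)%:C%C.
    have imE (z : R[i]) : Re z = 0 -> z = 'i%C * (Im z)%:C%C.
      by case: z => x y /= ->; apply: eqcP => /=; ring.
    exact: imE.
  by move/(canRL (divfK l0)) => H; apply/eqP; rewrite addrC -subr_eq; apply/eqP.
have gE m l : cmod m < 1 -> cmod l < 1 -> Im (m^*%C * l) != 0 -> g l = g m.
  move=> m1 l1 ml; have lm : l != m.
    by apply/eqP => lm; move: ml; rewrite lm mulrC mulJc/= eqxx.
  have l0 : l != 0 by apply/eqP => l0; move: ml; rewrite l0 mulr0 eqxx.
  pose k := (1 + cmod m ^+ 2)^-1.
  have kE : k * (1 + cmod m ^+ 2) = 1.
    by rewrite /k mulVf// gt_eqF//; have := sqr_ge0 (cmod m); lra.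
  (* This solves [eta - eta^* m^2 = i g(m) m], so [A + eta] is the parameter [b] belonging to
     [m]. *)
  pose eta := 'i%C * (g m * k)%:C%C * m.
  have := Erel m l (A + eta) m1 l1 lm.
  have -> : A + eta - (A + eta)^*%C * m ^+ 2 = E m.
    have gk : (g m)%:C%C = (g m * (k * (1 + cmod m ^+ 2)))%:C%C :> R[i].
      by rewrite kE mulr1.
    rewrite (Eg m m1) gk /eta !realCM realCD realC1 sqr_cmodE.
    by rewrite !conjCE; move: (A^*%C) (m^*%C) (g m)%:C%C k%:C%C => u v x y; ring.
  move=> /(_ erefl); rewrite (Eg l l1).
  set Y := (l - m) * _.
  have -> : A - A^*%C * l ^+ 2 + 'i%C * (g l)%:C%C * l - (A + eta - (A + eta)^*%C * l ^+ 2)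
     = 'i%C * (g l - g m)%:C%C * l + 'i%C * (g m * k)%:C%C * Y.
    have -> : (g l - g m)%:C%C = (g l)%:C%C - (g m * (k * (1 + cmod m ^+ 2)))%:C%C :> R[i].
      by rewrite kE mulr1 rmorphB.
    rewrite /eta /Y !realCM realCD realC1 sqr_cmodE !conjCE.
    by move: (A^*%C) (m^*%C) (g m)%:C%C (g l)%:C%C k%:C%C => u v x z y; ring.
  have Y0 : Y != 0.
    rewrite mulf_neq0 ?subr_eq0//; apply/eqP => h.
    by move: ml; rewrite -h eqxx.
  rewrite mulrDl mulfK// ReD.
  rewrite (_ : 'i%C * _ * l / Y = ((g l - g m) / cmod Y ^+ 2)%:C%C * ('i%C * (l * Y^*%C))); last first.
    rewrite [((_ - _) / _)%:C%C]realCM realCV -mulJc; field.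
    by rewrite Y0 conjc_eq0 Y0.
  rewrite ReZ (_ : Re ('i%C * (g m * k)%:C%C) = 0); last by rewrite !ReImE/=; ring.
  rewrite addr0 (_ : Re ('i%C * (l * Y^*%C)) = Im (m^*%C * l) * (1 - cmod l ^+ 2)); last first.
    rewrite sqr_cmod /Y !ReImE/=; ring.
  move/eqP; rewrite !mulf_eq0 (negbTE ml)/= invr_eq0 sqrf_eq0 cmod_eq0 (negbTE Y0) orbF.
  have : 0 < 1 - cmod l ^+ 2 by have := cmod_ge0 l; nra.
  by move/gt_eqF => ->; rewrite orbF subr_eq0 => /eqP.
have h1 : cmod (2^-1%:C%C : R[i]) < 1 by rewrite cmod_real ger0_norm ?invr_ge0//; lra.
have h2 : cmod ('i%C * 2^-1%:C%C : R[i]) < 1 by rewrite cmodM cmod_i mul1r.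
exists (g 2^-1%:C%C) => l l1; rewrite (Eg l l1).
have [->|l0] := eqVneq l 0; first by rewrite !mulr0.
have [Il|Il] := eqVneq (Im l) 0; last first.
  by rewrite (gE 2^-1%:C%C l)// !ReImE/= oppr0 mul0r addr0 mulf_neq0// invr_neq0.
have Rl : Re l != 0.
  by apply: contra l0 => /eqP Rl; apply/eqP/eqcP; rewrite ?Rl ?Il.
rewrite (gE ('i%C * 2^-1%:C%C) l)//; last first.
  rewrite (_ : Im _ = - (2^-1 * Re l)); last by rewrite !ReImE/= Il; ring.
  by rewrite oppr_eq0 mulf_neq0// invr_neq0.
rewrite (gE 2^-1%:C%C ('i%C * 2^-1%:C%C))//.
rewrite (_ : Im _ = 2^-1 * 2^-1); last by rewrite !ReImE/=; ring.
by rewrite mulf_neq0// invr_neq0.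
Qed.

End disc_self_maps.

(** * Fields tangent to the circle or pointing into the disc *)

Section inward_fields.
Context (R : realType).
Local Notation Re := complex.Re.
Local Notation Im := complex.Im.
Implicit Types (h E F : R[i] -> R[i]) (l m b : R[i]) (r : R).

Lemma Re_divJ (z w : R[i]) : Re (z / w) = Re (z * w^*%C) / cmod w ^+ 2.
Proof.
have [->|w0] := eqVneq w 0; first by rewrite invr0 conjc0 !mulr0 /= mul0r.
rewrite (_ : z / w = (cmod w ^- 2)%:C%C * (z * w^*%C)); first by rewrite ReZ mulrC.
rewrite realCV -mulJc; field.
by rewrite w0 conjc_eq0 w0.
Qed.

Lemma cdifferentiableZ F (c : R[i]) l :
  cdifferentiable F l -> cdifferentiable (fun z => c * F z) l.
Proof. exact: differentiableZ. Qed.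

Lemma cdifferentiable_ccontinuous F l : cdifferentiable F l -> ccontinuous F l.
Proof. by move=> /differentiable_cexpansion[d]; exact: cexpansion_continuous. Qed.

Lemma circle_max_lt0 F r : 0 < r ->
  (forall l, cmod l = r -> ccontinuous F l) ->
  (forall l, cmod l = r -> Re (F l) < 0) ->
  exists2 c : R, 0 < c & forall l, cmod l = r -> Re (F l) <= - c.
Proof.
move=> r0 cF F0.
have [|l0 /andP[h1 h2] l0max] := @annulus_EVT R (fun l => Re (F l)) r r (ltW r0) (lexx _).
  move=> l /andP[h1 h2]; apply: ccontinuous_Re; apply: cF.
  by apply/eqP; rewrite eq_le h2 h1.
have l0r : cmod l0 = r by apply/eqP; rewrite eq_le h2 h1.
exists (- Re (F l0)); first by rewrite oppr_gt0 F0.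
by move=> l lr; rewrite opprK l0max// lr lexx.
Qed.

(* If [F] had no zero, the maximum principle applied to [l / F l], whose real
   part is negative on the circle, would be violated at the origin. *)
Lemma inward_zero_exists F r : 0 < r ->
  (forall l, cmod l <= r -> cdifferentiable F l) ->
  (forall l, cmod l = r -> Re (F l * l^*%C) < 0) ->
  exists2 l, cmod l < r & F l = 0.
Proof.
move=> r0 dF F0; apply: contrapT => noz.
have Fn0 l : cmod l <= r -> F l != 0.
  move=> lr; apply/eqP => Fl0; apply: noz; exists l => //.
  rewrite lt_neqAle lr andbT; apply/eqP => lrE.
  by have := F0 l lrE; rewrite Fl0 mul0r/= ltxx.
pose q l := l * (F l)^-1.
have dq l : cmod l <= r -> cdifferentiable q l.
  move=> lr; apply: differentiableM; first by [].
  by apply: differentiableV; [exact: dF|exact: Fn0].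
have [||c c0 cP] := @circle_max_lt0 q r r0.
- by move=> l lr; apply: cdifferentiable_ccontinuous; apply: dq; rewrite lr.
- move=> l lr; rewrite /q Re_divJ pmulr_llt0.
    rewrite (_ : Re _ = Re (F l * l^*%C)) ?F0//.
    by rewrite !ReImE; ring.
  by rewrite invr_gt0 exprn_gt0// cmod_gt0 Fn0// lr.
have := @maximum_principle R q (2 * r)%:C%C r (- c) r0 _ _ cP 0.
rewrite cmod0 (ltW r0) /q mul0r/= => H.
have : 0 <= - c; last by lra.
apply: H => // l lr; last exact/cdifferentiable_ccontinuous/dq.
by move=> _; apply/differentiable_cexpansion/dq/ltW.
Qed.

(** Dividing by [(l - m) (r^2 - m^* l)] removes the zero and keeps the sign on the circle, hence in
    the disc. The strictly negative bound excludes a second zero and bounds the cofactor of [l - m]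
    from below. *)
Lemma inward_zero_quotient F r m : 0 < r ->
  (forall l, cmod l <= r -> cdifferentiable F l) ->
  (forall l, cmod l = r -> Re (F l * l^*%C) < 0) ->
  cmod m < r -> F m = 0 ->
  exists d, cexpansion F m d /\ exists2 c : R, 0 < c &
    forall l, cmod l <= r -> Re (ball_quotient F m d r l) <= - c.
Proof.
move=> r0 dF F0 mr Fm0.
have [d Fd] := differentiable_cexpansion (dF m (ltW mr)); exists d; split => //.
have cQ l : cmod l <= r -> ccontinuous (ball_quotient F m d r) l.
  by move=> lr; apply: ball_quotient_continuous => //; exact: dF.
have [||c c0 cP] := @circle_max_lt0 (ball_quotient F m d r) r r0.
- by move=> l lr; apply: cQ; rewrite lr.
- move=> l lr; have lm : l != m by apply: contraTneq mr => <-; rewrite lr ltxx.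
  rewrite ball_quotientE// circle_denominator// Re_divJ.
  have k0 : 0 < cmod (l - m) ^+ 2 by rewrite exprn_gt0// cmod_gt0 subr_eq0.
  have l0 : l != 0 by rewrite -cmod_gt0 lr.
  rewrite pmulr_llt0; last first.
    rewrite invr_gt0 exprn_gt0// cmodM cmod_real ger0_norm ?(ltW k0)//.
    by rewrite mulr_gt0// cmod_gt0.
  rewrite (_ : Re _ = cmod (l - m) ^+ 2 * Re (F l * l^*%C)).
    by rewrite pmulr_rlt0 ?F0.
  by move: (cmod _ ^+ 2) => k; rewrite !ReImE/=; ring.
exists c => // l lr; apply: (@maximum_principle R _ m r (- c)) => //.
move=> z zr zm; apply: ball_quotient_differentiable => //; first exact: ltW.
exact/dF/ltW.
Qed.

Lemma ball_quotientK F m d r l : F m = 0 -> cmod m < r -> cmod l <= r ->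
  F l = ball_quotient F m d r l * ((l - m) * ((r ^+ 2)%:C%C - m^*%C * l)).
Proof.
move=> Fm0 mr lr; have [->|lm] := eqVneq l m; first by rewrite Fm0 subrr mul0r mulr0.
rewrite ball_quotientE// divfK// mulf_neq0//; first by rewrite subr_eq0.
exact: ball_denominator_neq0.
Qed.

(** If [l^* h] is real on the circle, [i h] is tangent to it and the quotient has real part 0 there.
    The opposite inequality comes from [- h], which is of the same kind. *)
Lemma real_on_circle_le h m b l :
  (forall l, cmod l <= 1 -> cdifferentiable h l) ->
  (forall l, cmod l = 1 -> Im (h l * l^*%C) = 0) ->
  cmod m < 1 -> cmod l < 1 -> l != m ->
  b - b^*%C * m ^+ 2 = 'i%C * h m ->
  Re (('i%C * h l - (b - b^*%C * l ^+ 2)) / ((l - m) * (1 - m^*%C * l))) <= 0.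
Proof.
move=> dh h0 m1 l1 lm bE; pose F l := 'i%C * h l - (b - b^*%C * l ^+ 2).
have dF z : cmod z <= 1 -> cdifferentiable F z.
  move=> z1; apply: differentiableB.
    by apply: differentiableM => //; exact: dh.
  by apply: differentiableB => //; apply: differentiableM => //; apply: differentiableX.
have Fm0 : F m = 0 by rewrite /F bE subrr.
have [d Fd] := differentiable_cexpansion (dF m (ltW m1)).
have := @maximum_principle R (ball_quotient F m d 1) m 1 0 ltr01 _ _ _ l (ltW l1).
rewrite ball_quotientE// expr1n; apply.
- by move=> z z1 zm;
    apply: (ball_quotient_differentiable d m1 (ltW z1) (dF z (ltW z1)) zm).
- by move=> z z1; apply: (ball_quotient_continuous m1 z1 (dF z z1) Fd).
- move=> z z1; have zm : z != m by apply: contraTneq m1 => <-; rewrite z1 ltxx.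
  rewrite ball_quotientE// circle_denominator// Re_divJ.
  rewrite (_ : Re _ = 0) ?mul0r//.
  have -> : Re (F z * (z * (cmod (z - m) ^+ 2)%:C)^*%C) =
      - cmod (z - m) ^+ 2 * (Im (h z * z^*%C) +
       (1 - cmod z ^+ 2) * Re (b * z^*%C)).
    by rewrite !sqr_cmod /F !expr2 !ReImE/=; ring.
  by rewrite h0// z1 expr1n subrr mul0r addr0 mulr0.
Qed.

(** Rigidity applies to the tangent field [i h] in the open disc, and continuity along radii carries
    the formula to the circle. This takes the place of a comparison of Fourier coefficients. *)
Lemma real_on_circle_quadratic h :
  (forall l, cmod l <= 1 -> cdifferentiable h l) ->
  (forall l, cmod l = 1 -> Im (h l * l^*%C) = 0) ->
  exists g : R, forall l, cmod l <= 1 ->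
    h l = h 0 + g%:C%C * l + (h 0)^*%C * l ^+ 2.
Proof.
move=> dh h0.
have [|g gP] := @generator_rigidity R (fun l => 'i%C * h l).
  move=> m l b m1 l1 lm bE; apply/eqP; rewrite eq_le real_on_circle_le//=.
  rewrite -oppr_le0 -ReN -mulNr.
  have -> : - ('i%C * h l - (b - b^*%C * l ^+ 2)) =
      'i%C * - h l - (- b - (- b)^*%C * l ^+ 2).
    by rewrite rmorphN/=; ring.
  apply: (@real_on_circle_le (fun z => - h z) m (- b) l _ _ m1 l1 lm).
  - by move=> z z1; apply: differentiableN; exact: dh.
  - by move=> z z1; rewrite mulNr ImN h0 ?oppr0.
  - by rewrite mulrN -bE conjCN; ring.
pose k l := h l - (h 0 + g%:C%C * l + (h 0)^*%C * l ^+ 2).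
have k0 l : cmod l < 1 -> k l = 0.
  move=> /gP H; apply/eqP; rewrite subr_eq0; apply/eqP.
  have i0 : 'i%C != 0 :> R[i] by rewrite -cmod_gt0 cmod_i.
  by apply: (mulfI i0); rewrite H !conjCE; ring.
exists g => l l1; apply/eqP; rewrite -subr_eq0 -/(k l) -cmod_eq0 eq_le cmod_ge0 andbT.
apply/ler_addgt0Pl => e e0; rewrite addr0.
have dk : ccontinuous k l.
  apply: cdifferentiable_ccontinuous; apply: differentiableB; first exact: dh.
  apply: differentiableD; first by apply: differentiableD => //; apply: differentiableM.
  by apply: differentiableM => //; apply: differentiableX.
have [d d0 dP] := dk e e0.
pose t := 1 - Num.min (d / 2) (1 / 2).
have t1 : 0 <= t < 1.
  rewrite /t subr_ge0 ge_min; apply/andP; split; first by apply/orP; right; lra.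
  by rewrite ltrBlDr ltrDl lt_min divr_gt0//=; lra.
have td : 1 - t <= d.
  by rewrite /t opprB addrC subrK ge_min; apply/orP; left; lra.
clearbody t; have /andP[t0 t1'] := t1.
have := dP (t%:C%C * l).
rewrite (_ : t%:C%C * l - l = (t - 1)%:C%C * l); last first.
  by rewrite rmorphB/= rmorph1; ring.
rewrite cmodM cmod_real distrC ger0_norm ?subr_ge0 ?(ltW t1')// => H.
rewrite -[k l]opprK cmodN -[- k l]add0r -(k0 (t%:C%C * l)); last first.
  rewrite cmodM cmod_real ger0_norm// (le_lt_trans _ t1')//.
  by rewrite -[leRHS]mulr1 ler_wpM2l.
apply: H; apply: le_trans td; rewrite -[leRHS]mulr1 ler_wpM2l//.
by rewrite subr_ge0 ltW.
Qed.

(** The inequality for each map [psi t] is divided by [t]. Its parameter [bt] depends on [t]; a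
    bounded solution operator [L] for [c - c^* m^2 = w] shows that [bt] is [t b] up to an error of
    smaller order. *)
Lemma self_map_family_generator (psi : R -> R[i] -> R[i]) E (del : R) m l b :
  0 < del ->
  (forall t, 0 < t < del -> forall l, cmod l < 1 -> cdifferentiable (psi t) l) ->
  (forall t, 0 < t < del -> forall l, cmod l < 1 -> cmod (psi t l) <= 1) ->
  (forall l, cmod l < 1 -> forall e : R, 0 < e -> exists2 del' : R, 0 < del' &
     forall t, 0 < t < del' -> cmod (psi t l - l - t%:C%C * E l) <= e * t) ->
  cmod m < 1 -> cmod l < 1 -> l != m -> b - b^*%C * m ^+ 2 = E m ->
  Re ((E l - (b - b^*%C * l ^+ 2)) / ((l - m) * (1 - m^*%C * l))) <= 0.
Proof.
move=> del0 dpsi psi1 Eder m1 l1 lm bE.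
set Y := (l - m) * _; set X := Re _.
have Y0 : Y != 0.
  rewrite mulf_neq0 ?subr_eq0//.
  have := @ball_denominator_neq0 R l m 1 (ltW l1) m1.
  by rewrite expr1n rmorph1 subr_eq0.
have cY : 0 < cmod Y by rewrite cmod_gt0.
pose k := 1 - cmod m ^+ 4.
have k0 : 0 < k by rewrite subr_gt0 exprn_ilt1.
(* Eliminating [c^*] between [c - c^* m^2 = w] and its conjugate leaves
   [(1 - |m|^4) c = w + w^* m^2]. *)
pose L w := k^-1%:C%C * (w + w^*%C * m ^+ 2).
have LE w : L w - (L w)^*%C * m ^+ 2 = w.
  have kk : k^-1 * (1 - cmod m ^+ 2 * cmod m ^+ 2) = 1.
    by rewrite -exprD mulVf ?gt_eqF.
  transitivity ((k^-1 * (1 - cmod m ^+ 2 * cmod m ^+ 2))%:C%C * w); last first.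
    by rewrite kk mul1r.
  rewrite /L !conjCE realCM realCD realCN realCM sqr_cmodE realC1; ring.
have Lb w c : c - c^*%C * m ^+ 2 = w -> c = L w.
  move=> cE; rewrite -cE /L.
  have kk : k^-1 * (1 - cmod m ^+ 2 * cmod m ^+ 2) = 1.
    by rewrite -exprD mulVf ?gt_eqF.
  transitivity ((k^-1 * (1 - cmod m ^+ 2 * cmod m ^+ 2))%:C%C * c).
    by rewrite kk mul1r.
  by rewrite !conjCE realCM realCD realCN realCM sqr_cmodE realC1; ring.
have Lle w : cmod (L w) <= 2 / k * cmod w.
  rewrite /L cmodM cmod_real ger0_norm ?invr_ge0 ?(ltW k0)// mulrAC mulrC.
  rewrite ler_wpM2r ?invr_ge0 ?(ltW k0)// (le_trans (cmodD _ _))//.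
  rewrite cmodM cmodJ cmodX.
  have : cmod w * cmod m ^+ 2 <= cmod w.
    by rewrite -[leRHS]mulr1 ler_wpM2l// exprn_ile1// ltW.
  lra.
(* The expansion at [l] costs [e * t] once; the one at [m] passes through [L], of norm at most
   [2 / k], and enters twice, through the parameter and its conjugate. *)
have [C C0 CP] : exists2 C : R, 0 < C & forall e : R, 0 < e -> X <= C * e.
  exists ((1 + 2 * (2 / k)) / cmod Y).
    rewrite divr_gt0//; have : 0 < 2 / k by rewrite divr_gt0.
    lra.
  move=> e e0.
  have [d1 d10 d1P] := Eder l l1 e e0; have [d2 d20 d2P] := Eder m m1 e e0.
  have [t [t0 td td1 td2]] : exists t : R, [/\ 0 < t, t < del, t < d1 & t < d2].
    exists (Num.min del (Num.min d1 d2) / 2).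
    have h0 : 0 < Num.min del (Num.min d1 d2) by rewrite !lt_min del0 d10.
    have h1 : Num.min del (Num.min d1 d2) <= del by rewrite ge_min lexx.
    have h2 : Num.min del (Num.min d1 d2) <= d1 by rewrite !ge_min lexx !orbT.
    have h3 : Num.min del (Num.min d1 d2) <= d2 by rewrite !ge_min lexx !orbT.
    by split; lra.
  have h1 := d1P t; have h2 := d2P t; rewrite t0 td1 td2 in h1 h2.
  have {}h1 := h1 isT; have {}h2 := h2 isT.
  have tI : 0 < t < del by rewrite t0 td.
  pose w := psi t m - m; pose bt := L w.
  have Xt := self_map_generator (dpsi t tI) (psi1 t tI) m1 (LE w) l1 lm.
  rewrite -/Y -/bt in Xt.
  have -> : X = t^-1 * (Re ((psi t l - l - (bt - bt^*%C * l ^+ 2)) / Y) -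
     Re ((psi t l - l - t%:C%C * E l - ((bt - t%:C%C * b) - (bt - t%:C%C * b)^*%C * l ^+ 2)) / Y)).
    rewrite -ReB -mulrBl (_ : _ - _ - _ = t%:C%C * (E l - (b - b^*%C * l ^+ 2))); last first.
      by rewrite !conjCE; ring.
    by rewrite -mulrA ReZ mulKf ?gt_eqF.
  rewrite ler_pdivrMl//.
  set W := psi t l - l - t%:C%C * E l - _.
  have : - Re (W / Y) <= t * ((1 + 2 * (2 / k)) / cmod Y * e); last by lra.
  rewrite -ReN (le_trans (Re_le_cmod _))// cmodN cmodM cmodV.
  rewrite (_ : t * _ = (1 + 2 * (2 / k)) * (e * t) / cmod Y); last by ring.
  rewrite ler_wpM2r ?invr_ge0// /W (le_trans (cmodB _ _))//.
  have hb : cmod (bt - t%:C%C * b) <= 2 / k * (e * t).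
    have -> : bt - t%:C%C * b = L (w - t%:C%C * E m).
      by apply: Lb; rewrite -(LE w) -/bt -bE !conjCE; ring.
    by rewrite (le_trans (Lle _))// ler_wpM2l// divr_ge0// ltW.
  have : cmod (bt - t%:C%C * b - (bt - t%:C%C * b)^*%C * l ^+ 2) <=
      2 * cmod (bt - t%:C%C * b).
    rewrite (le_trans (cmodB _ _))// cmodM cmodJ cmodX.
    have : cmod (bt - t%:C%C * b) * cmod l ^+ 2 <= cmod (bt - t%:C%C * b).
      by rewrite -[leRHS]mulr1 ler_wpM2l// exprn_ile1// ltW.
    lra.
  lra.
rewrite leNgt; apply/negP => X0.
have := CP (X / (2 * C)); rewrite divr_gt0 ?mulr_gt0// => /(_ isT).
rewrite (_ : C * _ = X / 2); first by lra.
by field; rewrite gt_eqF.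
Qed.

End inward_fields.

(** * Measures with a density *)

Section density.
Context d (T : measurableType d) (R : realType).
Variables (m : {measure set T -> \bar R}) (w : T -> R).
Hypotheses (w0 : forall x, 0 <= w x) (mw : measurable_fun setT w).
Local Open Scope ereal_scope.

Definition density (w0 : forall x, (0 <= w x)%R) (mw : measurable_fun setT w)
  (A : set T) : \bar R := \int[m]_(x in A) (w x)%:E.

Local Notation wm := (density w0 mw).

Let density0 : wm set0 = 0. Proof. by rewrite /density integral_set0. Qed.

Let density_ge0 A : 0 <= wm A.
Proof. by apply: integral_ge0 => x _; rewrite lee_fin. Qed.

Let density_sigma_additive : semi_sigma_additive wm.
Proof.
by apply: semi_sigma_additive_nng_induced => [|x]; [exact/measurable_EFinP|rewrite lee_fin].
Qed.

HB.instance Definition _ := isMeasure.Build _ _ _ wm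
  density0 density_ge0 density_sigma_additive.

Import HBNNSimple.

Lemma integral_density (f : T -> \bar R) : (forall x, 0 <= f x) ->
  measurable_fun setT f ->
  \int[wm]_x f x = \int[m]_x (f x * (w x)%:E).
Proof.
move=> f0 mf; pose h := nnsfun_approx measurableT mf.
have mwE : measurable_fun setT (EFin \o w) by exact/measurable_EFinP.
have mh n : measurable_fun setT (EFin \o h n).
  by apply/measurable_EFinP; exact/measurable_funP.
have ndh x : {homo (fun n => (EFin \o h n) x) : a b / (a <= b)%N >-> a <= b}.
  by move=> a b ab; rewrite lee_fin; exact/lefP/nd_nnsfun_approx.
have fE x : f x = lim ((EFin \o h n) x @[n --> \oo]).
  by apply/esym/cvg_lim => //; apply: cvg_nnsfun_approx.
have -> : \int[wm]_x f x = lim (\int[wm]_x (EFin \o h n) x @[n --> \oo]).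
  under eq_integral => x _ do rewrite fE.
  by apply: monotone_convergence => //; move=> n x _ /=; rewrite lee_fin.
have -> : \int[m]_x (f x * (w x)%:E) =
    lim (\int[m]_x ((EFin \o h n) x * (w x)%:E) @[n --> \oo]).
  have fw x : f x * (w x)%:E = lim ((EFin \o h n) x * (w x)%:E @[n --> \oo]).
    by apply/esym/cvg_lim => //; apply: cvgeZr => //; apply: cvg_nnsfun_approx.
  under eq_integral => x _ do rewrite fw.
  apply: monotone_convergence => //.
  - by move=> n; apply: emeasurable_funM.
  - by move=> n x _; rewrite mule_ge0 ?lee_fin.
  - by move=> x _ a b ab; rewrite lee_wpmul2r ?lee_fin//; exact/lefP/nd_nnsfun_approx.
suff suf n : \int[wm]_x (EFin \o h n) x = \int[m]_x ((EFin \o h n) x * (w x)%:E).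
  by under eq_fun do rewrite suf.
have hE x : (EFin \o h n) x =
    \sum_(y \in range (h n)) (y * \1_(h n @^-1` [set y]) x)%:E.
  by rewrite /= fimfunE -fsumEFin.
have hge0 y x : 0 <= (y * \1_(h n @^-1` [set y]) x)%:E by exact: nnfun_muleindic_ge0.
have mhy y : measurable_fun setT (fun x => (y * \1_(h n @^-1` [set y]) x)%:E).
  by apply/measurable_EFinP; exact: measurable_funM.
under [LHS]eq_integral => x _ do rewrite hE.
rewrite ge0_integral_fsum//.
transitivity (\int[m]_x (\sum_(y \in range (h n))
    (y * \1_(h n @^-1` [set y]) x)%:E * (w x)%:E)); last first.
  by apply: eq_integral => x _; rewrite hE ge0_mule_fsuml.
rewrite ge0_integral_fsum//; last 2 first.
  by move=> y; apply: emeasurable_funM.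
  by move=> y x _; apply: mule_ge0; [exact: hge0|rewrite lee_fin].
apply: eq_fsbigr => y /set_mem[t _ yt].
have y0 : 0 <= y%:E by rewrite -yt lee_fin.
have mA : measurable (h n @^-1` [set y]) by [].
under eq_integral do rewrite EFinM.
rewrite ge0_integralZl//; last first.
  by apply/measurable_EFinP; exact: measurable_indic.
rewrite integral_indic// setIT.
under eq_integral do rewrite EFinM -muleA.
rewrite ge0_integralZl//; last 2 first.
  by apply: emeasurable_funM => //; apply/measurable_EFinP; exact: measurable_indic.
  by move=> x _; rewrite mule_ge0 ?lee_fin.
congr (_ * _).
rewrite -[LHS]/(\int[m]_(x in h n @^-1` [set y]) (w x)%:E) [LHS]integral_mkcond.
apply: eq_integral => x _.
by rewrite epatch_indic muleC.
Qed.

End density.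

(** * Bounded measurable functions *)

Section bounded_measurable.
Context d (T : measurableType d) (R : realType).
Implicit Types (f g k l : T -> R).

(** All test functions below are of this kind: they are integrable against every finite measure, and
    so are their products with integrable densities. *)
Definition bmeas f := measurable_fun setT f /\ exists M : R, forall x, `|f x| <= M.

Lemma bmeasD f g : bmeas f -> bmeas g -> bmeas (fun x => f x + g x).
Proof.
move=> [mf [M fM]] [mg [N gN]]; split; first exact: measurable_funD.
by exists (M + N) => x; rewrite (le_trans (ler_normD _ _))// lerD.
Qed.

Lemma bmeasM f g : bmeas f -> bmeas g -> bmeas (fun x => f x * g x).
Proof.
move=> [mf [M fM]] [mg [N gN]]; split; first exact: measurable_funM.
by exists (M * N) => x; rewrite normrM ler_pM.
Qed.

Lemma bmeas_cst (c : R) : bmeas (fun=> c).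
Proof. by split; [exact: measurable_cst|exists `|c|]. Qed.

Lemma bmeasZ (c : R) f : bmeas f -> bmeas (fun x => c * f x).
Proof. by move=> bf; apply: bmeasM => //; exact: bmeas_cst. Qed.

Lemma bmeasN f : bmeas f -> bmeas (fun x => - f x).
Proof.
move=> [mf [M fM]]; split; first exact: measurable_funN.
by exists M => x; rewrite normrN.
Qed.

Lemma bmeasB f g : bmeas f -> bmeas g -> bmeas (fun x => f x - g x).
Proof. by move=> bf bg; apply: bmeasD => //; exact: bmeasN. Qed.

Lemma bmeas_integrable (m : {finite_measure set T -> \bar R}) f :
  bmeas f -> m.-integrable setT (EFin \o f).
Proof.
move=> [mf [M fM]]; apply: measurable_bounded_integrable => //.
  by rewrite -ge0_fin_numE// fin_num_measure.
exists M; split; first exact: num_real.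
by move=> N MN x _ /=; rewrite (le_trans (fM x))// ltW.
Qed.

Lemma bmeas_integrableM (m : {measure set T -> \bar R}) f k : bmeas f ->
  m.-integrable setT (EFin \o k) -> m.-integrable setT (EFin \o (fun x => f x * k x)).
Proof.
move=> [mf [M fM]] ik.
have -> : EFin \o (fun x => f x * k x) = ((EFin \o f) \* (EFin \o k))%E.
  by apply/funext => x; rewrite /= EFinM.
apply: integrableMr => //; exists M; split; first exact: num_real.
by move=> N MN x _ /=; rewrite (le_trans (fM x))// ltW.
Qed.
End bounded_measurable.

(** * Integration against a signed measure given by densities *)

Section charge_integral.
Context d (T : measurableType d) (R : realType).
Variables (m1 m2 : {finite_measure set T -> \bar R}) (k l : T -> R).
Hypotheses (ik : m1.-integrable setT (EFin \o k)) (il : m2.-integrable setT (EFin \o l)).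
Implicit Type f : T -> R.

Let mk : measurable_fun setT k.
Proof. by apply/measurable_EFinP; exact: measurable_int ik. Qed.
Let ml : measurable_fun setT l.
Proof. by apply/measurable_EFinP; exact: measurable_int il. Qed.

Let pos_ge0 (u : T -> R) x : 0 <= u^\+ x. Proof. by rewrite /funrpos le_max lexx orbT. Qed.
Let neg_ge0 (u : T -> R) x : 0 <= u^\- x. Proof. by rewrite /funrneg le_max lexx orbT. Qed.
Let mpos (u : T -> R) : measurable_fun setT u -> measurable_fun setT u^\+.
Proof. exact: measurable_funrpos. Qed.
Let mneg (u : T -> R) : measurable_fun setT u -> measurable_fun setT u^\-.
Proof. exact: measurable_funrneg. Qed.

Let posB (u : T -> R) x : u^\+ x - u^\- x = u x.
Proof. exact: (congr1 (fun g : T -> R => g x) (funrposBneg u)). Qed.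

(** With [mixed_neg] this splits the signed measure into positive ones, in general not its Jordan
    parts, as [m1] and [m2] may overlap. *)
Definition mixed_pos : {measure set T -> \bar R} :=
  measure_add (density m1 (pos_ge0 k) (mpos mk)) (density m2 (pos_ge0 l) (mpos ml)).
Definition mixed_neg : {measure set T -> \bar R} :=
  measure_add (density m1 (neg_ge0 k) (mneg mk)) (density m2 (neg_ge0 l) (mneg ml)).

Let ge0_mixed (u v : T -> R) (u0 : forall x, 0 <= u x) (v0 : forall x, 0 <= v x)
    (mu : measurable_fun setT u) (mv : measurable_fun setT v) f :
  measurable_fun setT f -> (forall x, 0 <= f x) ->
  (\int[measure_add (density m1 u0 mu) (density m2 v0 mv)]_x (f x)%:E =
   \int[m1]_x (f x * u x)%:E + \int[m2]_x (f x * v x)%:E)%E.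
Proof.
move=> mf f0; have mfE : measurable_fun setT (EFin \o f) by exact/measurable_EFinP.
have f0E x : (0 <= (f x)%:E)%E by rewrite lee_fin.
rewrite ge0_integral_measure_add// (integral_density m1 u0 mu f0E mfE).
by rewrite (integral_density m2 v0 mv f0E mfE).
Qed.

Lemma mixed_posE A : measurable A ->
  mixed_pos A = (\int[m1]_(x in A) (k^\+ x)%:E + \int[m2]_(x in A) (l^\+ x)%:E)%E.
Proof. by move=> _; exact: measure_addE. Qed.

Lemma mixed_negE A : measurable A ->
  mixed_neg A = (\int[m1]_(x in A) (k^\- x)%:E + \int[m2]_(x in A) (l^\- x)%:E)%E.
Proof. by move=> _; exact: measure_addE. Qed.

Lemma mixed_pos_fin A : measurable A -> mixed_pos A \is a fin_num.
Proof.
move=> mA; rewrite mixed_posE// fin_numD; apply/andP; split;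
  apply: integrable_fin_num => //;
  apply: (@integrableS _ _ _ _ setT) => //; exact: integrable_funrpos.
Qed.

Lemma mixed_neg_fin A : measurable A -> mixed_neg A \is a fin_num.
Proof.
move=> mA; rewrite mixed_negE// fin_numD; apply/andP; split;
  apply: integrable_fin_num => //;
  apply: (@integrableS _ _ _ _ setT) => //; exact: integrable_funrneg.
Qed.

Lemma mixedE A : measurable A ->
  (mixed_pos A - mixed_neg A =
   \int[m1]_(x in A) (k x)%:E + \int[m2]_(x in A) (l x)%:E)%E.
Proof.
move=> mA.
have split (m : {finite_measure set T -> \bar R}) (u : T -> R) :
    m.-integrable setT (EFin \o u) ->
    (\int[m]_(x in A) (u x)%:E =
     \int[m]_(x in A) (u^\+ x)%:E - \int[m]_(x in A) (u^\- x)%:E)%E.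
  move=> iu; rewrite -integralB_EFin//.
  - by apply: eq_integral => x _; rewrite -EFinB posB.
  - by apply: (@integrableS _ _ _ _ setT) => //; exact: integrable_funrpos.
  - by apply: (@integrableS _ _ _ _ setT) => //; exact: integrable_funrneg.
have fin (m : {finite_measure set T -> \bar R}) (u : T -> R) :
    m.-integrable setT (EFin \o u) ->
    (\int[m]_(x in A) (u^\+ x)%:E)%E \is a fin_num /\
    (\int[m]_(x in A) (u^\- x)%:E)%E \is a fin_num.
  move=> iu; split; apply: integrable_fin_num => //;
    apply: (@integrableS _ _ _ _ setT) => //.
  - exact: integrable_funrpos.
  - exact: integrable_funrneg.
rewrite (split m1 k)// (split m2 l)// mixed_posE// mixed_negE//.
have [a1 a2] := fin m1 k ik; have [b1 b2] := fin m2 l il.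
by rewrite fin_num_oppeD// addeACA.
Qed.

Let mixed_integral_ge0 f : bmeas f -> (forall x, 0 <= f x) ->
  \int[mixed_pos]_x f x - \int[mixed_neg]_x f x =
  \int[m1]_x (f x * k x) + \int[m2]_x (f x * l x).
Proof.
move=> bf f0; have [mf _] := bf.
rewrite /Rintegral /mixed_pos /mixed_neg !ge0_mixed//.
have ikp : m1.-integrable setT (EFin \o k^\+) by exact: integrable_funrpos.
have ikn : m1.-integrable setT (EFin \o k^\-) by exact: integrable_funrneg.
have ilp : m2.-integrable setT (EFin \o l^\+) by exact: integrable_funrpos.
have iln : m2.-integrable setT (EFin \o l^\-) by exact: integrable_funrneg.
have fkp := integrable_fin_num measurableT (bmeas_integrableM bf ikp).
have fkn := integrable_fin_num measurableT (bmeas_integrableM bf ikn).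
have flp := integrable_fin_num measurableT (bmeas_integrableM bf ilp).
have fln := integrable_fin_num measurableT (bmeas_integrableM bf iln).
have -> : fine (\int[m1]_x (f x * k^\+ x)%:E + \int[m2]_x (f x * l^\+ x)%:E)%E =
    \int[m1]_x (f x * k^\+ x) + \int[m2]_x (f x * l^\+ x) by exact: fineD.
have -> : fine (\int[m1]_x (f x * k^\- x)%:E + \int[m2]_x (f x * l^\- x)%:E)%E =
    \int[m1]_x (f x * k^\- x) + \int[m2]_x (f x * l^\- x) by exact: fineD.
rewrite opprD addrACA -(RintegralB measurableT (bmeas_integrableM bf ikp)
  (bmeas_integrableM bf ikn)).
rewrite -(RintegralB measurableT (bmeas_integrableM bf ilp) (bmeas_integrableM bf iln)).
by congr (_ + _); apply: eq_Rintegral => x _; rewrite -mulrBr posB.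
Qed.

Lemma bmeas_integrable_mixed_pos f : bmeas f -> mixed_pos.-integrable setT (EFin \o f).
Proof.
move=> [mf [M fM]]; apply: measurable_bounded_integrable => //.
  by rewrite -ge0_fin_numE// mixed_pos_fin.
exists M; split; first exact: num_real.
by move=> N MN x _ /=; rewrite (le_trans (fM x))// ltW.
Qed.

Lemma bmeas_integrable_mixed_neg f : bmeas f -> mixed_neg.-integrable setT (EFin \o f).
Proof.
move=> [mf [M fM]]; apply: measurable_bounded_integrable => //.
  by rewrite -ge0_fin_numE// mixed_neg_fin.
exists M; split; first exact: num_real.
by move=> N MN x _ /=; rewrite (le_trans (fM x))// ltW.
Qed.

Lemma mixed_integral f : bmeas f ->
  \int[mixed_pos]_x f x - \int[mixed_neg]_x f x =
  \int[m1]_x (f x * k x) + \int[m2]_x (f x * l x).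
Proof.
move=> bf; have [_ [M fM]] := bf.
(* Adding the constant [|M|] makes the integrand nonnegative; its contribution is cancelled at the
   end. *)
have bM := @bmeas_cst d T R `|M|.
have bfM := bmeasD bf bM.
have fM0 x : 0 <= f x + `|M|.
  have := fM x; rewrite ler_norml => /andP[h _]; have := ler_norm M; lra.
have := mixed_integral_ge0 bfM fM0.
have := mixed_integral_ge0 bM (fun=> normr_ge0 M).
have ip := bmeas_integrable_mixed_pos; have iN := bmeas_integrable_mixed_neg.
rewrite (RintegralD measurableT (ip _ bf) (ip _ bM)).
rewrite (RintegralD measurableT (iN _ bf) (iN _ bM)).
have -> : \int[m1]_x ((f x + `|M|) * k x) =
    \int[m1]_x (f x * k x) + \int[m1]_x (`|M| * k x).
  rewrite -(RintegralD measurableT (bmeas_integrableM bf ik) (bmeas_integrableM bM ik)).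
  by apply: eq_Rintegral => x _; rewrite mulrDl.
have -> : \int[m2]_x ((f x + `|M|) * l x) =
    \int[m2]_x (f x * l x) + \int[m2]_x (`|M| * l x).
  rewrite -(RintegralD measurableT (bmeas_integrableM bf il) (bmeas_integrableM bM il)).
  by apply: eq_Rintegral => x _; rewrite mulrDl.
move=> h1 h2; apply: (addIr (\int[m1]_x (`|M| * k x) + \int[m2]_x (`|M| * l x))).
by rewrite [RHS]addrACA -h2 -h1 opprD [RHS]addrACA.
Qed.

(** Two splittings of one charge can be compared without subtraction: [jp + mixed_neg] and
    [jn + mixed_pos] are the same positive measure. From here on no Hahn decomposition is met
    again. *)
Lemma charge_RintegralE (nu : {charge set T -> \bar R}) f :
  (forall A, measurable A ->
     nu A = (\int[m1]_(x in A) (k x)%:E + \int[m2]_(x in A) (l x)%:E)%E) ->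
  bmeas f ->
  charge_Rintegral nu f = \int[m1]_x (f x * k x) + \int[m2]_x (f x * l x).
Proof.
move=> nuE bf; rewrite -mixed_integral// /charge_Rintegral.
case: cid => P /= HP; case: cid => N /= PN.
set jp := jordan_pos PN; set jn := jordan_neg PN.
have eqm A : measurable A -> measure_add jp mixed_neg A = measure_add jn mixed_pos A.
  move=> mA; rewrite !measure_addE.
  have : nu A = (jp A - jn A)%E by rewrite (jordan_decomp PN mA) /cadd/= cscaleN1.
  rewrite nuE// -mixedE//.
  have f1 := mixed_pos_fin mA; have f2 := mixed_neg_fin mA.
  have f3 : jp A \is a fin_num by exact: fin_num_measure.
  have f4 : jn A \is a fin_num by exact: fin_num_measure.
  have swap (p q a b : \bar R) : p \is a fin_num -> q \is a fin_num ->
      a \is a fin_num -> b \is a fin_num -> (p - q = a - b -> a + q = b + p)%E.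
    move: p q a b => [p| |] [q| |] [a| |] [b| |] //= _ _ _ _ [E].
    by congr EFin; lra.
  exact: swap.
have ijp : jp.-integrable setT (EFin \o f) by exact: bmeas_integrable.
have ijn : jn.-integrable setT (EFin \o f) by exact: bmeas_integrable.
have ip := bmeas_integrable_mixed_pos bf; have iN := bmeas_integrable_mixed_neg bf.
have : (\int[measure_add jp mixed_neg]_x (f x)%:E =
        \int[measure_add jn mixed_pos]_x (f x)%:E)%E.
  by apply: eq_measure_integral => A mA _; exact: eqm.
have -> : (\int[measure_add jp mixed_neg]_x (f x)%:E =
    \int[jp]_x (f x)%:E + \int[mixed_neg]_x (f x)%:E)%E.
  exact: integral_measure_add.
have -> : (\int[measure_add jn mixed_pos]_x (f x)%:E =
    \int[jn]_x (f x)%:E + \int[mixed_pos]_x (f x)%:E)%E.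
  exact: integral_measure_add.
have h1 := integrable_fin_num measurableT ijp.
have h2 := integrable_fin_num measurableT ijn.
have h3 := integrable_fin_num measurableT ip.
have h4 := integrable_fin_num measurableT iN.
move=> /(congr1 fine); rewrite (fineD h1 h4) (fineD h2 h3).
have swap (a b u v : R) : a + v = b + u -> a - b = u - v by lra.
exact: swap.
Qed.
End charge_integral.

(** * Measurable functions on the circle *)

Section circle_measurability.
Context (R : realType).
Local Notation T := (borel (circle R)).
Local Notation Re := complex.Re.
Local Notation Im := complex.Im.

Lemma cval_expi (t : R) : cval (expi t) = cis t. Proof. by []. Qed.

Lemma cmod_cval (w : T) : cmod (cval w) = 1.
Proof.
have : `|(cval w : R[i])| = 1 by have := set_valP (w : circle R).
by rewrite normc_cmod => /(congr1 (@complex.Re R)).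
Qed.

Lemma circle_ex (z : R[i]) : cmod z = 1 -> exists w : T, cval w = z.
Proof.
move=> z1; have zc : z \in unit_circle R.
  by rewrite inE /unit_circle /= normc_cmod z1.
by exists (SigSub zc : circle R).
Qed.

Lemma cval_inj (w w' : T) : cval w = cval w' -> w = w'.
Proof. exact: val_inj. Qed.

Lemma cvalJ (w : T) : (cval w)^-1 = (cval w)^*%C.
Proof.
have w0 : (cval w : R[i]) != 0 by rewrite -cmod_gt0 cmod_cval.
apply: (mulfI w0); rewrite divff// mulJc cmod_cval expr1n //.
Qed.

(** Lipschitz for the chordal distance. Such functions are stable under maxima, are approximated
    uniformly by their Poisson integrals, and suffice to compare finite Borel measures. *)
Definition clipschitz (f : T -> R) := exists2 K : R, 0 <= K &
  forall w w' : T, `|f w - f w'| <= K * cmod (cval w - cval w').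

Lemma clipschitz_measurable (f : T -> R) : clipschitz f -> measurable_fun setT f.
Proof.
move=> [K K0 fK]; apply: (measurability _ (RGenOpens.measurableE R)) => // _ [_ [x [y ->]] <-].
rewrite setTI; apply: sub_sigma_algebra => /=.
pose cf : circle R -> R := f.
suff cfc : continuous cf by move/continuousP : cfc; apply; exact: interval_open.
move=> w.
apply/(@cvgrPdist_le R R (circle R) (nbhs w) (nbhs_filter w)) => /= e e0.
have cw : {for w, continuous (@cval R)} by exact: initial_continuous.
have eK : 0 < e / (K + 1) by rewrite divr_gt0// ltr_wpDl.
have eKC : 0 < (e / (K + 1))%:C%C :> R[i] by rewrite ltcR.
move/(@cvgrPdist_le R[i] R[i]^o (circle R) (nbhs w) (nbhs_filter w))/(_ _ eKC) : cw.
apply: filterS => w' /=; rewrite normc_cmod lecR => h.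
apply: (le_trans (fK w w')); apply: (@le_trans _ _ ((K + 1) * (e / (K + 1)))).
  by apply: ler_pM => //; rewrite lerDl.
by rewrite mulrC divfK// gt_eqF// ltr_wpDl.
Qed.

Lemma bmeas_Re_cval : bmeas (fun w : T => Re (cval w)).
Proof.
split; last by exists 1 => w; rewrite (le_trans (ler_Re_cmod _))// cmod_cval.
apply: clipschitz_measurable; exists 1 => // w w'.
by rewrite mul1r -ReB ler_Re_cmod.
Qed.

Lemma bmeas_Im_cval : bmeas (fun w : T => Im (cval w)).
Proof.
split; last by exists 1 => w; rewrite (le_trans (ler_Im_cmod _))// cmod_cval.
apply: clipschitz_measurable; exists 1 => // w w'.
by rewrite mul1r -ImB ler_Im_cmod.
Qed.

End circle_measurability.

Section complex_bounded_measurable.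
Context d (T : measurableType d) (R : realType).
Local Notation Re := complex.Re.
Local Notation Im := complex.Im.
Implicit Types (F G : T -> R[i]) (f : T -> R).

Lemma bmeasV f (c : R) : 0 < c -> (forall x, c <= f x) -> bmeas f ->
  bmeas (fun x => (f x)^-1).
Proof.
move=> c0 cf [mf _]; split; last first.
  exists c^-1 => x; have fx : 0 < f x by exact: lt_le_trans (cf x).
  by rewrite ger0_norm ?invr_ge0 ?(ltW fx)// lef_pV2.
have -> : (fun x => (f x)^-1) = (@powR R ^~ (-1)) \o f.
  apply/funext => x /=; rewrite powR_inv1//.
  by rewrite (le_trans _ (cf x))// ltW.
by apply: measurableT_comp => //; exact: measurable_powR.
Qed.

Definition cbmeas F := bmeas (fun x => Re (F x)) /\ bmeas (fun x => Im (F x)).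

Lemma cbmeas_cst (c : R[i]) : cbmeas (fun=> c).
Proof. by split; exact: bmeas_cst. Qed.

Lemma cbmeasD F G : cbmeas F -> cbmeas G -> cbmeas (fun x => F x + G x).
Proof.
move=> [F1 F2] [G1 G2]; split; under eq_fun do rewrite ?ReD ?ImD; exact: bmeasD.
Qed.

Lemma cbmeasN F : cbmeas F -> cbmeas (fun x => - F x).
Proof.
by move=> [F1 F2]; split; under eq_fun do rewrite ?ReN ?ImN; exact: bmeasN.
Qed.

Lemma cbmeasB F G : cbmeas F -> cbmeas G -> cbmeas (fun x => F x - G x).
Proof. by move=> cF cG; apply: cbmeasD => //; exact: cbmeasN. Qed.

Lemma cbmeasM F G : cbmeas F -> cbmeas G -> cbmeas (fun x => F x * G x).
Proof.
move=> [F1 F2] [G1 G2]; split; under eq_fun do rewrite ?ReM ?ImM.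
  by apply: bmeasB; exact: bmeasM.
by apply: bmeasD; exact: bmeasM.
Qed.

Lemma cbmeasJ F : cbmeas F -> cbmeas (fun x => (F x)^*%C).
Proof.
move=> [F1 F2]; split; under eq_fun do rewrite ?ReJ ?ImJ; first exact: F1.
exact: bmeasN.
Qed.

Lemma cbmeas_real f : bmeas f -> cbmeas (fun x => (f x)%:C%C).
Proof. by move=> bf; split => //=; exact: bmeas_cst. Qed.

Lemma cbmeasV F (c : R) : 0 < c -> (forall x, c <= cmod (F x)) -> cbmeas F ->
  cbmeas (fun x => (F x)^-1).
Proof.
move=> c0 cF bF.
have -> : (fun x => (F x)^-1) =
    (fun x => ((cmod (F x) ^+ 2)^-1)%:C%C * (F x)^*%C).
  apply/funext => x; rewrite realCV sqr_cmodE.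
  have Fx : F x != 0 by rewrite -cmod_gt0 (lt_le_trans c0).
  by field; rewrite conjc_eq0 Fx.
apply: cbmeasM; last exact: cbmeasJ.
apply: cbmeas_real; apply: (@bmeasV _ (c ^+ 2)); first by rewrite exprn_gt0.
  by move=> x; rewrite ler_pXn2r ?nnegrE// ?(ltW c0).
under eq_fun do rewrite sqr_cmod !expr2.
by case: bF => F1 F2; apply: bmeasD; exact: bmeasM.
Qed.
End complex_bounded_measurable.

(** * Integrals for arc length *)

Section arc_length_integral.
Context (R : realType).
Local Notation T := (borel (circle R)).
Local Notation L := (arc_length R).
Local Notation Re := complex.Re.
Local Notation leb := (@lebesgue_measure R).

Let I02pi : set R := `[0, 2 * pi[%classic.
Let mI02pi : measurable (I02pi : set (measurableTypeR R)).
Proof. exact: measurable_itv. Qed.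

Lemma two_pi_gt0 : 0 < 2 * pi :> R.
Proof. by rewrite mulr_gt0// pi_gt0. Qed.

Lemma arc_lengthT : L setT = (2 * pi)%:E.
Proof.
rewrite /arc_length /pushforward preimage_setT /= /mrestr setTI.
by rewrite lebesgue_measure_itv/= lte_fin two_pi_gt0 -EFinB subr0.
Qed.

Lemma arc_length_fin : fin_num_fun L.
Proof.
move=> A mA; rewrite ge0_fin_numE//.
by rewrite (@le_lt_trans _ _ (L setT)) ?le_measure ?inE// arc_lengthT ltry.
Qed.

HB.instance Definition _ := @Measure_isFinite.Build _ _ _ L arc_length_fin.

Lemma ge0_integral_arc_length (f : T -> R) : measurable_fun setT f ->
  (forall w, 0 <= f w) ->
  (\int[L]_w (f w)%:E = \int[leb]_(t in `[0%R, (2 * pi)%R]) (f (expi t))%:E)%E.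
Proof.
move=> mf f0.
have mfE : measurable_fun setT (fun w : T => (f w)%:E) by exact/measurable_EFinP.
have mfe : measurable_fun setT ((fun w : T => (f w)%:E) \o (@expi R : measurableTypeR R -> T)).
  by apply: measurableT_comp => //; exact: measurable_expi.
have -> : (\int[L]_w (f w)%:E =
    \int[mrestr leb mI02pi]_t (f (expi t))%:E)%E.
  have := @ge0_integral_pushforward _ _ (measurableTypeR R) T R
    (@expi R : measurableTypeR R -> T) (@measurable_expi R)
    (mrestr leb mI02pi) setT (fun w : T => (f w)%:E) measurableT mfE.
  by rewrite preimage_setT; apply => w _; rewrite lee_fin.
have ind0 x : 0 <= (\1_I02pi x : R) by [].
have mind : measurable_fun setT (\1_I02pi : measurableTypeR R -> R).
  exact: measurable_indic.
rewrite (@eq_measure_integral _ _ _ _ (density leb ind0 mind)); last first.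
  move=> A mA _; rewrite /= /mrestr /density.
  by rewrite integral_indic// setIC.
rewrite (integral_density leb ind0 mind)//; last by move=> t; rewrite lee_fin.
rewrite -integral_itv_bndo_bndc; last exact: measurable_funTS mfe.
rewrite [RHS]integral_mkcond; apply: eq_integral => t _.
by rewrite epatch_indic.
Qed.

Lemma integral_arc_length (f : T -> R) : bmeas f ->
  (forall t, {for t, continuous (fun t => f (expi t))}) ->
  \int[L]_w f w = Int 0 (2 * pi) (fun t => f (expi t)).
Proof.
move=> bf cf; have [mf [M fM]] := bf.
have bM := @bmeas_cst _ T R `|M|.
have := ge0_integral_arc_length (bmeasD bf bM).1 => /(_ _)/(congr1 fine).
rewrite -![fine _]/(Rintegral _ _ _) => H.
have {}H : \int[L]_x (f x + `|M|) = \int[leb]_(t in `[0, 2 * pi]) (f (expi t) + `|M|).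
  apply: H => w; have := fM w; rewrite ler_norml => /andP[h _].
  by have := ler_norm M; lra.
have iM : leb.-integrable `[0, 2 * pi] (EFin \o (fun=> `|M|)).
  by apply: integrable_continuous => t _; exact: cst_continuous.
have icf : leb.-integrable `[0, 2 * pi] (EFin \o (fun t => f (expi t))).
  by apply: integrable_continuous => t _; exact: cf.
move: H; rewrite (RintegralD measurableT (bmeas_integrable L bf) (bmeas_integrable L bM)).
rewrite RintegralD// !Rintegral_cst// [fine (L _)](_ : _ = 2 * pi); last first.
  by rewrite (congr1 fine arc_lengthT).
have -> : fine (leb `[0, 2 * pi]%classic) = 2 * pi.
  by rewrite lebesgue_measure_itv/= lte_fin two_pi_gt0 -EFinB subr0.
by move/addIr.
Qed.

Lemma circle_mean (q : R[i] -> R[i]) : (forall l, cmod l <= 1 -> cdifferentiable q l) ->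
  bmeas (fun w : T => Re (q (cval w))) ->
  \int[L]_w Re (q (cval w)) = 2 * pi * Re (q 0).
Proof.
move=> dq bq.
have -> : 2 * pi * Re (q 0) =
    Int 0 (2 * pi) (fun t => Re (q (0 + 1%:C%C * cis t))).
  apply/esym/mean_value => //; last first.
    by apply/cdifferentiable_ccontinuous/dq; rewrite cmod0.
  by move=> l /andP[_]; rewrite subr0 => l1; exact/differentiable_cexpansion/dq.
rewrite integral_arc_length//.
  by apply: congr1; apply/funext => t; rewrite cval_expi add0r mul1r.
move=> t; have [|D DP] := @differentiable_cexpansion R q (0 + polar 0 t).
  by apply: dq; rewrite add0r cmod_polar expR0.
have [+ _] := cauchy_riemann_continuous (cauchy_riemann_polar DP).
rewrite (_ : (fun y => Re (q (0 + polar 0 y))) = (fun t => Re (q (cval (expi t)))))//.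
by apply/funext => y; rewrite cval_expi /polar expR0 mul1r add0r.
Qed.

End arc_length_integral.

(** * Herglotz and Poisson kernels *)

Section poisson_kernel.
Context (R : realType).
Local Notation T := (borel (circle R)).
Local Notation L := (arc_length R).
Local Notation Re := complex.Re.
Local Notation Im := complex.Im.
Implicit Types (l : R[i]) (w : T).

Definition herglotz l w : R[i] := (cval w + l) / (cval w - l).

Definition poisson l w : R := (1 - cmod l ^+ 2) / cmod (cval w - l) ^+ 2.

Lemma cval_sub_neq0 l w : cmod l < 1 -> cval w - l != 0.
Proof.
move=> l1; rewrite -cmod_gt0.
by have := cmod_sub (cval w) l; rewrite cmod_cval; lra.
Qed.

Lemma Re_herglotz l w : Re (herglotz l w) = poisson l w.
Proof.
rewrite /herglotz Re_divJ /poisson; congr (_ / _).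
rewrite -[1](expr1n _ 2) -(cmod_cval w) !sqr_cmod !ReImE.
by ring.
Qed.

Lemma poisson_gt0 l w : cmod l < 1 -> 0 < poisson l w.
Proof.
move=> l1; rewrite /poisson divr_gt0 ?exprn_gt0 ?cmod_gt0 ?cval_sub_neq0//.
by have := cmod_ge0 l; nra.
Qed.

Lemma cbmeas_cval : cbmeas (fun w : T => cval w).
Proof. by split; [exact: bmeas_Re_cval|exact: bmeas_Im_cval]. Qed.

Lemma cbmeas_herglotz l : cmod l < 1 -> cbmeas (herglotz l).
Proof.
move=> l1; apply: cbmeasM; first by apply: cbmeasD; [exact: cbmeas_cval|exact: cbmeas_cst].
apply: (@cbmeasV _ _ _ _ (1 - cmod l)); first by rewrite subr_gt0.
  by move=> w; have := cmod_sub (cval w) l; rewrite cmod_cval.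
by apply: cbmeasB; [exact: cbmeas_cval|exact: cbmeas_cst].
Qed.

Lemma bmeas_poisson l : cmod l < 1 -> bmeas (poisson l).
Proof.
move=> l1; rewrite (_ : poisson l = fun w => Re (herglotz l w)).
  by have [] := cbmeas_herglotz l1.
by apply/funext => w; rewrite Re_herglotz.
Qed.

(* On the circle [herglotz l w] is the conjugate of the function
   [(1 + l^* w) / (1 - l^* w)], which is holomorphic in [w]. *)
Lemma herglotz_mean l : cmod l < 1 ->
  \int[L]_w Re (herglotz l w) = 2 * pi /\ \int[L]_w Im (herglotz l w) = 0.
Proof.
move=> l1; pose q z := (1 + l^*%C * z) / (1 - l^*%C * z).
have den z : cmod z <= 1 -> 1 - l^*%C * z != 0.
  move=> z1; rewrite -cmod_gt0.
  have := cmod_sub 1 (l^*%C * z); rewrite cmod1 cmodM cmodJ.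
  have : cmod l * cmod z <= cmod l by rewrite -[leRHS]mulr1 ler_wpM2l.
  lra.
have dq z : cmod z <= 1 -> cdifferentiable q z.
  move=> z1; apply: differentiableM.
    by apply: differentiableD => //; apply: differentiableM.
  apply: differentiableV; last exact: den.
  by apply: differentiableB => //; apply: differentiableM.
have q0 : q 0 = 1 by rewrite /q !mulr0 addr0 subr0 divr1.
have qE w : q (cval w) = (herglotz l w)^*%C.
  rewrite /herglotz !conjCE /q -!cvalJ.
  have w0 : (cval w : R[i]) != 0 by rewrite -cmod_gt0 cmod_cval.
  have d1 := den (cval w); rewrite cmod_cval lexx in d1.
  have -> : (cval w)^-1 + l^*%C = (cval w)^-1 * (1 + l^*%C * cval w).
    by rewrite mulrDr mulr1 mulrCA mulVf ?mulr1.
  have -> : (cval w)^-1 - l^*%C = (cval w)^-1 * (1 - l^*%C * cval w).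
    by rewrite mulrBr mulr1 mulrCA mulVf ?mulr1.
  by rewrite invfM invrK mulrACA mulVf// mul1r.
have [b1 b2] := cbmeas_herglotz l1; split.
  have := circle_mean dq; rewrite q0 mulr1.
  have -> : (fun w : T => Re (q (cval w))) = fun w => Re (herglotz l w).
    by apply/funext => w; rewrite qE ReJ.
  exact.
have := @circle_mean R (fun z => 'i%C * q z).
have -> : (fun w : T => Re ('i%C * q (cval w))) = fun w => Im (herglotz l w).
  by apply/funext => w; rewrite qE !ReImE/=; ring.
rewrite q0 mulr1/= mulr0 => iq; apply: iq; last exact: b2.
by move=> z z1; exact: (cdifferentiableZ 'i%C (dq z z1)).
Qed.

Lemma poisson_mean l : cmod l < 1 -> \int[L]_w poisson l w = 2 * pi.
Proof.
move=> /herglotz_mean[+ _]; rewrite (_ : (fun w => Re (herglotz l w)) = poisson l)//.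
by apply/funext => w; rewrite Re_herglotz.
Qed.

(** The points [w' - r w] and [w - r w'] have the same modulus. Under Fubini this exchanges the
    Poisson integral of a measure with that of a test function. *)
Lemma poisson_sym (r : R) w w' :
  poisson (r%:C%C * cval w) w' = poisson (r%:C%C * cval w') w.
Proof.
rewrite /poisson !cmodM !cmod_cval; congr (_ / _).
have h1 : Re (cval w) ^+ 2 + Im (cval w) ^+ 2 = 1 by rewrite -sqr_cmod cmod_cval expr1n.
have h2 : Re (cval w') ^+ 2 + Im (cval w') ^+ 2 = 1 by rewrite -sqr_cmod cmod_cval expr1n.
rewrite !sqr_cmod !ReImE/= !mul0r subr0 addr0.
by nra.
Qed.

(* Harnack's inequality *)
Lemma poisson_ge l w : cmod l < 1 -> (1 - cmod l) / (1 + cmod l) <= poisson l w.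
Proof.
move=> l1; have l0 := cmod_ge0 l.
have h := cmodB (cval w) l; rewrite cmod_cval in h.
have p0 : 0 < cmod (cval w - l) by rewrite cmod_gt0 cval_sub_neq0.
rewrite /poisson ler_pdivlMr ?exprn_gt0// mulrAC ler_pdivrMr; last by lra.
rewrite (_ : (1 - cmod l ^+ 2) * _ = (1 - cmod l) * (1 + cmod l) ^+ 2); last by ring.
rewrite ler_wpM2l ?subr_ge0 ?(ltW l1)// ler_pXn2r ?nnegrE//; lra.
Qed.

End poisson_kernel.

(** * Fubini's theorem for bounded functions *)

Section bounded_fubini.
Context d1 d2 (T1 : measurableType d1) (T2 : measurableType d2) (R : realType).
Variables (m1 : {finite_measure set T1 -> \bar R})
          (m2 : {finite_measure set T2 -> \bar R}).
Variable f : T1 * T2 -> R.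
Hypotheses (bf : bmeas f) (f0 : forall x, 0 <= f x).

Let mfE : measurable_fun setT (EFin \o f).
Proof. by apply/measurable_EFinP; case: bf. Qed.
Let f0E x : (0 <= (EFin \o f) x)%E. Proof. by rewrite lee_fin. Qed.

Lemma bmeas_section1 x : bmeas (fun y => f (x, y)).
Proof.
case: bf => [mf [M fM]]; split; last by exists M.
by apply: measurableT_comp => //; exact: measurable_pair1.
Qed.

Lemma bmeas_section2 y : bmeas (fun x => f (x, y)).
Proof.
case: bf => [mf [M fM]]; split; last by exists M.
by apply: measurableT_comp => //; exact: measurable_pair2.
Qed.

Let inner1 x : (\int[m2]_y (f (x, y))%:E)%E = (\int[m2]_y f (x, y))%:E.
Proof.
by rewrite fineK//; apply: integrable_fin_num => //;
  apply: bmeas_integrable; exact: bmeas_section1.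
Qed.

Let inner2 y : (\int[m1]_x (f (x, y))%:E)%E = (\int[m1]_x f (x, y))%:E.
Proof.
by rewrite fineK//; apply: integrable_fin_num => //;
  apply: bmeas_integrable; exact: bmeas_section2.
Qed.

Lemma bmeas_inner1 : bmeas (fun x => \int[m2]_y f (x, y)).
Proof.
split.
  apply/measurable_EFinP.
  rewrite (_ : EFin \o _ = fun x => (\int[m2]_y (EFin \o f) (x, y))%E).
    exact: measurable_fun_fubini_tonelli_F.
  by apply/funext => x; rewrite /= inner1.
case: bf => [_ [M fM]]; exists (M * fine (m2 setT)) => x.
have fx := bmeas_integrable m2 (bmeas_section1 x).
rewrite (le_trans (le_normr_Rintegral _ _))// -Rintegral_cst//.
apply: le_Rintegral => //; first exact: integrable_norm.
exact: (bmeas_integrable m2 (bmeas_cst T2 M)).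
Qed.

Lemma Rintegral_fubini :
  \int[m1]_x \int[m2]_y f (x, y) = \int[m2]_y \int[m1]_x f (x, y).
Proof.
have := @fubini_tonelli _ _ _ _ R m1 m2 (EFin \o f) mfE f0E.
under eq_integral do rewrite /= inner1.
by under [X in _ = X -> _]eq_integral do rewrite /= inner2; move=> /(congr1 fine).
Qed.
End bounded_fubini.

Section bmeas_composition.
Context d1 d2 (T1 : measurableType d1) (T2 : measurableType d2) (R : realType).

Lemma bmeas_comp (f : T2 -> R) (g : T1 -> T2) :
  bmeas f -> measurable_fun setT g -> bmeas (fun x => f (g x)).
Proof.
move=> [mf [M fM]] mg; split; last by exists M.
exact: (measurableT_comp mf mg).
Qed.

Lemma cbmeas_comp (f : T2 -> R[i]) (g : T1 -> T2) :
  cbmeas f -> measurable_fun setT g -> cbmeas (fun x => f (g x)).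
Proof.
move=> [f1 f2] mg; split.
  exact: (bmeas_comp f1 mg).
exact: (bmeas_comp f2 mg).
Qed.
Lemma bmeas_norm (f : T1 -> R) : bmeas f -> bmeas (fun w => `|f w|).
Proof.
move=> [mf [M fM]]; split; last by exists M => w; rewrite normr_id.
exact: measurableT_comp.
Qed.
End bmeas_composition.

(** * Uniform approximation by Poisson integrals *)

Section poisson_approximation.
Context (R : realType).
Local Notation T := (borel (circle R)).
Local Notation L := (arc_length R).
Implicit Types (f : T -> R) (r e : R) (w : T).

Lemma clipschitz_bmeas f : clipschitz f -> bmeas f.
Proof.
move=> lf; split; first exact: clipschitz_measurable.
have [K K0 fK] := lf; pose w0 : T := expi 0.
exists (`|f w0| + K * 2) => w; rewrite -(subrK (f w0) (f w)).
rewrite (le_trans (ler_normD _ _))// addrC lerD2l (le_trans (fK _ _))//.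
by rewrite ler_wpM2l// (le_trans (cmodB _ _))// !cmod_cval.
Qed.

(** Within distance [del] the first term suffices. Farther away [w] has distance at least [del / 2]
    from [r w'], so the kernel is at most [4 (1 - r^2) / del^2], and a chord has length at most
    2. *)
Lemma poisson_concentration r (del : R) w w' : 0 < del -> 0 < r < 1 -> 1 - r <= del / 2 ->
  cmod (cval w - cval w') * poisson (r%:C%C * cval w') w <=
    del * poisson (r%:C%C * cval w') w + 8 * (1 - r ^+ 2) / del ^+ 2.
Proof.
move=> del0 /andP[r0 r1] rdel; set c := cmod (cval w - cval w').
have rw1 : cmod (r%:C%C * cval w') = r.
  by rewrite cmodM cmod_cval cmod_real mulr1 gtr0_norm.
have P0 : 0 < poisson (r%:C%C * cval w') w by rewrite poisson_gt0// rw1.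
have [cd|dc] := leP c del.
  have : c * poisson (r%:C%C * cval w') w <= del * poisson (r%:C%C * cval w') w.
    by rewrite ler_wpM2r// ltW.
  have : 0 <= 8 * (1 - r ^+ 2) / del ^+ 2.
    by rewrite divr_ge0 ?sqr_ge0// mulr_ge0//; nra.
  lra.
have c2 : c <= 2 by rewrite (le_trans (cmodB _ _))// !cmod_cval.
have h : del / 2 <= cmod (cval w - r%:C%C * cval w').
  have := cmod_sub (cval w - cval w') ((r - 1)%:C%C * cval w').
  rewrite cmodM cmod_cval cmod_real mulr1 distrC ger0_norm ?subr_ge0 ?(ltW r1)//.
  rewrite (_ : cval w - cval w' - _ = cval w - r%:C%C * cval w'); last first.
    by rewrite rmorphB/= rmorph1; ring.
  rewrite -/c; lra.
have P1 : poisson (r%:C%C * cval w') w <= 4 * (1 - r ^+ 2) / del ^+ 2.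
  rewrite /poisson rw1 (_ : 4 * (1 - r ^+ 2) / del ^+ 2 = (1 - r ^+ 2) / (del / 2) ^+ 2).
    rewrite ler_wpM2l//; first nra.
    rewrite lef_pV2 ?posrE ?exprn_gt0 ?divr_gt0//; last first.
      by apply: lt_le_trans h; rewrite divr_gt0.
    by rewrite ler_pXn2r ?nnegrE// ltW// divr_gt0.
  by field; rewrite gt_eqF.
have : c * poisson (r%:C%C * cval w') w <= 2 * (4 * (1 - r ^+ 2) / del ^+ 2).
  by apply: ler_pM; rewrite ?cmod_ge0 ?(ltW P0).
have : 0 <= del * poisson (r%:C%C * cval w') w by rewrite mulr_ge0 ?ltW.
lra.
Qed.

Lemma poisson_approximation f e : clipschitz f -> 0 < e ->
  exists2 r : R, 0 < r < 1 & forall w',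
    `|\int[L]_w (f w * poisson (r%:C%C * cval w') w) - 2 * pi * f w'| <= e.
Proof.
move=> lf e0; have bf := clipschitz_bmeas lf; have [K K0 fK] := lf.
have p0 := two_pi_gt0 R.
pose M := 2 * pi * K + 1; have M0 : 0 < M by rewrite ltr_wpDl// mulr_ge0// ltW.
pose del := e / (2 * M); have del0 : 0 < del by rewrite divr_gt0// mulr_gt0.
(* This will be [1 - r]: the first bound permits the concentration estimate, the second keeps [r]
   positive, the third makes the contribution of far points at most [e / 2]. *)
pose s := Num.min (Num.min (del / 2) (1 / 2)) (e * del ^+ 2 / (32 * M)).
have s0 : 0 < s.
  rewrite !lt_min; apply/andP; split; [apply/andP; split|]; apply: divr_gt0 => //.
    by apply: mulr_gt0 => //; exact: exprn_gt0.
  exact: mulr_gt0.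
have s1 : s <= del / 2 by rewrite !ge_min lexx.
have s2 : s <= 1 / 2 by rewrite !ge_min lexx !orbT.
have s3 : s * (32 * M) <= e * del ^+ 2.
  by rewrite -ler_pdivlMr ?mulr_gt0// ge_min lexx orbT.
clearbody s; pose r := 1 - s.
have r01 : 0 < r < 1 by rewrite /r; apply/andP; split; lra.
have [r0 r1] := andP r01.
exists r => // w'.
have rw1 : cmod (r%:C%C * cval w') < 1.
  by rewrite cmodM cmod_cval cmod_real mulr1 gtr0_norm.
have bP := bmeas_poisson rw1; set p := poisson (r%:C%C * cval w') in bP *.
have pgt0 w : 0 < p w by exact: poisson_gt0.
have -> : 2 * pi * f w' = \int[L]_w (f w' * p w).
  by rewrite (RintegralZl _ measurableT (bmeas_integrable L bP)) poisson_mean// mulrC.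
rewrite -(RintegralB measurableT (bmeas_integrable L (bmeasM bf bP))
   (bmeas_integrable L (bmeasZ (f w') bP))).
have bD := bmeasB (bmeasM bf bP) (bmeasZ (f w') bP).
rewrite (le_trans (le_normr_Rintegral measurableT (bmeas_integrable L bD)))//.
pose B := 8 * (1 - r ^+ 2) / del ^+ 2.
have bR := bmeasD (bmeasZ (K * del) bP) (bmeas_cst T (K * B)).
apply: (@le_trans _ _ (\int[L]_w (K * del * p w + K * B))).
  apply: le_Rintegral => //.
  - exact: (bmeas_integrable L (bmeas_norm bD)).
  - exact: (bmeas_integrable L bR).
  - move=> w _; rewrite -mulrBl normrM (gtr0_norm (pgt0 w)).
    apply: (@le_trans _ _ (K * cmod (cval w - cval w') * p w)).
      by rewrite ler_wpM2r// ltW.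
    rewrite (_ : K * del * p w + K * B = K * (del * p w + B)); last by ring.
    rewrite -mulrA ler_wpM2l//.
    by apply: poisson_concentration => //; rewrite /r; lra.
rewrite (RintegralD measurableT (bmeas_integrable L (bmeasZ (K * del) bP))
  (bmeas_integrable L (bmeas_cst T (K * B)))).
rewrite (RintegralZl _ measurableT (bmeas_integrable L bP)) poisson_mean//.
rewrite Rintegral_cst// (congr1 fine (arc_lengthT R))/=.
have h1 : K * del * (2 * pi) <= e / 2.
  rewrite (_ : e / 2 = M * del); last by rewrite /del; field; rewrite gt_eqF.
  rewrite mulrAC [K * _]mulrC ler_wpM2r ?(ltW del0)// /M; lra.
have h2 : K * B * (2 * pi) <= e / 2.
  apply: (@le_trans _ _ (M * B)).
    rewrite mulrAC [K * _]mulrC ler_wpM2r; [|rewrite /B|rewrite /M; lra].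
      by [].
    by rewrite divr_ge0 ?sqr_ge0// mulr_ge0//; nra.
  rewrite /B mulrA ler_pdivrMr ?exprn_gt0//.
  have : 1 - r ^+ 2 <= 2 * s by rewrite /r; nra.
  move=> h; have : M * (1 - r ^+ 2) <= M * (2 * s) by rewrite ler_wpM2l// ltW.
  lra.
lra.
Qed.
End poisson_approximation.

(** * Lipschitz approximation of Borel sets; comparison of measures *)

Section lipschitz_density.
Context (R : realType).
Local Notation T := (borel (circle R)).
Local Notation L := (arc_length R).
Implicit Types (f g : T -> R) (e : R) (w : T) (A B : set T).

Lemma clipschitz_cst (c : R) : clipschitz (fun=> c : R).
Proof. by exists 0 => // w w'; rewrite subrr normr0 mul0r. Qed.

Lemma maxr_dist (a b c d : R) :
  `|Num.max a b - Num.max c d| <= `|a - c| + `|b - d|.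
Proof.
rewrite ler_norml; have := ler_norm (a - c); have := ler_norm (b - d).
have := ler_norm (c - a); have := ler_norm (d - b).
rewrite (distrC c a) (distrC d b).
have := normr_ge0 (a - c); have := normr_ge0 (b - d).
by case: (leP a b); case: (leP c d) => *; apply/andP; split; lra.
Qed.

Lemma clipschitz_max f g : clipschitz f -> clipschitz g ->
  clipschitz (fun w => Num.max (f w) (g w)).
Proof.
move=> [K K0 fK] [K' K'0 gK]; exists (K + K'); first exact: addr_ge0.
by move=> w w'; rewrite (le_trans (maxr_dist _ _ _ _))// mulrDl lerD.
Qed.

Lemma clipschitz_onem f : clipschitz f -> clipschitz (fun w => 1 - f w).
Proof.
move=> [K K0 fK]; exists K => // w w'.
have -> : 1 - f w - (1 - f w') = - (f w - f w') by ring.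
by rewrite normrN; exact: fK.
Qed.

Lemma bmeas_indic A : measurable A -> bmeas (\1_A : T -> R).
Proof.
move=> mA; split; first exact: measurable_indic.
by exists 1 => w; rewrite indicE normr_nat lern1 leq_b1.
Qed.

Variables P N : {finite_measure set T -> \bar R}.

(** One function must serve [P] and [N] together, because the two measures are to be compared on the
    same set. The sets with this property form a sigma-algebra. *)
Definition lipschitz_approximable A := measurable A /\ forall e, 0 < e ->
  exists f, [/\ clipschitz f, forall w, 0 <= f w <= 1,
    \int[P]_w `|\1_A w - f w| <= e & \int[N]_w `|\1_A w - f w| <= e].

Let le_int (m : {finite_measure set T -> \bar R}) f g : bmeas f -> bmeas g ->
  (forall w, f w <= g w) -> \int[m]_w f w <= \int[m]_w g w.
Proof.
move=> bf bg fg; apply: le_Rintegral => //; exact: bmeas_integrable.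
Qed.

Let bmeas_err A f : measurable A -> clipschitz f -> bmeas (fun w => `|\1_A w - f w|).
Proof.
move=> mA lf; apply: bmeas_norm; apply: bmeasB; first exact: bmeas_indic.
exact: clipschitz_bmeas.
Qed.

Let approx0 : lipschitz_approximable set0.
Proof.
split => // e e0; exists (fun=> 0); split; first exact: clipschitz_cst.
- by move=> w; rewrite lexx ler01.
- under eq_Rintegral do rewrite indic0 subr0 normr0.
  by rewrite Rintegral_cst// mul0r ltW.
- under eq_Rintegral do rewrite indic0 subr0 normr0.
  by rewrite Rintegral_cst// mul0r ltW.
Qed.

Let approxC A : lipschitz_approximable A -> lipschitz_approximable (~` A).
Proof.
move=> [mA aA]; split; first exact: measurableC.
move=> e e0; have [f [lf f01 fP fN]] := aA e e0.
have cE w : `|\1_(~` A) w - (1 - f w)| = `|\1_A w - f w|.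
  rewrite !indicE in_setC; case: (w \in A) => /=.
    by rewrite sub0r normrN.
  by rewrite sub0r opprB addrCA subrr addr0 normrN.
exists (fun w => 1 - f w); split; first exact: clipschitz_onem.
- by move=> w; have /andP[? ?] := f01 w; apply/andP; split; lra.
- by under eq_Rintegral do rewrite cE.
- by under eq_Rintegral do rewrite cE.
Qed.

Let approxU A B : lipschitz_approximable A -> lipschitz_approximable B ->
  lipschitz_approximable (A `|` B).
Proof.
move=> [mA aA] [mB aB]; split; first exact: measurableU.
move=> e e0; have e20 : 0 < e / 2 by rewrite divr_gt0.
have [f [lf f01 fP fN]] := aA _ e20; have [g [lg g01 gP gN]] := aB _ e20.
have lm := clipschitz_max lf lg.
have le w : `|\1_(A `|` B) w - Num.max (f w) (g w)| <=
    `|\1_A w - f w| + `|\1_B w - g w|.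
  suff -> : \1_(A `|` B) w = Num.max (\1_A w) (\1_B w) :> R by exact: maxr_dist.
  rewrite !indicE in_setU; case: (w \in A); case: (w \in B) => /=;
  by rewrite ?maxxx ?(max_l ler01) ?(max_r ler01).
have fin (m : {finite_measure set T -> \bar R}) :
    \int[m]_w `|\1_A w - f w| <= e / 2 -> \int[m]_w `|\1_B w - g w| <= e / 2 ->
    \int[m]_w `|\1_(A `|` B) w - Num.max (f w) (g w)| <= e.
  move=> h1 h2; have b1 := bmeas_err mA lf; have b2 := bmeas_err mB lg.
  apply: (@le_trans _ _ (\int[m]_w (`|\1_A w - f w| + `|\1_B w - g w|))).
    apply: le_int => //; last exact: bmeasD.
    by apply: bmeas_err => //; exact: measurableU.
  rewrite (RintegralD measurableT (bmeas_integrable m b1) (bmeas_integrable m b2)).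
  by lra.
exists (fun w => Num.max (f w) (g w)); split => //.
- move=> w; have /andP[? ?] := f01 w; have /andP[? ?] := g01 w.
  by case: (leP (f w) (g w)) => _; apply/andP; split.
- exact: fin.
- exact: fin.
Qed.

Let exhaust (B : (set T)^nat) e : (forall n, measurable (B n)) ->
  nondecreasing_seq B -> 0 < e ->
  exists n, \int[P]_w (\1_(\bigcup_k B k) w - \1_(B n) w) <= e /\
            \int[N]_w (\1_(\bigcup_k B k) w - \1_(B n) w) <= e.
Proof.
move=> mB ndB e0; have mU : measurable (\bigcup_k B k) by exact: bigcupT_measurable.
have cvg (m : {finite_measure set T -> \bar R}) :
    \forall n \near \oo, \int[m]_w (\1_(\bigcup_k B k) w - \1_(B n) w) <= e.
  have cm := nondecreasing_cvg_mu mB mU ndB (mu := m).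
  have fU : m (\bigcup_k B k) \is a fin_num by exact: fin_num_measure.
  have /fine_cvgP[_] : (m \o B) n @[n --> \oo] --> (fine (m (\bigcup_k B k)))%:E.
    by rewrite fineK.
  move=> /cvgrPdist_le/(_ e e0); apply: filterS => n /=.
  rewrite (RintegralB measurableT (bmeas_integrable m (bmeas_indic mU))
    (bmeas_integrable m (bmeas_indic (mB n)))).
  rewrite /Rintegral !integral_indic// !setIT.
  exact: le_trans (ler_norm _).
near \oo => n; exists n; split.
  by near: n; exact: cvg.
by near: n; exact: cvg.
Unshelve. all: by end_near. Qed.

Let approx_bigcup (A : (set T)^nat) : (forall n, lipschitz_approximable (A n)) ->
  lipschitz_approximable (\bigcup_k A k).
Proof.
move=> aA; pose B n := \big[setU/set0]_(i < n) A i.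
have aB n : lipschitz_approximable (B n).
  elim: n => [|n IH]; first by rewrite /B big_ord0; exact: approx0.
  by rewrite /B big_ord_recr/=; apply: approxU => //; exact: aA.
have ndB : nondecreasing_seq B by move=> n m nm; apply/subsetPset; exact: subset_bigsetU.
have BE : \bigcup_k B k = \bigcup_k A k.
  apply/seteqP; split => [w [k _]|w [k _ Akw]]; first exact: bigsetU_bigcup.
  by exists k.+1 => //; rewrite /B big_ord_recr; right.
have mU : measurable (\bigcup_k A k) by apply: bigcupT_measurable => k; have [] := aA k.
split => // e e0; have e20 : 0 < e / 2 by rewrite divr_gt0.
have [n [nP nN]] := exhaust (fun n => (aB n).1) ndB e20.
rewrite BE in nP nN.
have [mBn aBn] := aB n; have [f [lf f01 fP fN]] := aBn _ e20.
have BA : B n `<=` \bigcup_k A k by rewrite -BE; exact: bigcup_sup.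
have le w : `|\1_(\bigcup_k A k) w - f w| <=
    (\1_(\bigcup_k A k) w - \1_(B n) w) + `|\1_(B n) w - f w|.
  have ind : (\1_(B n) w : R) <= \1_(\bigcup_k A k) w.
    rewrite !indicE; have [/set_mem wB|] := boolP (w \in B n); last by rewrite ler0n.
    by rewrite mem_set//; exact: BA.
  rewrite -{1}(subrK (\1_(B n) w) (\1_(\bigcup_k A k) w)) -addrA.
  by rewrite (le_trans (ler_normD _ _))// lerD2r ger0_norm// subr_ge0.
have fin (m : {finite_measure set T -> \bar R}) :
    \int[m]_w (\1_(\bigcup_k A k) w - \1_(B n) w) <= e / 2 ->
    \int[m]_w `|\1_(B n) w - f w| <= e / 2 ->
    \int[m]_w `|\1_(\bigcup_k A k) w - f w| <= e.
  move=> h1 h2; have b1 := bmeasB (bmeas_indic mU) (bmeas_indic mBn).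
  have b2 := bmeas_err mBn lf.
  apply: (@le_trans _ _ (\int[m]_w ((\1_(\bigcup_k A k) w - \1_(B n) w) +
      `|\1_(B n) w - f w|))).
    by apply: le_int => //; [exact: bmeas_err|exact: bmeasD].
  rewrite (RintegralD measurableT (bmeas_integrable m b1) (bmeas_integrable m b2)).
  by lra.
by exists f; split => //; exact: fin.
Qed.

Let cdist A w : R := inf [set cmod (cval w - cval w') | w' in A].

Let cdist_ge0 A w w' : A w' -> 0 <= cdist A w.
Proof.
move=> Aw'; apply: lb_le_inf; first by exists (cmod (cval w - cval w')), w'.
by move=> _ [z _ <-].
Qed.

Let cdist_le A w w' : A w' -> cdist A w <= cmod (cval w - cval w').
Proof.
by move=> Aw'; apply: ge_inf; [exists 0 => _ [z _ <-]|exists w'].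
Qed.

Let cdist_lipschitz A w0 w w' : A w0 ->
  cdist A w <= cdist A w' + cmod (cval w - cval w').
Proof.
move=> Aw0; rewrite -lerBlDr; apply: lb_le_inf.
  by exists (cmod (cval w' - cval w0)), w0.
move=> _ [z Az <-]; rewrite lerBlDr (le_trans (cdist_le w Az))//.
have := cmodD (cval w' - cval z) (cval w - cval w').
by rewrite addrC addrA subrK.
Qed.

(** With [d] the distance to the complement, [min 1 ((n + 1) d)] agrees with the indicator of [U]
    outside [U] and on [C n], and the sets [C n] exhaust [U]. *)
Let approx_open (U : set (circle R)) : open U -> lipschitz_approximable (U : set T).
Proof.
move=> oU; have mU : measurable (U : set T) by exact: sub_sigma_algebra.
split => // e e0.
(* For an empty complement the infimum in [cdist] would be a default value, so this case is
   separate. *)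
have [CU0|/set0P[w0 w0U]] := eqVneq (~` U) set0.
  have UT : U = setT by rewrite -(setCK U) CU0 setC0.
  have z w : `|\1_(U : set T) w - 1| = 0 :> R by rewrite UT indicT subrr normr0.
  exists (fun=> 1); split; first exact: clipschitz_cst.
  - by move=> w; rewrite lexx ler01.
  - by under eq_Rintegral do rewrite z; rewrite Rintegral_cst// mul0r ltW.
  - by under eq_Rintegral do rewrite z; rewrite Rintegral_cst// mul0r ltW.
pose d := cdist (~` U).
have dU w : U w -> 0 < d w.
  have [V oV VU] := oU; rewrite -VU /= => Vw.
  have [ec /= ec0 ecV] : nbhs_ball (cval w : R[i]^o) V.
    by apply/nbhs_ballP; exact: open_nbhs_nbhs.
  have [er er0 ecE] := gt0_realC ec0.
  apply: lt_le_trans er0 _; apply: lb_le_inf.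
    by exists (cmod (cval w - cval w0)), w0.
  move=> _ [z zU <-]; rewrite leNgt; apply/negP => wz; apply: zU.
  rewrite -VU /=; apply: ecV; rewrite /ball/= ecE normc_cmod ltcR.
  exact: wz.
have d0 w : 0 <= d w by exact: (@cdist_ge0 _ w w0).
have dl w w' : d w <= d w' + cmod (cval w - cval w') by exact: (@cdist_lipschitz _ w0).
pose f n w : R := Num.min 1 (n.+1%:R * d w).
have lf n : clipschitz (f n).
  exists n.+1%:R => // w w'; rewrite /f.
  have h1 := dl w w'; have h2 := dl w' w; rewrite cmodBC in h2.
  have n0 : 0 < n.+1%:R :> R by rewrite ltr0n.
  have k1 : n.+1%:R * d w <= n.+1%:R * d w' + n.+1%:R * cmod (cval w - cval w').
    by rewrite -mulrDr ler_pM2l.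
  have k2 : n.+1%:R * d w' <= n.+1%:R * d w + n.+1%:R * cmod (cval w - cval w').
    by rewrite -mulrDr ler_pM2l.
  have k3 : 0 <= n.+1%:R * cmod (cval w - cval w') by rewrite mulr_ge0.
  move: k1 k2 k3; set x := _ * d w; set y := _ * d w'; set z := _ * cmod _.
  move=> k1 k2 k3; rewrite ler_norml.
  by case: (leP 1 x); case: (leP 1 y) => *; apply/andP; split; lra.
pose C n : set T := [set w | n.+1%:R^-1 <= d w].
have ld : clipschitz d.
  exists 1 => // w w'; rewrite mul1r ler_norml.
  have h1 := dl w w'; have h2 := dl w' w; rewrite cmodBC in h2.
  by apply/andP; split; lra.
have mC n : measurable (C n).
  rewrite (_ : C n = d @^-1` `[n.+1%:R^-1, +oo[%classic).
    rewrite -[X in measurable X]setTI; apply: clipschitz_measurable => //.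
  by apply/seteqP; split => w; rewrite /C/= in_itv/= andbT.
have ndC : nondecreasing_seq C.
  move=> n m nm; apply/subsetPset => w; rewrite /C/=; apply: le_trans.
  by rewrite lef_pV2 ?posrE// ler_nat ltnS.
have CU : \bigcup_k C k = U.
  apply/seteqP; split => [w [n _]|w Uw].
    rewrite /C/= => nd; apply: contrapT => nU.
    have := @cdist_le (~` U) w w nU; rewrite subrr cmod0 => dle.
    by have := le_trans nd dle; rewrite leNgt invr_gt0 ltr0n.
  have dw := dU w Uw; exists (Num.truncn (d w)^-1) => //; rewrite /C/=.
  rewrite invf_ple ?posrE//; first by rewrite ltW// truncnS_gt.
have [n [nP nN]] := exhaust mC ndC e0; rewrite CU in nP nN.
have le w : `|\1_(U : set T) w - f n w| <= \1_(U : set T) w - \1_(C n) w.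
  rewrite /f !indicE; have n0 : 0 < n.+1%:R :> R by rewrite ltr0n.
  have [/set_mem Cw|nC] := boolP (w \in C n).
    rewrite mem_set; last by rewrite -CU; exists n.
    rewrite min_l ?subrr ?normr0// -ler_pdivrMl// mulr1; exact: Cw.
  have [Uw|nU] := boolP (w \in (U : set T)).
    rewrite /= ?mulr1n ?mulr0n subr0 ler_norml; have dw := d0 w.
    have : 0 <= n.+1%:R * d w by rewrite mulr_ge0.
    by case: (leP 1 (n.+1%:R * d w)) => *; apply/andP; split; lra.
  have dw : d w = 0.
    apply/eqP; rewrite eq_le d0 andbT.
    have := @cdist_le (~` U) w w; rewrite subrr cmod0; apply.
    by move=> Uw; move: nU; rewrite mem_set.
  by rewrite dw mulr0 min_r// !subr0 normr0.
exists (f n); split => //.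
- move=> w; rewrite /f; have : 0 <= n.+1%:R * d w by rewrite mulr_ge0.
  by case: (leP 1 (n.+1%:R * d w)) => *; apply/andP; split; lra.
- apply: le_trans nP; apply: le_int => //; first exact: bmeas_err.
  by apply: bmeasB; exact: bmeas_indic.
- apply: le_trans nN; apply: le_int => //; first exact: bmeas_err.
  by apply: bmeasB; exact: bmeas_indic.
Qed.

Lemma measurable_lipschitz_approximable A : measurable A -> lipschitz_approximable A.
Proof.
suff : <<s @open (circle R) >> `<=` lipschitz_approximable by exact.
apply: smallest_sub; last by move=> U oU; exact: approx_open.
split; first exact: approx0.
- by move=> B aB; rewrite setTD; exact: approxC.
- exact: approx_bigcup.
Qed.

Lemma lipschitz_test_le A : measurable A ->
  (forall f, clipschitz f -> (forall w, 0 <= f w) ->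
     \int[P]_w f w <= \int[N]_w f w) -> (P A <= N A)%E.
Proof.
move=> mA test.
have PA : P A \is a fin_num by exact: fin_num_measure.
have NA : N A \is a fin_num by exact: fin_num_measure.
rewrite -(fineK PA) -(fineK NA) lee_fin.
apply/ler_addgt0Pl => e e0; have e20 : 0 < e / 2 by rewrite divr_gt0.
have [_ /(_ _ e20)[f [lf f01 fP fN]]] := measurable_lipschitz_approximable mA.
have indE (m : {finite_measure set T -> \bar R}) : fine (m A) = \int[m]_w \1_A w.
  by rewrite /Rintegral integral_indic// setIT.
have bf := clipschitz_bmeas lf; have b1 := bmeas_indic mA; have b2 := bmeas_err mA lf.
have h1 : \int[P]_w \1_A w <= \int[P]_w f w + \int[P]_w `|\1_A w - f w|.
  rewrite -(RintegralD measurableT (bmeas_integrable P bf) (bmeas_integrable P b2)).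
  apply: le_int => //; first exact: bmeasD.
  by move=> w; rewrite -lerBlDl ler_norm.
have h2 : \int[N]_w f w <= \int[N]_w \1_A w + \int[N]_w `|\1_A w - f w|.
  rewrite -(RintegralD measurableT (bmeas_integrable N b1) (bmeas_integrable N b2)).
  apply: le_int => //; first exact: bmeasD.
  by move=> w; rewrite -lerBlDl distrC ler_norm.
have h3 : \int[P]_w f w <= \int[N]_w f w by apply: test => // w; have /andP[] := f01 w.
by rewrite !indE; lra.
Qed.

(** By Fubini and [poisson_sym], averaging the Poisson integrals of a measure over the circle of
    radius [r] with weight [f] is integrating against that measure the Poisson integral of [f],
    which is uniformly close to [2 pi f]. The origin is excluded since the identities to which this
    is applied divide by [l]. *)
Lemma poisson_domination A :
  (forall l, 0 < cmod l < 1 -> \int[P]_w poisson l w <= \int[N]_w poisson l w) ->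
  measurable A -> (P A <= N A)%E.
Proof.
move=> PN mA; apply: lipschitz_test_le => // f lf f0.
have bf := clipschitz_bmeas lf.
set p := fine (P setT); set n := fine (N setT).
have p0 : 0 <= p by rewrite fine_ge0.
have n0 : 0 <= n by rewrite fine_ge0.
have pi0 := two_pi_gt0 R.
suff key e : 0 < e -> 2 * pi * \int[P]_w f w <= 2 * pi * \int[N]_w f w + e * (p + n).
  rewrite -(ler_pM2l pi0); apply/ler_addgt0Pl => e e0.
  have pn : 0 < p + n + 1 by lra.
  have := key (e / (p + n + 1)); rewrite divr_gt0// => /(_ isT) h.
  rewrite addrC; apply: (le_trans h); rewrite lerD2l mulrAC ler_pdivrMr//.
  by rewrite ler_wpM2l ?(ltW e0)//; lra.
move=> e0; have [r r01 rP] := poisson_approximation lf e0.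
have [r0 r1] := andP r01.
pose F (x : T * T) := f x.1 * poisson (r%:C%C * cval x.1) x.2.
have rw1 w : cmod (r%:C%C * cval w) = r.
  by rewrite cmodM cmod_cval cmod_real mulr1 gtr0_norm.
have F0 x : 0 <= F x by rewrite mulr_ge0// ltW// poisson_gt0// rw1.
have bF : bmeas F.
  have c1 : cbmeas (fun x : T * T => cval x.1).
    by apply: (@cbmeas_comp _ _ _ _ R (@cval R : T -> R[i])); [exact: cbmeas_cval|exact: measurable_fst].
  have c2 : cbmeas (fun x : T * T => cval x.2).
    by apply: (@cbmeas_comp _ _ _ _ R (@cval R : T -> R[i])); [exact: cbmeas_cval|exact: measurable_snd].
  have c3 := cbmeasB c2 (cbmeasM (cbmeas_cst _ r%:C%C) c1).
  apply: bmeasM; first by apply: (bmeas_comp bf); exact: measurable_fst.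
  rewrite (_ : (fun x : T * T => poisson (r%:C%C * cval x.1) x.2) =
      fun x => (1 - r ^+ 2) * (cmod (cval x.2 - r%:C%C * cval x.1) ^+ 2)^-1); last first.
    by apply/funext => x; rewrite /poisson rw1.
  apply: bmeasZ; apply: (@bmeasV _ _ _ _ ((1 - r) ^+ 2)).
  - by rewrite exprn_gt0// subr_gt0.
  - move=> x; rewrite ler_pXn2r ?nnegrE// ?subr_ge0 ?(ltW r1)//.
    by have := cmod_sub (cval x.2) (r%:C%C * cval x.1); rewrite rw1 cmod_cval.
  - under eq_fun do rewrite sqr_cmod !expr2.
    by case: c3 => c31 c32; apply: bmeasD; exact: bmeasM.
pose I w' := \int[L]_w F (w, w').
have IE w' : I w' = \int[L]_w (f w * poisson (r%:C%C * cval w') w).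
  by apply: eq_Rintegral => w _; rewrite /F/= poisson_sym.
have bI : bmeas I.
  pose F' (x : T * T) := F (x.2, x.1).
  have bF' : bmeas F'.
    apply: (@bmeas_comp _ _ _ _ R F (fun x : T * T => (x.2, x.1))) => //.
    exact: measurable_swap.
  exact: (bmeas_inner1 L bF' (fun x => F0 (x.2, x.1))).
have cmp (m : {finite_measure set T -> \bar R}) :
    `|\int[m]_w I w - 2 * pi * \int[m]_w f w| <= e * fine (m setT).
  rewrite -(RintegralZl _ measurableT (bmeas_integrable m bf)).
  have bf2 := bmeasZ (2 * pi) bf.
  rewrite -(RintegralB measurableT (bmeas_integrable m bI) (bmeas_integrable m bf2)).
  have bD := bmeasB bI bf2.
  rewrite (le_trans (le_normr_Rintegral measurableT (bmeas_integrable m bD)))//.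
  rewrite -Rintegral_cst//; apply: le_int; [exact: bmeas_norm|exact: bmeas_cst|].
  by move=> w; rewrite IE.
have fub (m : {finite_measure set T -> \bar R}) :
    \int[m]_w I w = \int[L]_w (f w * \int[m]_w' poisson (r%:C%C * cval w) w').
  rewrite /I -(Rintegral_fubini L m bF F0); apply: eq_Rintegral => w _.
  have bp : bmeas (poisson (r%:C%C * cval w)) by apply: bmeas_poisson; rewrite rw1.
  by rewrite -(RintegralZl _ measurableT (bmeas_integrable m bp)).
have PNI : \int[P]_w I w <= \int[N]_w I w.
  rewrite !fub.
  have bin (m : {finite_measure set T -> \bar R}) :
      bmeas (fun w => f w * \int[m]_w' poisson (r%:C%C * cval w) w').
    have := bmeas_inner1 m bF F0.
    rewrite (_ : (fun x => \int[m]_y F (x, y)) =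
      fun w => f w * \int[m]_w' poisson (r%:C%C * cval w) w')//.
    apply/funext => w.
    have bp : bmeas (poisson (r%:C%C * cval w)) by apply: bmeas_poisson; rewrite rw1.
    by rewrite -(RintegralZl _ measurableT (bmeas_integrable m bp)).
  apply: (@le_int L) => //; [exact: bin|exact: bin|].
  by move=> w; rewrite ler_wpM2l//; apply: PN; rewrite rw1.
have := cmp P; have := cmp N; rewrite !ler_norml -/p -/n => /andP[A1 A2] /andP[B1 B2].
by lra.
Qed.

End lipschitz_density.

(** * Signs of densities from Poisson integrals *)

Section sign_lemma.
Context (R : realType).
Local Notation T := (borel (circle R)).
Local Notation L := (arc_length R).

Lemma null_of_integral_le0 d (S : measurableType d) (m : {measure set S -> \bar R})
    (k : S -> R) A : measurable A -> measurable_fun A (EFin \o k) ->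
  (forall x, A x -> 0 < k x) -> (\int[m]_(x in A) (k x)%:E <= 0)%E -> m A = 0%E.
Proof.
move=> mA mk k0 le0.
have I0 : (\int[m]_(x in A) `|(EFin \o k) x| = 0)%E.
  rewrite (_ : (\int[m]_(x in A) _ = \int[m]_(x in A) (k x)%:E)%E).
    apply/eqP; rewrite eq_le le0/=; apply: integral_ge0 => x Ax.
    by rewrite lee_fin ltW// k0.
  by apply: eq_integral => x /set_mem Ax; rewrite /= gtr0_norm// k0.
have [N [mN N0 AN]] := (ae_eq_integral_abs m mA mk).1 I0.
apply: (subset_measure0 mA mN _ N0) => x Ax; apply: AN => /= /(_ Ax) [] kx.
by have := k0 x Ax; rewrite kx ltxx.
Qed.

Variables (nu : {finite_measure set T -> \bar R}) (k l : T -> R).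
Hypotheses (ik : L.-integrable setT (EFin \o k)) (il : nu.-integrable setT (EFin \o l)).
Hypothesis sing : mutually_singular nu L.
Hypothesis neg : forall z, 0 < cmod z < 1 ->
  \int[L]_w (poisson z w * k w) + \int[nu]_w (poisson z w * l w) <= 0.

Let mixed_le0 A : measurable A ->
  (\int[L]_(x in A) (k x)%:E + \int[nu]_(x in A) (l x)%:E <= 0)%E.
Proof.
move=> mA.
pose finP := Measure_isFinite.Build _ _ _ (mixed_pos ik il) (@mixed_pos_fin _ _ _ _ _ _ _ ik il).
pose finN := Measure_isFinite.Build _ _ _ (mixed_neg ik il) (@mixed_neg_fin _ _ _ _ _ _ _ ik il).
pose P : {finite_measure set T -> \bar R} := HB.pack (Measure.sort (mixed_pos ik il)) finP.
pose N : {finite_measure set T -> \bar R} := HB.pack (Measure.sort (mixed_neg ik il)) finN.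
have PN : (P A <= N A)%E.
  apply: (@poisson_domination R P N A _ mA) => z /andP[z0 z1].
  have := mixed_integral ik il (bmeas_poisson z1).
  have h1 : \int[L]_w (poisson z w * k w) + \int[nu]_w (poisson z w * l w) <= 0.
    by apply: neg; rewrite z0.
  by rewrite -subr_le0 => h2; apply: le_trans h1; rewrite -h2.
rewrite -(mixedE ik il)// leeBlDr ?add0e//.
exact: (mixed_neg_fin ik il mA).
Qed.

Let mk : measurable_fun setT k.
Proof. by apply/measurable_EFinP; exact: measurable_int ik. Qed.

Let ml : measurable_fun setT l.
Proof. by apply/measurable_EFinP; exact: measurable_int il. Qed.

Let mpos (f : T -> R) : measurable_fun setT f -> measurable [set w | 0 < f w].
Proof.
move=> mf; rewrite (_ : [set w | _] = f @^-1` `]0, +oo[%classic).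
  by rewrite -[X in measurable X]setTI; exact: mf.
by apply/seteqP; split => w; rewrite /= in_itv/= andbT.
Qed.

(** Domination makes the signed measure with densities [k] and [l] nonpositive on all Borel sets. A
    set that is null for [nu] and has complement null for [L] separates the two parts, and each
    density is tested where it is positive. *)
Lemma sign_lemma :
  (\forall w \ae L, k w <= 0) /\ (\forall w \ae nu, l w <= 0).
Proof.
have [Z [mZ nuZ LZ]] := sing.
split.
- pose A := Z `&` [set w | 0 < k w].
  have mA : measurable A by apply: measurableI => //; exact: mpos.
  have A0 : L A = 0%E.
    apply: (@null_of_integral_le0 _ _ L k) => //.
    + by apply: (measurable_funS measurableT) => //; exact/measurable_EFinP.
    + by move=> w [].
    + have := mixed_le0 mA; rewrite [X in (_ + X)%E](_ : _ = 0%E) ?adde0//.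
      apply: null_set_integral => //.
        by apply: (measurable_funS measurableT) => //; exact/measurable_EFinP.
      by apply: (subset_measure0 mA mZ) => // w [].
  exists (A `|` ~` Z); split.
  + by apply: measurableU => //; exact: measurableC.
  + by rewrite -(measureU0 mA (measurableC mZ) LZ) in A0.
  + move=> w /=/negP; rewrite -ltNge => kw.
    by have [Zw|nZ] := pselect (Z w); [left|right].
- pose A := ~` Z `&` [set w | 0 < l w].
  have mA : measurable A by apply: measurableI; [exact: measurableC|exact: mpos].
  have A0 : nu A = 0%E.
    apply: (@null_of_integral_le0 _ _ nu l) => //.
    + by apply: (measurable_funS measurableT) => //; exact/measurable_EFinP.
    + by move=> w [].
    + have := mixed_le0 mA; rewrite [X in (X + _)%E](_ : _ = 0%E) ?add0e//.
      apply: null_set_integral => //.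
        by apply: (measurable_funS measurableT) => //; exact/measurable_EFinP.
      by apply: (subset_measure0 mA (measurableC mZ)) => // w [].
  exists (A `|` Z); split.
  + exact: measurableU.
  + by rewrite -(measureU0 mA mZ nuZ) in A0.
  + move=> w /=/negP; rewrite -ltNge => kw.
    by have [Zw|nZ] := pselect (Z w); [right|left].
Qed.
End sign_lemma.

(** * Scalar product and sup norm *)

Section row_vectors.
Context (R : realType) (n : nat).
Implicit Types (x y v p q : 'rV[R]_n) (U : set 'rV[R]_n) (a b e : R).

Lemma dotvC x v : dotv x v = dotv v x.
Proof. by apply: eq_bigr => j _; rewrite mulrC. Qed.

Lemma dotvDl x y v : dotv (x + y) v = dotv x v + dotv y v.
Proof. by rewrite -big_split; apply: eq_bigr => j _; rewrite mxE mulrDl. Qed.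

Lemma dotvZl a x v : dotv (a *: x) v = a * dotv x v.
Proof. by rewrite mulr_sumr; apply: eq_bigr => j _; rewrite mxE mulrA. Qed.

Lemma dotvNl x v : dotv (- x) v = - dotv x v.
Proof. by rewrite -scaleN1r dotvZl mulN1r. Qed.

Lemma dotvBl x y v : dotv (x - y) v = dotv x v - dotv y v.
Proof. by rewrite dotvDl dotvNl. Qed.

Lemma dotvDr x v y : dotv x (v + y) = dotv x v + dotv x y.
Proof. by rewrite dotvC dotvDl !(dotvC x). Qed.

Lemma dotvZr a x v : dotv x (a *: v) = a * dotv x v.
Proof. by rewrite dotvC dotvZl dotvC. Qed.

Lemma dotvNr x v : dotv x (- v) = - dotv x v.
Proof. by rewrite dotvC dotvNl dotvC. Qed.

Lemma dotv_sqrDZ x y a :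
  dotv (x + a *: y) (x + a *: y) = dotv x x + 2 * a * dotv y x + a ^+ 2 * dotv y y.
Proof. by rewrite dotvDl !dotvDr !dotvZl !dotvZr (dotvC x y); ring. Qed.

Lemma dotv_delta x j : dotv x (delta_mx 0 j) = x 0 j.
Proof.
rewrite /dotv (bigD1 j)//= big1 ?addr0 => [|i ij].
  by rewrite mxE !eqxx mulr1.
by rewrite mxE (negPf ij) andbF mulr0.
Qed.

Lemma coord_le_norm x j : `|x 0 j| <= `|x|.
Proof.
rewrite [leRHS]/Num.Def.normr/= mx_normrE; apply/bigmax_geP; right.
by exists (0, j).
Qed.

Lemma norm_le_coord x a : 0 <= a -> (forall j, `|x 0 j| <= a) -> `|x| <= a.
Proof.
move=> a0 xa; rewrite [leLHS]/Num.Def.normr/= mx_normrE; apply/bigmax_leP; split => //.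
by move=> [i j] _ /=; rewrite ord1.
Qed.

Lemma norm_lt_coord x a : 0 < a -> (forall j, `|x 0 j| < a) -> `|x| < a.
Proof.
move=> a0 xa; rewrite [ltLHS]/Num.Def.normr/= mx_normrE; apply/bigmax_ltP; split => //.
by move=> [i j] _ /=; rewrite ord1.
Qed.

Lemma dotv_ge0 x : 0 <= dotv x x.
Proof. by apply: sumr_ge0 => j _; rewrite -expr2 sqr_ge0. Qed.

Lemma norm_le_dotv x : `|x| ^+ 2 <= dotv x x.
Proof.
rewrite -[leRHS]sqr_sqrtr ?dotv_ge0// ler_pXn2r ?nnegrE ?sqrtr_ge0//.
apply: norm_le_coord; first exact: sqrtr_ge0.
move=> j; rewrite -sqrtr_sqr ler_wsqrtr// /dotv (bigD1 j)//= -expr2 lerDl.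
by apply: sumr_ge0 => i _; rewrite -expr2 sqr_ge0.
Qed.

Lemma dotv_le_norm x : dotv x x <= n%:R * `|x| ^+ 2.
Proof.
apply: (@le_trans _ _ (\sum_(j < n) `|x| ^+ 2)); last first.
  by rewrite sumr_const card_ord mulr_natl.
apply: ler_sum => j _; rewrite -expr2 -[_ ^+ 2]ger0_norm ?sqr_ge0// normrX.
by rewrite ler_pXn2r ?nnegrE//; exact: coord_le_norm.
Qed.

Lemma dotv_gt0 x : x != 0 -> 0 < dotv x x.
Proof.
by move=> x0; rewrite (lt_le_trans _ (norm_le_dotv x))// exprn_gt0// normr_gt0.
Qed.

Lemma continuous_sum (F : 'I_n -> 'rV[R]_n -> R) :
  (forall j, continuous (F j)) -> continuous (fun x => \sum_j F j x).
Proof.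
move=> Fc; elim: (index_enum _) => [|j s IH].
  rewrite (_ : (fun x => _) = cst 0); first exact: cst_continuous.
  by apply/funext => x; rewrite big_nil.
rewrite (_ : (fun x => _) = fun x => F j x + \sum_(i <- s) F i x); last first.
  by apply/funext => x; rewrite big_cons.
move=> x.
exact: (continuousD (Fc j x) (IH x)).
Qed.

Lemma dotv_continuous v : continuous (fun x => dotv x v : R).
Proof.
apply: continuous_sum => j x.
exact: (continuousM (@coord_continuous R 1 n 0 j x) (@cst_continuous _ _ (v 0 j) x)).
Qed.

Lemma sqr_dist_continuous q : continuous (fun x => dotv (x - q) (x - q) : R).
Proof.
apply: continuous_sum => j x.
have cj : {for x, continuous (fun y : 'rV[R]_n => (y - q) 0 j : R)}.
  rewrite (_ : (fun y => _) = fun y : 'rV[R]_n => y 0 j - q 0 j); last first.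
    by apply/funext => y; rewrite !mxE.
  exact: (continuousB (@coord_continuous R 1 n 0 j x) (@cst_continuous _ _ (q 0 j) x)).
exact: (continuousM cj cj).
Qed.

Lemma closure_rVP U p :
  closure U p <-> forall e, 0 < e -> exists2 x, U x & `|p - x| < e.
Proof.
split=> [clp e e0|h B /nbhs_ballP[e /= e0 eB]].
  have [x [Ux px]] : U `&` ball p e !=set0 by apply: clp; exact: nbhsx_ballx.
  by exists x => //; rewrite -ball_normE in px.
by have [x Ux px] := h _ e0; exists x; split => //; apply: eB; rewrite -ball_normE.
Qed.

Lemma open_rVP U x : open U -> U x -> exists2 e : R, 0 < e & forall y, `|x - y| < e -> U y.
Proof.
move=> oU Ux; have /nbhs_ballP[e /= e0 eU] := open_nbhs_nbhs (conj oU Ux).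
by exists e => // y xy; apply: eU; rewrite -ball_normE.
Qed.

Lemma closure_halfspace U v (M : R) p : (forall x, U x -> dotv x v <= M) ->
  closure U p -> dotv p v <= M.
Proof.
move=> UM; have cl : closed [set x | dotv x v <= M].
  by apply: (closed_comp (f := fun x => dotv x v) _ (@closed_le R M)) => x _; exact: dotv_continuous.
by move=> /(closureS UM); rewrite -(closure_id _).1.
Qed.

Lemma rational_rV_dense p e : 0 < e ->
  exists q : 'rV[rat]_n, `|p - map_mx ratr q| < e.
Proof.
move=> e0.
have /choice[q qP] j : exists q : rat, `|p 0 j - ratr q| < e.
  have /rat_in_itvoo[q] : p 0 j < p 0 j + e by rewrite ltrDl.
  rewrite in_itv/= => /andP[h1 h2]; exists q.
  by rewrite distrC gtr0_norm ?subr_gt0// ltrBlDl.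
by exists (\row_j q j); apply: norm_lt_coord => // j; rewrite !mxE.
Qed.
End row_vectors.

(** * Open convex sets and their supporting half-spaces *)

Section open_convex.
Context (R : realType) (n : nat).
Variable U : set 'rV[R]_n.
Hypotheses (oU : open U) (U0 : U !=set0).
Hypothesis cvU : forall (x y : 'rV[R]_n) (t : R), U x -> U y -> 0 <= t <= 1 ->
  U (t *: x + (1 - t) *: y).
Implicit Types (x y v p q c : 'rV[R]_n).

(** The error made in replacing [p] by a nearby point of [U] is absorbed by moving [x] inside a ball
    contained in [U], which its positive weight permits. *)
Lemma closure_mix p x (t : R) : closure U p -> U x -> 0 < t <= 1 ->
  U ((1 - t) *: p + t *: x).
Proof.
move=> /closure_rVP clp Ux /andP[t0 t1].
have [e e0 eU] := open_rVP oU Ux.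
have [p' Up' pp'] := clp _ (mulr_gt0 e0 t0).
have Ux' : U (x + ((1 - t) / t) *: (p - p')).
  apply: eU; rewrite opprD addrA subrr sub0r normrN normrZ.
  have s0 : 0 <= 1 - t by rewrite subr_ge0.
  rewrite ger0_norm ?divr_ge0 ?(ltW t0)// mulrAC ltr_pdivrMr//.
  have : (1 - t) * `|p - p'| <= (1 - t) * (e * t) by rewrite ler_wpM2l// ltW.
  have := mulr_gt0 t0 (mulr_gt0 e0 t0); nra.
have -> : (1 - t) *: p + t *: x = t *: (x + ((1 - t) / t) *: (p - p')) + (1 - t) *: p'.
  rewrite scalerDr scalerA mulrCA divff ?gt_eqF// mulr1 scalerBr.
  by rewrite -addrA subrK addrC.
by apply: cvU; rewrite ?(ltW t0).
Qed.

(** Compactness of a bounded piece of the closure gives a minimiser [c] of the distance to [q].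
    Moving from [c] towards [x] cannot decrease that distance, and letting the step tend to 0 gives
    the inequality. *)
Lemma nearest_point q : exists2 c, closure U c &
  forall x, U x -> dotv (x - c) (q - c) <= 0.
Proof.
have [x0 Ux0] := U0; pose f x : R := dotv (x - q) (x - q).
pose K := closure U `&` [set x | f x <= f x0].
have clK : closed K.
  apply: closedI; first exact: closed_closure.
  by apply: (closed_comp (f := f) _ (@closed_le R (f x0))) => x _; exact: sqr_dist_continuous.
have bK : bounded_set K.
  exists (`|q| + (1 + f x0)); split; first exact: num_real.
  move=> M hM x [_ /= fx]; apply: le_trans (ltW hM).
  rewrite -(subrK q x) addrC (le_trans (ler_normD _ _))// lerD2l.
  have h := le_trans (norm_le_dotv (x - q)) fx.
  have := normr_ge0 (x - q); have := sqr_ge0 (`|x - q| - 1); nra.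
have K0 : K !=set0 by exists x0; split; [exact: subset_closure|exact: lexx].
have [c cK cmin] := EVT_min_rV K0 (bounded_closed_compact bK clK)
  (continuous_subspaceT (@sqr_dist_continuous R n q)).
have [clc fc] := set_mem cK; exists c => // x Ux.
have key (t : R) : 0 < t <= 1 -> 2 * dotv (x - c) (q - c) <= t * dotv (x - c) (x - c).
  move=> t01; have [t0 t1] := andP t01.
  pose y := (1 - t) *: c + t *: x.
  have cy : f c <= f y.
    have [yx|/ltW xy] := leP (f y) (f x0); last exact: le_trans fc xy.
    by apply: cmin; apply/mem_set; split => //; apply: subset_closure; exact: closure_mix.
  have yE : y - q = (c - q) + t *: (x - c).
    by rewrite /y scalerBl scale1r scalerBr -!addrA; congr (_ + _); rewrite addrCA [RHS]addrC -addrA.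
  have fyE : f y = f c + 2 * t * dotv (x - c) (c - q) + t ^+ 2 * dotv (x - c) (x - c).
    rewrite /f yE; set a := c - q; set b := x - c.
    exact: dotv_sqrDZ.
  rewrite -(opprB c q) dotvNr -(ler_pM2l t0); move: cy; rewrite fyE; lra.
rewrite leNgt; apply/negP => d0; set d := dotv _ _ in key d0.
set s := dotv _ _ in key; have s0 : 0 <= s by exact: dotv_ge0.
have ds : 0 < d + s by rewrite ltr_wpDr.
have := key (d / (d + s)); rewrite divr_gt0//= ler_pdivrMr// mul1r lerDl s0 => /(_ isT).
rewrite mulrAC ler_pdivlMr//; nra.
Qed.

(** Countability is the point: statements that hold almost everywhere for each half-space can be
    combined. The half-spaces support the closure at the projections of rational points. If [p] is
    off the closure, a rational point much nearer to [p] than the closure is yields a half-space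
    that misses [p]. *)
Lemma rational_halfspaces : exists H : 'rV[rat]_n -> 'rV[R]_n * R,
  (forall (q : 'rV[rat]_n) x, U x -> dotv x (H q).1 <= (H q).2) /\
  (forall p, (forall q : 'rV[rat]_n, dotv p (H q).1 <= (H q).2) -> closure U p).
Proof.
have /choice[c cP] (q : 'rV[rat]_n) : exists c, closure U c /\
    forall x, U x -> dotv (x - c) (map_mx ratr q - c) <= 0.
  by have [c ? ?] := nearest_point (map_mx ratr q); exists c.
pose v (q : 'rV[rat]_n) := map_mx ratr q - c q.
exists (fun q : 'rV[rat]_n => (v q, dotv (c q) (v q))); split => [q x Ux|p pH] /=.
  by have [_ /(_ _ Ux)] := cP q; rewrite dotvBl subr_le0.
apply: contrapT => /closure_rVP/existsNP[e /not_implyP[e0 eP]].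
have eU x : U x -> e <= `|p - x|.
  by move=> Ux; rewrite leNgt; apply/negP => px; apply: eP; exists x.
have ecl x : closure U x -> e <= `|p - x|.
  move=> /closure_rVP clx; apply/ler_addgt0Pr => d d0.
  have [y Uy xy] := clx d d0; apply: (le_trans (eU y Uy)).
  rewrite -(subrK x p) -addrA (le_trans (ler_normD _ _))//.
  by rewrite subrK lerD2l ltW.
pose k : R := n%:R; have k0 : 0 <= k by rewrite ler0n.
have k2 : 0 < k + 2 by rewrite ltr_wpDl.
(* The sup norm and the scalar product differ by a factor [n]. With this choice [v q] has norm at
   least [(n + 1) e'], whereas [p] lying in the half-space would force
   [dotv (v q) (v q) <= n e'^2]. *)
pose e' := e / (k + 2); have e'0 : 0 < e' by rewrite divr_gt0.
have ee' : e = (k + 2) * e' by rewrite /e' mulrC divfK// gt_eqF.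
have [q pq] := rational_rV_dense p e'0; have [clc _] := cP q.
have := pH q => /=; rewrite -subr_le0 -dotvBl.
have vE : p - c q = (p - map_mx ratr q) + v q by rewrite /v addrA subrK.
set d := p - map_mx ratr q in pq vE; rewrite vE dotvDl => h1.
have h2 : 0 <= dotv d d + 2 * dotv d (v q) + dotv (v q) (v q).
  have := dotv_ge0 (d + 1 *: v q).
  by rewrite dotv_sqrDZ (dotvC (v q)) expr1n mulr1 mul1r.
have h3 : (k + 1) * e' <= `|v q|.
  have := ecl _ clc; rewrite vE => h3.
  have := le_trans h3 (ler_normD _ _); rewrite ee'; lra.
have h4 := norm_le_dotv (v q).
have h5 := dotv_le_norm d; rewrite -/k in h5.
have h6 : `|d| ^+ 2 <= e' ^+ 2 by rewrite ler_pXn2r ?nnegrE ?(ltW e'0)// ltW.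
have h7 : ((k + 1) * e') ^+ 2 <= `|v q| ^+ 2.
  have z0 : 0 <= (k + 1) * e' by rewrite mulr_ge0 ?addr_ge0// ltW.
  by rewrite ler_pXn2r ?nnegrE.
have h8 : k * `|d| ^+ 2 <= k * e' ^+ 2 by rewrite ler_wpM2l.
have h9 : 0 < e' ^+ 2 by rewrite exprn_gt0.
move: h7; rewrite exprMn; move: h1 h2 h4 h5 h8 h9.
set a := dotv d (v q); set b := dotv (v q) (v q); set g := dotv d d.
set z := `|v q| ^+ 2; set w := `|d| ^+ 2; set f := e' ^+ 2 => h1 h2 h4 h5 h8 h9 h7.
have : b <= k * f by lra.
have : (k + 1) ^+ 2 * f <= b by lra.
have : k * f < (k + 1) ^+ 2 * f by rewrite ltr_pM2r//; nra.
lra.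
Qed.
End open_convex.

(** * The base of a tube domain *)

Section tube_base.
Context (R : realType) (n : nat) (D : set 'rV[R[i]]_n).
Hypothesis hD : family_D D.
Implicit Types (x y v : 'rV[R]_n).

Definition rvC x : 'rV[R[i]]_n := map_mx (real_complex R) x.

Lemma re_rvC x : re_vec (rvC x) = x.
Proof. by apply/rowP => j; rewrite !mxE. Qed.

Lemma tube_baseE : D = [set z | Re_base D (re_vec z)].
Proof.
have [[U _ DU] _ _] := hD; apply/seteqP; split => z /= Dz; first by exists z.
by case: Dz => w Dw wz; rewrite DU/= -wz; move: Dw; rewrite DU.
Qed.

Lemma Re_base_rvC x : Re_base D x <-> D (rvC x).
Proof. by rewrite {2}tube_baseE /= re_rvC. Qed.

Lemma Re_base_domain : real_domain (Re_base D).
Proof.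
have [[U dU DU] _ _] := hD; suff -> : Re_base D = U by [].
apply/seteqP; split => [_ [z Dz <-]|x Ux]; first by move: Dz; rewrite DU.
by apply/Re_base_rvC; rewrite DU/= re_rvC.
Qed.

Lemma Re_base_convex x y (t : R) : Re_base D x -> Re_base D y -> 0 <= t <= 1 ->
  Re_base D (t *: x + (1 - t) *: y).
Proof.
move=> /Re_base_rvC Dx /Re_base_rvC Dy /andP[t0 t1]; apply/Re_base_rvC.
have [_ cD _] := hD.
have t0' : 0 <= t%:C%C :> R[i] by rewrite lecR.
have t1' : t%:C%C <= 1 :> R[i] by rewrite lecR.
have := cD (rvC x) (rvC y) (Itv01 t0' t1') (mem_set Dx) (mem_set Dy).
move=> /set_mem; congr D; apply/rowP => j; rewrite !mxE /=.
by rewrite realCD !rmorphM/= rmorphB.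
Qed.

Lemma Re_base_sup v : W_set D v <-> exists M : R, forall x, Re_base D x -> dotv x v <= M.
Proof.
split=> [Wv|[M UM]]; last first.
  apply: (@le_lt_trans _ _ M%:E); last exact: ltry.
  by apply: ub_ereal_sup => _ [x Ux <-]; rewrite lee_fin; exact: UM.
have [[x0 Ux0] _ _] := Re_base_domain.
exists (fine (ereal_sup [set (dotv x v)%:E | x in Re_base D])) => x Ux.
have le y : Re_base D y -> ((dotv y v)%:E <= ereal_sup [set (dotv x v)%:E | x in Re_base D])%E.
  by move=> Uy; apply: ereal_sup_ubound; exists y.
rewrite -lee_fin fineK ?le// fin_real//; apply/andP; split => //.
exact: lt_le_trans (ltNyr _) (le _ Ux0).
Qed.

Lemma W_set_ge0 v j : W_set D v -> 0 <= v 0 j.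
Proof.
have [_ _ cW] := hD => Wv.
have : closure (W_set D) v by exact: subset_closure.
by rewrite cW; exact.
Qed.

Lemma W_set_dense j (e : R) : 0 < e -> exists2 v, W_set D v & `|delta_mx 0 j - v| < e.
Proof.
have [_ _ cW] := hD; move=> e0.
have /closure_rVP : closure (W_set D) (delta_mx 0 j : 'rV[R]_n).
  by rewrite cW => i /=; rewrite mxE ler0n.
exact.
Qed.
End tube_base.

(** * Quadratics that are real on the circle after division by [l] *)

Section quadratics_on_circle.
Context (R : realType).
Local Notation T := (borel (circle R)).
Local Notation Re := complex.Re.
Local Notation Im := complex.Im.
Implicit Types (a l u : R[i]) (b : R) (w : T).

Definition circle_quadratic a b l : R[i] := a + b%:C%C * l + a^*%C * l ^+ 2.

(** The real value of [l^* (a + b l + a^* l^2)] at a point of the circle. *)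
Definition circle_trace a b w : R := b + 2 * Re (a^*%C * cval w).

Lemma cvalJK w : (cval w)^*%C * cval w = 1.
Proof. by rewrite mulrC mulJc cmod_cval expr1n. Qed.

Lemma circle_traceE a b w :
  (cval w)^*%C * circle_quadratic a b (cval w) = (circle_trace a b w)%:C%C.
Proof.
have z1 := cvalJK w; set z := cval w in z1 *.
have -> : z^*%C * circle_quadratic a b z =
    (z^*%C * z) * b%:C%C + (a * z^*%C + (z^*%C * z) * (a^*%C * z)).
  by rewrite /circle_quadratic; ring.
rewrite z1 !mul1r; apply: eqcP; rewrite !ReImE /circle_trace -/z !ReImE/=; ring.
Qed.

Lemma bmeas_circle_trace a b : bmeas (circle_trace a b).
Proof.
apply: bmeasD; first exact: bmeas_cst.
by apply: bmeasZ; have [] := cbmeasM (cbmeas_cst _ a^*%C) (@cbmeas_cval R).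
Qed.

(** Trading the quadratic at [l] for its trace at [w] cancels the pole [w = l] in the difference,
    which is [a / l - a^* l] up to a purely imaginary term. Hence the correction does not depend on
    [w]. *)
Lemma herglotz_quadratic a b l w : l != 0 -> cmod l < 1 ->
  Re (circle_quadratic a b l / l * herglotz l w) =
  poisson l w * circle_trace a b w + Re (a / l - a^*%C * l).
Proof.
move=> l0 l1; have zl := cval_sub_neq0 w l1.
have z0 : cval w != 0 by rewrite -cmod_gt0 cmod_cval.
have zJ := cvalJ w; have tr := circle_traceE a b w.
have -> : poisson l w * circle_trace a b w =
    Re ((circle_trace a b w)%:C%C * herglotz l w) by rewrite ReZ Re_herglotz mulrC.
rewrite -tr -zJ /herglotz /circle_quadratic.
set z := cval w in zl z0 zJ *.
have -> : (a + b%:C%C * l + a^*%C * l ^+ 2) / l * ((z + l) / (z - l)) =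
    z^-1 * (a + b%:C%C * z + a^*%C * z ^+ 2) * ((z + l) / (z - l)) +
    (a / l - a^*%C * l) + (a / z - a^*%C * z).
  by field; rewrite l0 z0 zl.
rewrite ReD [Re (a / z - _)](_ : _ = 0) ?addr0 ?ReD//.
by rewrite zJ !ReImE; ring.
Qed.

(** [J] is abstract because two functionals are needed: integration against a component of [mu],
    which represents [phi], and a multiple of arc length, which represents a constant. *)
Lemma quadratic_poisson (J : (T -> R) -> R) (u u0 : R[i]) a b l :
  (forall f k, bmeas f -> bmeas k -> J (fun w => f w + k w) = J f + J k) ->
  (forall c f, bmeas f -> J (fun w => c * f w) = c * J f) ->
  l != 0 -> cmod l < 1 ->
  u = (2 * pi)^-1%:C%C * (J (fun w => Re (herglotz l w)) +i*
        J (fun w => Im (herglotz l w)))%C + 'i%C * (Im u0)%:C%C ->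
  Re u0 = (2 * pi)^-1 * J (fun=> 1) ->
  Re (circle_quadratic a b l * u / l) =
    (2 * pi)^-1 * J (fun w => poisson l w * circle_trace a b w) +
    Re (a * u0 / l - (a * u0)^*%C * l).
Proof.
move=> JD JZ l0 l1 uE u0E; have [bRe bIm] := cbmeas_herglotz l1.
set K := circle_quadratic a b l / l; set c := Re (a / l - a^*%C * l).
have J1 : J (fun w => poisson l w * circle_trace a b w) =
    Re K * J (fun w => Re (herglotz l w)) - Im K * J (fun w => Im (herglotz l w)) -
    c * J (fun=> 1).
  rewrite -!mulNr -!JZ//; try exact: bmeas_cst.
  rewrite -!JD//; try by do ?apply: bmeasD; do ?apply: bmeasZ => //; exact: bmeas_cst.
  congr J; apply/funext => w.
  by have := herglotz_quadratic a b w l0 l1; rewrite -/K -/c ReM; lra.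
rewrite J1 mulrAC -/K uE.
have -> : a * u0 / l = a / l * u0 by rewrite mulrAC.
have -> : (a * u0)^*%C * l = a^*%C * l * u0^*%C by rewrite !conjCE; ring.
have KE : K = a / l + b%:C%C + a^*%C * l.
  by rewrite /K /circle_quadratic; field; exact: l0.
have : c = Re (a / l) - Re (a^*%C * l) by rewrite /c ReB.
have : Im K = Im (a / l) + Im (a^*%C * l) by rewrite KE !ImD /= addr0.
set A := a / l; set B := a^*%C * l => ImK cE.
clear KE J1 uE; clearbody K c A B.
rewrite mulrBr mulrBr -mulrCA [_ * (c * _)]mulrCA -u0E cE.
rewrite !ReM !ReB !ReM !ReD !ImD !ReM !ImM !ReJ !ImJ ImK/=; ring.
Qed.
End quadratics_on_circle.

(** * Boundary measures in terms of their decomposition *)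

Section boundary_integrals.
Context (R : realType) (n : nat).
Local Notation T := (borel (circle R)).
Local Notation L := (arc_length R).
Local Notation Re := complex.Re.
Local Notation Im := complex.Im.
Variables (phi : R[i]^o -> 'rV[R[i]]_n)
  (mu : 'I_n -> {charge set T -> \bar R})
  (g rho : T -> borel 'rV[R]_n) (nu : {finite_measure set T -> \bar R}).
Hypotheses (hmu : is_boundary_measure phi mu) (hdec : is_decomposition mu g rho nu).
Implicit Types (f k : T -> R) (l : R[i]) (j : 'I_n) (w : T).

Lemma measurable_coord j : measurable_fun setT (fun x : borel 'rV[R]_n => x 0 j).
Proof.
apply: (measurability _ (RGenOpens.measurableE R)) => // _ [_ [x [y ->]] <-].
rewrite setTI; apply: sub_sigma_algebra => /=.
by apply: (open_comp (f := fun x : 'rV[R]_n => x 0 j)); [move=> z _; exact: coord_continuous|exact: interval_open].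
Qed.

Lemma bmeas_rho j : bmeas (fun w => rho w 0 j).
Proof.
have [_ [mrho srho] _ _] := hdec.
split; first exact: (measurableT_comp (measurable_coord j) mrho).
exists 1 => w; have s1 : Num.sqrt (dotv (rho w) (rho w)) = 1 := srho w.
rewrite -s1 -sqrtr_sqr ler_wsqrtr//.
rewrite /dotv (bigD1 j)//= -expr2 lerDl; apply: sumr_ge0 => i _.
by rewrite -expr2 sqr_ge0.
Qed.

Lemma integrable_g j : L.-integrable setT (EFin \o (fun w => g w 0 j)).
Proof. by have [[_ ig] _ _ _] := hdec; exact: (ig j). Qed.

Lemma integrable_rho j : nu.-integrable setT (EFin \o (fun w => rho w 0 j)).
Proof. exact: (bmeas_integrable nu (bmeas_rho j)). Qed.

(** Integration against [mu j], written with [g], [rho] and [nu]. *)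
Definition bint j f : R :=
  \int[L]_w (f w * g w 0 j) + \int[nu]_w (f w * rho w 0 j).

Lemma charge_bint j f : bmeas f -> charge_Rintegral (mu j) f = bint j f.
Proof.
move=> bf; apply: (charge_RintegralE (integrable_g j) (integrable_rho j)) => // A mA.
by have [_ _ _] := hdec; exact.
Qed.

Lemma bintD j f k : bmeas f -> bmeas k ->
  bint j (fun w => f w + k w) = bint j f + bint j k.
Proof.
move=> bf bk; rewrite /bint addrACA.
have ig := integrable_g j; have ir := integrable_rho j.
rewrite -(RintegralD measurableT (bmeas_integrableM bf ig) (bmeas_integrableM bk ig)).
rewrite -(RintegralD measurableT (bmeas_integrableM bf ir) (bmeas_integrableM bk ir)).
by congr (_ + _); apply: eq_Rintegral => w _; rewrite mulrDl.
Qed.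

Lemma bintZ j (c : R) f : bmeas f -> bint j (fun w => c * f w) = c * bint j f.
Proof.
move=> bf; rewrite /bint mulrDr.
have ig := integrable_g j; have ir := integrable_rho j.
rewrite -(RintegralZl _ measurableT (bmeas_integrableM bf ig)).
rewrite -(RintegralZl _ measurableT (bmeas_integrableM bf ir)).
by congr (_ + _); apply: eq_Rintegral => w _; rewrite mulrA.
Qed.

Lemma phi_bint j l : cmod l < 1 -> phi l 0 j =
  (2 * pi)^-1%:C%C * (bint j (fun w => Re (herglotz l w)) +i*
     bint j (fun w => Im (herglotz l w)))%C + 'i%C * (Im (phi 0 0 j))%:C%C.
Proof.
move=> l1; have [bRe bIm] := cbmeas_herglotz l1.
have dl : unit_disc R l by rewrite /unit_disc/= normc_cmod ltcR.
by rewrite (hmu dl) /charge_Cintegral !charge_bint.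
Qed.

Lemma Re_phi j l : cmod l < 1 -> Re (phi l 0 j) = (2 * pi)^-1 * bint j (poisson l).
Proof.
move=> l1; rewrite (phi_bint j l1) ReD ReZ /= !(mul0r, mul1r, mulr0) subrr addr0.
by congr (_ * bint j _); apply/funext => w; rewrite Re_herglotz.
Qed.

Lemma poisson0 w : poisson 0 w = 1.
Proof. by rewrite /poisson cmod0 subr0 cmod_cval !expr1n expr0n subr0 divr1. Qed.

Lemma Re_phi0 j : Re (phi 0 0 j) = (2 * pi)^-1 * bint j (fun=> 1).
Proof.
rewrite Re_phi ?cmod0//; congr (_ * bint j _).
by apply/funext => w; rewrite poisson0.
Qed.

Lemma Rintegral_sum d (S : measurableType d) (m : {measure set S -> \bar R})
    (F : 'I_n -> S -> R) : (forall j, m.-integrable setT (EFin \o F j)) ->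
  m.-integrable setT (EFin \o (fun x => \sum_j F j x)) /\
  \int[m]_x (\sum_j F j x) = \sum_j \int[m]_x F j x.
Proof.
move=> iF; elim: (index_enum _) => [|j s [IH1 IH2]].
  under eq_Rintegral do rewrite big_nil; rewrite big_nil; split.
    rewrite (_ : EFin \o _ = cst 0%E); first exact: integrable0.
    by apply/funext => x /=; rewrite big_nil.
  by rewrite /Rintegral integral0.
rewrite (_ : (fun x => _) = fun x => F j x + \sum_(i <- s) F i x); last first.
  by apply/funext => x; rewrite big_cons.
split; first exact: (integrableD measurableT (iF j) IH1).
by rewrite (RintegralD measurableT (iF j) IH1) IH2 big_cons.
Qed.

Definition hcirc (h : R[i]^o -> 'rV[R[i]]_n) w : 'rV[R]_n :=
  re_vec ((cval w)^* *: h (cval w)).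

Lemma integrable_dot (c : 'I_n -> T -> R) f : (forall j, bmeas (c j)) -> bmeas f ->
  [/\ L.-integrable setT (EFin \o (fun w => dotv (g w) (\row_j c j w))),
      nu.-integrable setT (EFin \o (fun w => dotv (rho w) (\row_j c j w))) &
      \sum_j bint j (fun w => f w * c j w) =
      \int[L]_w (f w * dotv (g w) (\row_j c j w)) +
      \int[nu]_w (f w * dotv (rho w) (\row_j c j w))].
Proof.
move=> bc bP.
have dE (q : T -> 'rV[R]_n) : (fun w => dotv (q w) (\row_j c j w)) =
    fun w => \sum_j (c j w * q w 0 j).
  by apply/funext => w; apply: eq_bigr => j _; rewrite mxE mulrC.
have pE (q : T -> 'rV[R]_n) : (fun w => f w * dotv (q w) (\row_j c j w)) =
    fun w => \sum_j (f w * c j w * q w 0 j).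
  apply/funext => w; rewrite mulr_sumr; apply: eq_bigr => j _.
  by rewrite mxE (mulrC (q w 0 j)) mulrA.
have i1 j := bmeas_integrableM (bc j) (integrable_g j).
have i2 j := bmeas_integrableM (bc j) (integrable_rho j).
have i3 j := bmeas_integrableM (bmeasM bP (bc j)) (integrable_g j).
have i4 j := bmeas_integrableM (bmeasM bP (bc j)) (integrable_rho j).
rewrite !dE !pE; split.
- exact: (Rintegral_sum i1).1.
- exact: (Rintegral_sum i2).1.
- by rewrite (Rintegral_sum i3).2 (Rintegral_sum i4).2 -big_split.
Qed.

Lemma Re_phi_dot v l : cmod l < 1 ->
  [/\ L.-integrable setT (EFin \o (fun w => dotv (g w) v)),
      nu.-integrable setT (EFin \o (fun w => dotv (rho w) v)) &
      2 * pi * dotv (re_vec (phi l)) v =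
      \int[L]_w (poisson l w * dotv (g w) v) +
      \int[nu]_w (poisson l w * dotv (rho w) v)].
Proof.
move=> l1; have bv j : bmeas (fun _ : T => v 0 j) by exact: bmeas_cst.
have := integrable_dot bv (bmeas_poisson l1); have -> : \row_j v 0 j = v by apply/rowP => j; rewrite mxE.
move=> [h1 h2 h3]; split => //; rewrite -h3 mulr_sumr; apply: eq_bigr => j _.
rewrite !mxE Re_phi// mulrA mulrA divff ?gt_eqF ?two_pi_gt0// mul1r mulrC -bintZ; last first.
  exact: bmeas_poisson.
by congr bint; apply/funext => w; rewrite mulrC.
Qed.

Section quadratic_field.
Variables (h : R[i]^o -> 'rV[R[i]]_n) (a : 'I_n -> R[i]) (b : 'I_n -> R).
Hypothesis hq : forall j l, cmod l <= 1 -> h l 0 j = circle_quadratic (a j) (b j) l.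
Implicit Type z : 'rV[R[i]]_n.

Lemma hcircE w : hcirc h w = \row_j circle_trace (a j) (b j) w.
Proof.
by apply/rowP => j; rewrite !mxE hq ?cmod_cval// [_ * _]circle_traceE.
Qed.

Lemma hcirc_circle w j : (cval w)^*%C * h (cval w) 0 j = (hcirc h w 0 j)%:C%C.
Proof. by rewrite hcircE mxE hq ?cmod_cval// circle_traceE. Qed.

Lemma bmeas_hcirc j : bmeas (fun w => hcirc h w 0 j).
Proof.
under eq_fun do rewrite hcircE mxE.
exact: bmeas_circle_trace.
Qed.

(** The bilinear pairing [<z - phi l, h l>]; if [h] is the gradient of a left inverse, it is the
    field by which points move when [phi] is deformed towards [z]. *)
Definition Ffield z l : R[i] := \sum_j h l 0 j * (z 0 j - phi l 0 j).

(** The pivot of both implications. Once the tangent field with the same value at 0 is split off,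
    what remains of the field divided by [l] has as real part a Poisson integral, with density
    [<Re z - g, l^* h>] and singular part [- <rho, l^* h>]. Coordinatewise it is [quadratic_poisson]
    for the constant [z 0 j] minus the one for [phi]. *)
Lemma Re_Ffield z l : l != 0 -> cmod l < 1 ->
  [/\ L.-integrable setT (EFin \o (fun w => dotv (re_vec z - g w) (hcirc h w))),
      nu.-integrable setT (EFin \o (fun w => - dotv (rho w) (hcirc h w))) &
  2 * pi * Re (Ffield z l / l) =
    2 * pi * Re (Ffield z 0 / l - (Ffield z 0)^*%C * l) +
    (\int[L]_w (poisson l w * dotv (re_vec z - g w) (hcirc h w)) +
     \int[nu]_w (poisson l w * - dotv (rho w) (hcirc h w)))].
Proof.
move=> l0 l1; have p0 := two_pi_gt0 R.
have pn : 2 * pi != 0 :> R by rewrite gt_eqF.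
pose c j := circle_trace (a j) (b j).
have bc j : bmeas (c j) by exact: bmeas_circle_trace.
have [i1 i2 i3] := integrable_dot bc (bmeas_poisson l1); have bP := bmeas_poisson l1.
have a0 j : a j = h 0 0 j by rewrite hq ?cmod0// /circle_quadratic mulr0 expr0n mulr0 !addr0.
have bx : bmeas (fun w => dotv (re_vec z) (hcirc h w)).
  under eq_fun do rewrite hcircE; rewrite /dotv.
  elim: (index_enum _) => [|j s IH].
    by under eq_fun do rewrite big_nil; exact: bmeas_cst.
  under eq_fun do rewrite big_cons mxE; apply: bmeasD => //.
  exact: (bmeasZ _ (bc j)).
have hE : hcirc h = fun w => \row_j c j w by apply/funext => w; rewrite hcircE.
have {}i1 : L.-integrable setT (EFin \o (fun w => dotv (g w) (hcirc h w))) by rewrite hE.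
have {}i2 : nu.-integrable setT (EFin \o (fun w => dotv (rho w) (hcirc h w))) by rewrite hE.
have {}i3 : \sum_j bint j (fun w => poisson l w * c j w) =
    \int[L]_w (poisson l w * dotv (g w) (hcirc h w)) +
    \int[nu]_w (poisson l w * dotv (rho w) (hcirc h w)) by rewrite hE.
have ix := bmeas_integrable L bx.
split.
- rewrite (_ : EFin \o _ = fun w => ((dotv (re_vec z) (hcirc h w))%:E - (dotv (g w) (hcirc h w))%:E)%E).
    exact: integrableB.
  by apply/funext => w; rewrite /= dotvBl EFinB.
- rewrite (_ : EFin \o _ = (\- (EFin \o (fun w => dotv (rho w) (hcirc h w))))%E)//.
  exact: integrableN.
have iP1 := bmeas_integrableM bP i1; have iP2 := bmeas_integrableM bP i2.
have iPx := bmeas_integrable L (bmeasM bP bx).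
have -> : \int[nu]_w (poisson l w * - dotv (rho w) (hcirc h w)) =
    - \int[nu]_w (poisson l w * dotv (rho w) (hcirc h w)).
  rewrite -mulN1r -(RintegralZl _ measurableT iP2).
  by apply: eq_Rintegral => w _; rewrite mulN1r mulrN.
have -> : \int[L]_w (poisson l w * dotv (re_vec z - g w) (hcirc h w)) =
    \int[L]_w (poisson l w * dotv (re_vec z) (hcirc h w)) -
    \int[L]_w (poisson l w * dotv (g w) (hcirc h w)).
  rewrite -(RintegralB measurableT iPx iP1).
  by apply: eq_Rintegral => w _; rewrite dotvBl mulrBr.
have xE : \int[L]_w (poisson l w * dotv (re_vec z) (hcirc h w)) =
    \sum_j Re (z 0 j) * \int[L]_w (poisson l w * c j w).
  have ij j := bmeas_integrable L (bmeasZ (Re (z 0 j)) (bmeasM bP (bc j))).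
  transitivity (\int[L]_w (\sum_j Re (z 0 j) * (poisson l w * c j w))).
    apply: eq_Rintegral => w _; rewrite hE mulr_sumr; apply: eq_bigr => j _.
    by rewrite !mxE mulrCA.
  rewrite (Rintegral_sum ij).2; apply: eq_bigr => j _.
  by rewrite (RintegralZl _ measurableT (bmeas_integrable L (bmeasM bP (bc j)))).
rewrite xE -addrA -opprD -i3 -sumrB.
have jE j : 2 * pi * Re (h l 0 j * (z 0 j - phi l 0 j) / l) =
    2 * pi * Re (h 0 0 j * (z 0 j - phi 0 0 j) / l - (h 0 0 j * (z 0 j - phi 0 0 j))^*%C * l) +
    (Re (z 0 j) * \int[L]_w (poisson l w * c j w) - bint j (fun w => poisson l w * c j w)).
  have := @quadratic_poisson R (bint j) (phi l 0 j) (phi 0 0 j) (a j) (b j) l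
    (@bintD j) (@bintZ j) l0 l1 (phi_bint j l1) (Re_phi0 j).
  (* The measure representing the constant [z 0 j]: by [herglotz_mean] arc length integrates the
     Herglotz kernel to [2 pi]. *)
  pose J f := Re (z 0 j) * \int[L]_w f w.
  have JD f k : bmeas f -> bmeas k -> J (fun w => f w + k w) = J f + J k.
    move=> bf bk; rewrite /J -mulrDr; congr (_ * _).
    by rewrite (RintegralD measurableT (bmeas_integrable L bf) (bmeas_integrable L bk)).
  have JZ (e : R) f : bmeas f -> J (fun w => e * f w) = e * J f.
    by move=> bf; rewrite /J (RintegralZl _ measurableT (bmeas_integrable L bf)) mulrCA.
  have [m1 m2] := herglotz_mean l1.
  have zE : z 0 j = (2 * pi)^-1%:C%C * (J (fun w => Re (herglotz l w)) +i*
        J (fun w => Im (herglotz l w)))%C + 'i%C * (Im (z 0 j))%:C%C.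
    rewrite /J m1 m2; move: (2 * pi) pn => p p_neq0.
    by apply: eqcP; rewrite !ReImE/=; field.
  have z0E : Re (z 0 j) = (2 * pi)^-1 * J (fun=> 1).
    rewrite /J Rintegral_cst// (congr1 fine (arc_lengthT R))/=.
    by rewrite mul1r mulrCA mulVf// mulr1.
  have := @quadratic_poisson R J (z 0 j) (z 0 j) (a j) (b j) l JD JZ l0 l1 zE z0E.
  rewrite /J -hq ?(ltW l1)// -a0 -/(c j).
  set I1 := \int[L]_w _; set I2 := bint _ _ => q1 q2.
  have -> : h l 0 j * (z 0 j - phi l 0 j) / l = h l 0 j * z 0 j / l - h l 0 j * phi l 0 j / l.
    by rewrite mulrBr mulrBl.
  have -> : a j * (z 0 j - phi 0 0 j) / l - (a j * (z 0 j - phi 0 0 j))^*%C * l =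
      (a j * z 0 j / l - (a j * z 0 j)^*%C * l) -
      (a j * phi 0 0 j / l - (a j * phi 0 0 j)^*%C * l).
    by rewrite !conjCE; ring.
  rewrite (ReB (_ / l)) q1 q2 (ReB (_ - _)).
  by move: (2 * pi) pn => p p_neq0; field.
have sumRe (s : seq 'I_n) (G : 'I_n -> R[i]) : Re (\sum_(j <- s) G j) = \sum_(j <- s) Re (G j).
  by elim: s => [|j s IH]; rewrite ?big_nil// !big_cons ReD IH.
transitivity (\sum_j 2 * pi * Re (h l 0 j * (z 0 j - phi l 0 j) / l)).
  by rewrite -mulr_sumr -sumRe -mulr_suml.
rewrite (eq_bigr _ (fun j _ => jE j)) big_split/=; congr (_ + _).
rewrite -mulr_sumr; congr (_ * _); rewrite -sumRe; congr Re.
by rewrite sumrB -!mulr_suml -rmorph_sum.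
Qed.
End quadratic_field.
End boundary_integrals.

(* Differentiability over normed spaces given abstractly: the topology of
   ['rV[R[i]]_n] is found only through its structure of normed space. *)
Section vector_differentiability.
Context (R : realType).

Definition vdifferentiable (V W : normedModType R[i]) (f : V -> W) (p : V) : Prop :=
  differentiable f p.

Definition vdiff (V W : normedModType R[i]) (f : V -> W) (p : V) : V -> W := 'd f p.

Lemma vdifferentiable_directional (V : normedModType R[i]) (f : V -> R[i]^o)
    (p w : V) (e : R) :
  vdifferentiable f p -> 0 < e -> exists2 del : R, 0 < del &
    forall t : R, 0 < t < del ->
      cmod (f (p + t%:C%C *: w) - f p - t%:C%C * (vdiff f p w : R[i])) <= e * t.
Proof.
rewrite /vdifferentiable => df e0; have /derivable_nbhs/eqaddoP dq := @diff_derivable _ _ _ f p w df.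
have eC0 : 0 < e%:C%C :> R[i] by rewrite ltcR.
move: (dq _ eC0) => /nbhs_norm0P[d0 /= d00 dP].
have [d d_gt0 dE] := gt0_realC d00; exists d => // t /andP[t0 td].
have nt : `|t%:C%C : R[i]^o| < d%:C%C by rewrite normc_cmod cmod_real gtr0_norm// ltcR.
rewrite dE in dP; have := dP t%:C%C nt; rewrite /=.
rewrite -![(_ + _ : _ -> _) _]/(_ + _) -![(- _ : _ -> _) _]/(- _) /cst /=.
rewrite opprD addrA [_ *: w + p]addrC deriveE//.
by rewrite !normc_cmod -rmorphM/= lecR cmod_real gtr0_norm.
Qed.

Lemma vdiff_sum (V : normedModType R[i]) (f : V -> R[i]^o) (p : V) n
    (c : 'I_n -> R[i]) (v : 'I_n -> V) :
  vdiff f p (\sum_j c j *: v j) = \sum_j c j * (vdiff f p (v j) : R[i]).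
Proof.
rewrite /vdiff linear_sum; apply: eq_bigr => j _.
by rewrite linearZ.
Qed.

Lemma vdifferentiable_comp (V : normedModType R[i]) (f : R[i]^o -> V) (g : V -> R[i]^o)
    (l : R[i]^o) :
  vdifferentiable f l -> vdifferentiable g (f l) -> cdifferentiable (g \o f) l.
Proof. exact: differentiable_comp. Qed.

Lemma vdifferentiable_addZ (V W : normedModType R[i]) (f g : V -> W) (p : V) (c : R[i]) :
  vdifferentiable f p -> vdifferentiable g p ->
  vdifferentiable (fun l => f l + c *: g l) p.
Proof.
by move=> df dg; apply: differentiableD => //; exact: differentiableZ.
Qed.

Lemma vdifferentiable_cst (V W : normedModType R[i]) (c : W) (p : V) :
  vdifferentiable (fun=> c) p.
Proof. exact: differentiable_cst. Qed.

Lemma vdiff_left_inverse (V : normedModType R[i]) (f : R[i]^o -> V) (g : V -> R[i]^o) :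
  vdifferentiable f 0 -> vdifferentiable g (f 0) ->
  (forall l, unit_disc R l -> g (f l) = l) ->
  vdiff g (f 0) (vdiff f 0 1) = 1.
Proof.
move=> df dg fg; have dfg := differentiable_comp df dg.
have near_id : \forall l \near (0 : R[i]^o), (g \o f) l = l.
  apply/nbhs_ballP; exists 1 => //= l; rewrite /ball/= sub0r normrN => l1.
  exact: fg.
have D1 : 'D_1 (g \o f) (0 : R[i]^o) = (1 : R[i]^o).
  by rewrite (near_eq_derive _ near_id); exact: derive_id.
by move: D1; rewrite deriveE// diff_comp.
Qed.
Definition gradient n (f : 'rV[R[i]]_n -> R[i]^o) p (j : 'I_n) : R[i] :=
  vdiff f p (delta_mx 0 j).
End vector_differentiability.

Lemma sum_delta (K : fieldType) n (c : K) (j : 'I_n) (G : 'I_n -> K) :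
  \sum_k (c *: delta_mx 0 j : 'rV[K]_n) 0 k * G k = c * G j.
Proof.
rewrite (bigD1 j)//= big1 ?addr0 => [|k kj]; first by rewrite !mxE !eqxx mulr1.
by rewrite !mxE (negPf kj) andbF mulr0 mul0r.
Qed.

(** * The gradient of a left inverse along [phi] *)

Section left_inverse.
Context (R : realType) (n : nat).
Local Notation Re := complex.Re.
Variables (D : set 'rV[R[i]]_n) (phi : R[i]^o -> 'rV[R[i]]_n) (f : 'rV[R[i]]_n -> R[i]^o).
Hypotheses (hD : family_D D) (hphi : holomorphic_on (unit_disc R) phi)
  (phiD : forall l, unit_disc R l -> D (phi l)) (hf : holomorphic_on D f)
  (fD : forall z, D z -> unit_disc R (f z))
  (fphi : forall l, unit_disc R l -> f (phi l) = l).
Implicit Types (l : R[i]) (z w : 'rV[R[i]]_n).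

Let discE l : cmod l < 1 -> unit_disc R l.
Proof. by rewrite /unit_disc/= normc_cmod ltcR. Qed.

Let cmod_f z : D z -> cmod (f z) <= 1.
Proof. by move=> /fD; rewrite /unit_disc/= normc_cmod ltcR => /ltW. Qed.

Let grad l j : R[i] := gradient f (phi l) j.

Let expansion (w : R[i] -> 'rV[R[i]]_n) l (e : R) : cmod l < 1 -> 0 < e ->
  exists2 del : R, 0 < del & forall t, 0 < t < del ->
    cmod (f (phi l + t%:C%C *: w l) - l - t%:C%C * \sum_j w l 0 j * grad l j) <= e * t.
Proof.
move=> /discE dl e0; have df : vdifferentiable f (phi l) by apply: hf; exact: phiD.
have [del del0 delP] := vdifferentiable_directional (w l) df e0.
exists del => // t tdel; have := delP t tdel.
by rewrite {2}(row_sum_delta (w l)) vdiff_sum fphi.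
Qed.

Let generator (w : R[i] -> 'rV[R[i]]_n) m l b :
  (forall t : R, 0 < t < 1 -> forall l, cmod l < 1 -> D (phi l + t%:C%C *: w l)) ->
  (forall l, cmod l < 1 -> vdifferentiable (w : R[i]^o -> 'rV[R[i]]_n) (l : R[i]^o)) ->
  cmod m < 1 -> cmod l < 1 -> l != m ->
  b - b^*%C * m ^+ 2 = \sum_j w m 0 j * grad m j ->
  Re ((\sum_j w l 0 j * grad l j - (b - b^*%C * l ^+ 2)) / ((l - m) * (1 - m^*%C * l))) <= 0.
Proof.
move=> wD dw; apply: (@self_map_family_generator R (fun t l => f (phi l + t%:C%C *: w l))
  (fun l => \sum_j w l 0 j * grad l j) 1) => //.
- move=> t t01 l' l'1.
  apply: (@vdifferentiable_comp _ _ (fun l' : R[i]^o => phi l' + t%:C%C *: w l') f).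
    by apply: vdifferentiable_addZ; [apply: hphi; exact: discE|exact: dw].
  by apply: hf; exact: wD.
- by move=> t t01 l' l'1; apply: cmod_f; exact: wD.
- by move=> l' l'1 e e0; exact: expansion.
Qed.

Let imag_shift (s : R) j l (t : R) : cmod l < 1 ->
  D (phi l + t%:C%C *: (('i%C * s%:C%C) *: delta_mx 0 j)).
Proof.
move=> /discE/phiD; rewrite (tube_baseE hD) /=; congr (Re_base D _).
apply/rowP => i; rewrite !mxE; case: (_ && _); rewrite ?mulr1 ?mulr0 ?addr0//.
by rewrite !ReImE/=; ring.
Qed.

Let gradE j m l b (s : R) : cmod m < 1 -> cmod l < 1 -> l != m ->
  b - b^*%C * m ^+ 2 = 'i%C * s%:C%C * grad m j ->
  Re (('i%C * s%:C%C * grad l j - (b - b^*%C * l ^+ 2)) / ((l - m) * (1 - m^*%C * l))) <= 0.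
Proof.
move=> m1 l1 lm bE.
have sumE (l' : R[i]) : \sum_k (('i%C * s%:C%C) *: (delta_mx 0 j : 'rV[R[i]]_n)) 0 k * grad l' k =
    'i%C * s%:C%C * grad l' j by exact: sum_delta.
rewrite -(sumE l); rewrite -(sumE m) in bE.
apply: (@generator (fun=> ('i%C * s%:C%C) *: delta_mx 0 j) m l b _ _ m1 l1 lm bE).
  by move=> t _ l' l'1; exact: imag_shift.
by move=> l' _; exact: vdifferentiable_cst.
Qed.

Lemma left_inverse_gradient : exists g : 'I_n -> R, forall j l, cmod l < 1 ->
  grad l j = circle_quadratic (grad 0 j) (g j) l.
Proof.
suff /choice[g gP] : forall j, exists g : R, forall l, cmod l < 1 ->
    grad l j = circle_quadratic (grad 0 j) g l by exists g.
move=> j; have [g gP] : exists g : R, forall l, cmod l < 1 ->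
    'i%C * grad l j = 'i%C * grad 0 j - ('i%C * grad 0 j)^*%C * l ^+ 2 + 'i%C * g%:C%C * l.
  apply: (generator_rigidity (E := fun l => 'i%C * grad l j)) => m l b m1 l1 lm bE.
  apply/eqP; rewrite eq_le; apply/andP; split.
    have := @gradE j m l b 1 m1 l1 lm; rewrite !mulr1; exact.
  have sE (l' : R[i]) : 'i%C * (-1)%:C%C * grad l' j = - ('i%C * grad l' j).
    by rewrite rmorphN1; ring.
  have bE' : - b - (- b)^*%C * m ^+ 2 = 'i%C * (-1)%:C%C * grad m j.
    by rewrite sE -bE !conjCE; ring.
  have := @gradE j m l (- b) (-1) m1 l1 lm bE'; rewrite sE.
  rewrite (_ : - ('i%C * grad l j) - _ = - ('i%C * grad l j - (b - b^*%C * l ^+ 2))).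
    by rewrite mulNr ReN oppr_le0.
  by rewrite conjCN; move: (grad l j) b^*%C => u v; ring.
exists g => l l1; have i0 : 'i%C != 0 :> R[i] by rewrite eq_complex/= oner_eq0 andbF.
apply: (mulfI i0); rewrite gP// /circle_quadratic conjCM conjCi.
by move: (grad 0 j) (grad 0 j)^*%C => u v; ring.
Qed.

(** The chain rule for [f (phi l) = l] at 0 excludes a vanishing gradient. *)
Lemma left_inverse_gradient_neq0 : exists j, grad 0 j != 0.
Proof.
apply: contrapT => /forallNP h0; have g0 j : grad 0 j = 0.
  by apply/eqP; have /negP := h0 j; rewrite negbK.
have d0 : unit_disc R 0 by apply: discE; rewrite cmod0.
have dphi : vdifferentiable phi (0 : R[i]^o) by exact: hphi.
have df : vdifferentiable f (phi 0) by apply: hf; exact: phiD.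
have := vdiff_left_inverse dphi df fphi.
rewrite (row_sum_delta (vdiff phi 0 1)) vdiff_sum big1 => [/esym/eqP|j _].
  by rewrite oner_eq0.
by rewrite -/(gradient f (phi 0) j) -/(grad 0 j) g0 mulr0.
Qed.

Let field z l : R[i] := \sum_j grad l j * (z 0 j - phi l 0 j).

Lemma left_inverse_generator z l : D z -> l != 0 -> cmod l < 1 ->
  Re (field z l / l) <= Re (field z 0 / l - (field z 0)^*%C * l).
Proof.
move=> Dz l0 l1; set F := field z.
have sumE (l' : R[i]) : \sum_j (z - phi l') 0 j * grad l' j = F l'.
  by apply: eq_bigr => j _; rewrite !mxE mulrC.
have c0 : cmod (0 : R[i]) < 1 by rewrite cmod0.
have b0 : F 0 - (F 0)^*%C * 0 ^+ 2 = \sum_j (z - phi 0) 0 j * grad 0 j.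
  by rewrite sumE expr0n mulr0 subr0.
rewrite -subr_le0 -ReB.
have -> : F l / l - (F 0 / l - (F 0)^*%C * l) =
    (\sum_j (z - phi l) 0 j * grad l j - (F 0 - (F 0)^*%C * l ^+ 2)) /
    ((l - 0) * (1 - 0^*%C * l)).
  by rewrite sumE conjc0 mul0r !subr0 mulr1; field; exact: l0.
apply: (@generator (fun l' => z - phi l') 0 l (F 0) _ _ c0 l1 l0 b0).
- move=> t /andP[t0 t1] l' /discE/phiD; rewrite (tube_baseE hD)/= => Ul'.
  have Uz : Re_base D (re_vec z) by move: Dz; rewrite {1}(tube_baseE hD).
  have := Re_base_convex hD Uz Ul'; move=> /(_ t); rewrite !ltW// => /(_ isT).
  congr (Re_base D _); apply/rowP => j; rewrite !mxE !ReImE/=; ring.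
- move=> l' l'1; under eq_fun do rewrite -scaleN1r.
  apply: vdifferentiable_addZ; first exact: vdifferentiable_cst.
  by apply: hphi; exact: discE.
Qed.
End left_inverse.

(** * Null sets on the circle and zeros of traces *)

Section circle_null_sets.
Context (R : realType).
Local Notation T := (borel (circle R)).
Local Notation L := (arc_length R).
Local Notation Re := complex.Re.
Local Notation Im := complex.Im.
Implicit Types (w : T) (a : R[i]) (b : R).

Lemma ae_forall_countable d (S : measurableType d) (m : {measure set S -> \bar R})
    (C : countType) (P : C -> S -> Prop) :
  (forall c, \forall w \ae m, P c w) -> \forall w \ae m, forall c, P c w.
Proof.
move=> aeP; pose Q k (w : S) := if @unpickle C k is Some c then P c w else True.
have : \forall w \ae m, forall k, Q k w.
  apply: ae_foralln => k; rewrite /Q; case: unpickle => [c|]; first exact: aeP.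
  exact: aeW.
by apply: filterS => w Qw c; have := Qw (pickle c); rewrite /Q pickleK.
Qed.

Lemma measurable_circle1 w0 : measurable [set w0].
Proof.
have ld : clipschitz (fun w : T => cmod (cval w - cval w0)).
  exists 1 => // w w'; rewrite mul1r ler_norml; apply/andP; split.
    have := cmodD (cval w - cval w0) (cval w' - cval w).
    have -> : cval w - cval w0 + (cval w' - cval w) = cval w' - cval w0 by ring.
    by rewrite (cmodBC (cval w) (cval w')); lra.
  have := cmodD (cval w' - cval w0) (cval w - cval w').
  have -> : cval w' - cval w0 + (cval w - cval w') = cval w - cval w0 by ring.
  by lra.
rewrite (_ : [set w0] = (fun w : T => cmod (cval w - cval w0)) @^-1` [set 0]).
  by rewrite -[X in measurable X]setTI; apply: clipschitz_measurable.
apply/seteqP; split => w /=; first by move=> ->; rewrite subrr cmod0.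
by move/eqP; rewrite cmod_eq0 subr_eq0 => /eqP/cval_inj.
Qed.

(** At [l = (1 - s) w0] the Poisson kernel is at least [1 / s] at [w0] and has integral [2 pi], so
    the mass of the point is at most [2 pi s]. *)
Lemma arc_length1 w0 : L [set w0] = 0%E.
Proof.
have mw := measurable_circle1 w0; have p0 := two_pi_gt0 R.
have fL : L [set w0] \is a fin_num by exact: fin_num_measure.
set m := fine (L [set w0]); rewrite -(fineK fL) -/m.
have m0 : 0 <= m by rewrite fine_ge0.
suff m00 : m <= 0 by congr _%:E; apply/eqP; rewrite eq_le m00.
rewrite leNgt; apply/negP => mgt0.
have key (s : R) : 0 < s < 1 -> m <= 2 * pi * s.
  move=> /andP[s0 s1]; pose r := 1 - s; pose l := r%:C%C * cval w0.
  have rw1 : cmod l = r.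
    by rewrite cmodM cmod_cval cmod_real mulr1 gtr0_norm// subr_gt0.
  have l1 : cmod l < 1 by rewrite rw1 /r; lra.
  rewrite -ler_pdivrMr// -(poisson_mean l1).
  have -> : m / s = \int[L]_w (s^-1 * \1_[set w0] w).
    rewrite (RintegralZl _ measurableT (bmeas_integrable L (bmeas_indic mw))).
    by rewrite /Rintegral integral_indic// setIT mulrC.
  apply: le_Rintegral => //.
  - exact: (bmeas_integrable L (bmeasZ _ (bmeas_indic mw))).
  - exact: (bmeas_integrable L (bmeas_poisson l1)).
  move=> w _; rewrite indicE; have [/set_mem/= ->|_] := boolP (w \in [set w0]); last first.
    by rewrite mulr0 ltW// poisson_gt0.
  rewrite mulr1 /poisson rw1.
  have -> : cval w0 - l = s%:C%C * cval w0.
    by rewrite /l /r rmorphB rmorph1; ring.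
  rewrite cmodM cmod_cval mulr1 cmod_real gtr0_norm//.
  rewrite (_ : 1 - r ^+ 2 = (2 - s) * s); last by rewrite /r; ring.
  by rewrite expr2 invfM mulrA mulfK ?gt_eqF// ler_pMl ?invr_gt0//; lra.
have mp : 0 < 2 * (2 * pi + m) by lra.
have s01 : 0 < m / (2 * (2 * pi + m)) < 1.
  by rewrite divr_gt0//= ltr_pdivrMr// mul1r; lra.
have := key _ s01; rewrite mulrA ler_pdivlMr//; nra.
Qed.

Lemma circle_trace_lipschitz a b : clipschitz (circle_trace a b).
Proof.
exists (2 * cmod a) => [|w w']; first by rewrite mulr_ge0.
rewrite /circle_trace opprD addrACA subrr add0r -mulrBr -ReB -mulrBr normrM.
rewrite ger0_norm// -mulrA ler_wpM2l// (le_trans (ler_Re_cmod _))//.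
by rewrite cmodM cmodJ.
Qed.

(** Poisson integrals do not see null sets, and they approximate [f] uniformly. *)
Lemma clipschitz_ge0 (f : T -> R) : clipschitz f ->
  (\forall w \ae L, 0 <= f w) -> forall w, 0 <= f w.
Proof.
move=> lf f0 w'; have p0 := two_pi_gt0 R; have bf := clipschitz_bmeas lf.
rewrite -(pmulr_rge0 _ p0); apply/ler_addgt0Pr => e e0.
have [r /andP[r0 r1] rP] := poisson_approximation lf e0.
have := rP w'; set l := r%:C%C * cval w'.
have l1 : cmod l < 1 by rewrite cmodM cmod_cval cmod_real mulr1 gtr0_norm.
suff I0 : 0 <= \int[L]_w (f w * poisson l w) by move=> /ler_normlW; rewrite lerBlDl => /(le_trans I0).
have bP := bmeas_poisson l1.
have -> : \int[L]_w (f w * poisson l w) = \int[L]_w (`|f w| * poisson l w).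
  congr fine; apply: ae_eq_integral => //.
  - by apply/measurable_EFinP; have [] := bmeasM bf bP.
  - by apply/measurable_EFinP; have [] := bmeasM (bmeas_norm bf) bP.
  - by apply: filterS f0 => w fw _; rewrite ger0_norm.
by apply: Rintegral_ge0 => w _; rewrite mulr_ge0// ltW// poisson_gt0.
Qed.

Lemma circle_trace_argmin a b : exists u : T, circle_trace a b u = b - 2 * cmod a.
Proof.
have [a0|an0] := eqVneq a 0.
  by exists (expi 0); rewrite /circle_trace a0 conjc0 mul0r cmod0 mulr0 subr0 addr0.
have ca : 0 < cmod a by rewrite cmod_gt0.
have [u uE] : exists u : T, cval u = - (a / (cmod a)%:C%C).
  apply: circle_ex; rewrite cmodN cmodM cmodV cmod_real gtr0_norm//.
  by rewrite divff// gt_eqF.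
exists u; rewrite /circle_trace uE.
have -> : a^*%C * - (a / (cmod a)%:C%C) = - (a * a^*%C / (cmod a)%:C%C) by ring.
rewrite mulJc expr2 realCM mulfK ?ReN ?mulrN//.
by rewrite eq_complex/= eqxx andbT gt_eqF.
Qed.

Lemma circle_trace_ge a b w : b - 2 * cmod a <= circle_trace a b w.
Proof.
have := ler_Re_cmod (a^*%C * cval w).
rewrite cmodM cmodJ cmod_cval mulr1 ler_norml => /andP[h _].
by rewrite /circle_trace; lra.
Qed.

(** The minimum of the trace is [b - 2 |a|], so a nonnegative trace with a zero attains it there,
    where [a^* w] lies on the negative axis. A nonzero quadratic therefore has at most one such
    zero. *)
Lemma circle_trace_zeroE a b w : (forall u, 0 <= circle_trace a b u) ->
  circle_trace a b w = 0 -> b = 2 * cmod a /\ a^*%C * cval w = - (cmod a)%:C%C.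
Proof.
move=> t0 tw; have [u uE] := circle_trace_argmin a b.
have := circle_trace_ge a b w; rewrite tw; have := t0 u; rewrite uE => h1 h2.
have bE : b = 2 * cmod a by lra.
split => //; move: tw; rewrite /circle_trace bE.
have := sqr_cmod (a^*%C * cval w); rewrite cmodM cmodJ cmod_cval mulr1.
set z := a^*%C * cval w => za tw; have rz : Re z = - cmod a by lra.
have i0 : Im z = 0.
  by apply/eqP; rewrite -sqrf_eq0; apply/eqP; move: za; rewrite rz sqrrN; lra.
by apply: eqcP; rewrite ?ReN ?ImN/= ?i0 ?oppr0.
Qed.

Lemma circle_trace_zero a b w w' : (forall u, 0 <= circle_trace a b u) ->
  (a != 0) || (b != 0) -> circle_trace a b w = 0 -> circle_trace a b w' = 0 -> w = w'.
Proof.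
move=> t0 ab tw tw'; have [bE aw] := circle_trace_zeroE t0 tw.
have [_ aw'] := circle_trace_zeroE t0 tw'.
have aJ : a^*%C != 0.
  rewrite -cmod_gt0 cmodJ cmod_gt0; apply: contraTN ab => /eqP a0.
  by rewrite negb_or !negbK bE a0 cmod0 mulr0 !eqxx.
by apply: cval_inj; apply: (mulfI aJ); rewrite aw aw'.
Qed.
End circle_null_sets.

(** * Necessity of the conditions *)

Section necessity.
Context (R : realType) (n : nat).
Local Notation T := (borel (circle R)).
Local Notation L := (arc_length R).
Local Notation Re := complex.Re.
Variables (D : set 'rV[R[i]]_n) (phi : R[i]^o -> 'rV[R[i]]_n)
  (mu : 'I_n -> {charge set T -> \bar R})
  (g rho : T -> borel 'rV[R]_n) (nu : {finite_measure set T -> \bar R}).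
Hypotheses (hD : family_D D) (hmu : is_boundary_measure phi mu)
  (hdec : is_decomposition mu g rho nu)
  (phiD : forall l, unit_disc R l -> D (phi l)).
Implicit Types (w : T) (j : 'I_n) (v x : 'rV[R]_n).

Let sing : mutually_singular nu L.
Proof. by have [] := hdec. Qed.

Let U := Re_base D.

(** [M - <Re phi, v>] is nonnegative and is the normalized Poisson integral of
    [(M - <g, v>) dL - <rho, v> dnu]; the sign lemma reads off both densities. *)
Lemma base_bound v (M : R) : (forall x, U x -> dotv x v <= M) ->
  (\forall w \ae L, dotv (g w) v <= M) /\ (\forall w \ae nu, dotv (rho w) v <= 0).
Proof.
move=> UM; have c0 : cmod (0 : R[i]) < 1 by rewrite cmod0.
have [ig ir _] := Re_phi_dot hmu hdec v c0.
have igM : L.-integrable setT (EFin \o (fun w => dotv (g w) v - M)).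
  rewrite (_ : EFin \o _ = fun w => ((dotv (g w) v)%:E - M%:E)%E); last first.
    by apply/funext => w; rewrite /= EFinB.
  by apply: integrableB => //; exact: (bmeas_integrable L (bmeas_cst _ M)).
have [|h1 h2] := sign_lemma igM ir sing; last first.
  by split => //; apply: filterS h1 => w; rewrite subr_le0.
move=> l /andP[l0 l1]; have [_ _ lE] := Re_phi_dot hmu hdec v l1.
have bP := bmeas_poisson l1; have p0 := two_pi_gt0 R.
have -> : \int[L]_w (poisson l w * (dotv (g w) v - M)) =
    \int[L]_w (poisson l w * dotv (g w) v) - M * (2 * pi).
  rewrite -(poisson_mean l1) -(RintegralZl _ measurableT (bmeas_integrable L bP)).
  rewrite -(RintegralB measurableT (bmeas_integrableM bP ig) (bmeas_integrable L (bmeasZ M bP))).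
  by apply: eq_Rintegral => w _; rewrite mulrBr (mulrC M).
rewrite addrAC -lE mulrC -mulrBl pmulr_lle0// subr_le0; apply: UM.
by exists (phi l) => //; apply: phiD; rewrite /unit_disc/= normc_cmod ltcR.
Qed.

Lemma ae_closure_base : \forall w \ae L, closure U (g w).
Proof.
have [U0 oU _] := Re_base_domain hD.
have [H [HU clH]] := rational_halfspaces oU U0 (@Re_base_convex _ _ _ hD).
have : \forall w \ae L, forall q, dotv (g w) (H q).1 <= (H q).2.
  by apply: ae_forall_countable => q; exact: (base_bound (HU q)).1.
by apply: filterS => w; exact: clH.
Qed.

(** A coordinate vector is only a limit of vectors of [W_D]. A sequence of these is fixed
    beforehand, so that countably many null sets are discarded. *)
Lemma ae_rho_le0 : \forall w \ae nu, forall j, rho w 0 j <= 0.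
Proof.
apply: ae_forall_countable => j.
have /choice[v vP] (k : nat) : exists v, W_set D v /\ `|delta_mx 0 j - v| < k.+1%:R^-1.
  have k0 : 0 < k.+1%:R^-1 :> R by rewrite invr_gt0.
  by have [v ? ?] := W_set_dense hD j k0; exists v.
have : \forall w \ae nu, forall k, dotv (rho w) (v k) <= 0.
  apply: ae_foralln => k; have [/(Re_base_sup hD)[M UM] _] := vP k.
  exact: (base_bound UM).2.
apply: filterS => w wv; rewrite -dotv_delta dotvC.
apply: (@closure_halfspace _ _ (range v)); first by move=> _ [k _ <-]; rewrite dotvC.
apply/closure_rVP => e e0; have [k ke] : exists k : nat, k.+1%:R^-1 < e.
  exists (Num.truncn e^-1); rewrite invf_plt ?posrE//.
  exact: truncnS_gt.
by exists (v k); [exists k|exact: lt_trans (vP k).2 ke].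
Qed.

Variables (h : R[i]^o -> 'rV[R[i]]_n) (a : 'I_n -> R[i]) (b : 'I_n -> R).
Hypothesis hq : forall j l, cmod l <= 1 -> h l 0 j = circle_quadratic (a j) (b j) l.
Hypothesis generator : forall z l, D z -> l != 0 -> cmod l < 1 ->
  Re (Ffield phi h z l / l) <=
  Re (Ffield phi h z 0 / l - (Ffield phi h z 0)^*%C * l).
Hypothesis h_neq0 : exists j, a j != 0.
Local Notation H := (hcirc h).

Lemma ae_pairing x : U x ->
  (\forall w \ae L, dotv (x - g w) (H w) <= 0) /\
  (\forall w \ae nu, - dotv (rho w) (H w) <= 0).
Proof.
move=> /(Re_base_rvC hD) Dx; have c2 : cmod (2^-1%:C%C : R[i]) < 1.
  by rewrite cmod_real gtr0_norm// invf_lt1// ltr1n.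
have n2 : 2^-1%:C%C != 0 :> R[i] by rewrite -cmod_gt0 cmod_real normr_gt0.
have [ig ir _] := Re_Ffield hmu hdec hq (rvC x) n2 c2; rewrite re_rvC in ig.
apply: (sign_lemma ig ir sing) => l /andP[l0 l1]; rewrite cmod_gt0 in l0.
have [_ _] := Re_Ffield hmu hdec hq (rvC x) l0 l1; rewrite re_rvC.
have := generator Dx l0 l1; rewrite -(ler_pM2l (two_pi_gt0 R)).
by set X := Re _; set Y := Re _ => XY XYE; move: XY; rewrite XYE gerDl.
Qed.

(** The null set of [ae_pairing] depends on [x]; the rational points of the open base are dense in
    it and give one null set for all [x]. *)
Lemma ae_pairing_base : \forall w \ae L, forall x, U x -> dotv (x - g w) (H w) <= 0.
Proof.
have [U0 oU _] := Re_base_domain hD.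
have : \forall w \ae L, forall q : 'rV[rat]_n, U (map_mx ratr q) ->
    dotv (map_mx ratr q - g w) (H w) <= 0.
  apply: ae_forall_countable => q; have [Uq|nUq] := pselect (U (map_mx ratr q)).
    by apply: filterS (ae_pairing Uq).1 => w h1 _.
  exact: aeW.
apply: filterS => w wq x Ux; rewrite dotvBl subr_le0.
apply: (@closure_halfspace _ _ [set y | exists2 q : 'rV[rat]_n, y = map_mx ratr q & U y]).
  by move=> y [q yE Uy]; rewrite -subr_le0 -dotvBl yE; apply: wq; rewrite -yE.
apply/closure_rVP => e e0; have [d d0 dU] := open_rVP oU Ux.
have ed0 : 0 < Num.min e d by rewrite lt_min e0.
have [q] := rational_rV_dense x ed0; rewrite lt_min => /andP[qe qd].
by exists (map_mx ratr q) => //; exists q => //; exact: dU.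
Qed.

(** Almost everywhere the previous inequality bounds [<x, l^* h>] over the base, so [l^* h] lies in
    [W_D] and hence in the closed positive orthant. Continuity of the trace removes the exceptional
    set. *)
Lemma hcirc_ge0 w j : 0 <= H w 0 j.
Proof.
have -> : H w 0 j = circle_trace (a j) (b j) w by rewrite (hcircE hq) mxE.
apply: clipschitz_ge0; first exact: circle_trace_lipschitz.
apply: filterS ae_pairing_base => w' wU.
have -> : circle_trace (a j) (b j) w' = H w' 0 j by rewrite (hcircE hq) mxE.
apply: (W_set_ge0 hD); apply/(Re_base_sup hD); exists (dotv (g w') (H w')) => x Ux.
by rewrite -subr_le0 -dotvBl; exact: wU.
Qed.

Let trace_ge0 j w : 0 <= circle_trace (a j) (b j) w.
Proof. by have := hcirc_ge0 w j; rewrite (hcircE hq) mxE. Qed.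

Lemma ae_hcirc_neq0 : \forall w \ae L, H w != 0.
Proof.
have [j aj] := h_neq0.
have [[w0 w00]|nz] := pselect (exists w0, circle_trace (a j) (b j) w0 = 0); last first.
  apply: aeW => w; apply/eqP => Hw; apply: nz; exists w.
  by have := congr1 (fun x : 'rV_n => x 0 j) Hw; rewrite (hcircE hq) !mxE.
exists [set w0]; split; [exact: measurable_circle1|exact: arc_length1|].
move=> w /negP; rewrite negbK => /eqP Hw /=.
apply: (circle_trace_zero (trace_ge0 j)) => //; first by rewrite aj.
by have := congr1 (fun x : 'rV_n => x 0 j) Hw; rewrite (hcircE hq) !mxE.
Qed.

(** Strictness comes from the openness of the base: the weak inequality at [x + t l^* h] improves
    the one at [x] by [t |l^* h|^2]. *)
Lemma ae_P_set : \forall w \ae L, P_set D (H w) (g w).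
Proof.
have [_ oU _] := Re_base_domain hD.
apply: filterS3 ae_closure_base ae_pairing_base ae_hcirc_neq0 => w clg wU Hw.
split => // x Ux; have [e e0 eU] := open_rVP oU Ux.
have Hn : 0 < `|H w| by rewrite normr_gt0.
pose t := e / 2 / `|H w|; have t0 : 0 < t by rewrite !divr_gt0.
have /wU : U (x + t *: H w).
  apply: eU; rewrite opprD addrA subrr sub0r normrN normrZ gtr0_norm//.
  by rewrite divfK ?gt_eqF// ltr_pdivrMr// ltr_pMr// ltr1n.
rewrite addrAC (dotvDl (x - g w)) dotvZl; have := mulr_gt0 t0 (dotv_gt0 Hw); lra.
Qed.

(** Each product is nonpositive, while their sum is nonnegative by [ae_pairing]. *)
Lemma ae_rho_hcirc : \forall w \ae nu, forall j, rho w 0 j * H w 0 j = 0.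
Proof.
have [[x Ux] _ _] := Re_base_domain hD.
apply: filterS2 ae_rho_le0 (ae_pairing Ux).2 => w r0; rewrite oppr_le0 => d0 j.
have le0 i : rho w 0 i * H w 0 i <= 0 by rewrite mulr_le0_ge0// hcirc_ge0.
apply/eqP; rewrite eq_le le0/=; apply: (le_trans d0).
rewrite /dotv (bigD1 j)//= gerDl; apply: sumr_le0 => i _; exact: le0.
Qed.

(** By [ae_rho_hcirc] the component vanishes off the zeros of its trace, and there is at most one
    zero. *)
Lemma rho_dirac j : (a j != 0) || (b j != 0) ->
  exists (l : T) (c : R), [/\ c <= 0,
    forall A : set T, measurable A ->
      (\int[nu]_(w in A) (rho w 0 j)%:E = c%:E * \d_l A)%E &
    c * H l 0 j = 0].
Proof.
move=> ab.
(* If the trace has no zero, [expi 0] is an arbitrary choice; the last clause then forces the mass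
   [c] to be 0. *)
have [l lP] : exists l, forall w, circle_trace (a j) (b j) w = 0 -> w = l.
  have [[w0 w00]|nz] := pselect (exists w0, circle_trace (a j) (b j) w0 = 0).
    by exists w0 => w w0'; exact: (circle_trace_zero (trace_ge0 j)).
  by exists (expi 0) => w w0; exfalso; apply: nz; exists w.
have ml := measurable_circle1 l; have br := bmeas_rho hdec j.
have ir := integrable_rho hdec j.
have HE w : H w 0 j = circle_trace (a j) (b j) w by rewrite (hcircE hq) mxE.
have off : \forall w \ae nu, w <> l -> rho w 0 j = 0.
  apply: filterS ae_rho_hcirc => w /(_ j)/eqP; rewrite mulf_eq0 => /orP[/eqP//|/eqP Hw].
  by case; apply: lP; rewrite -HE.
pose c := \int[nu]_(w in [set l]) rho w 0 j.
have irA (A : set T) : measurable A -> nu.-integrable A (EFin \o (fun w => rho w 0 j)).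
  by move=> mA; apply: (integrableS measurableT).
have cE : (\int[nu]_(w in [set l]) (rho w 0 j)%:E)%E = c%:E.
  by rewrite fineK//; apply: integrable_fin_num => //; exact: irA.
have null (A : set T) : measurable A -> ~ A l ->
    (\int[nu]_(w in A) (rho w 0 j)%:E = 0)%E.
  move=> mA nAl; rewrite (@ae_eq_integral _ _ _ nu A (cst 0%E))//.
  - by rewrite integral0.
  - exact: measurable_int (irA A mA).
  - apply: filterS off => w wl Aw; rewrite wl// => wl'.
    by apply: nAl; rewrite -wl'.
have c_le0 : c <= 0.
  have -> : c = \int[nu]_(w in [set l]) (- 1 * `|rho w 0 j|).
    congr fine; apply: ae_eq_integral => //.
    - exact: measurable_int (irA _ ml).
    - apply/measurable_EFinP; apply: (measurable_funS measurableT) => //.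
      by have [] := bmeasZ (-1) (bmeas_norm br).
    - by apply: filterS ae_rho_le0 => w rw _; rewrite mulN1r ler0_norm// opprK.
  rewrite (RintegralZl _ ml) ?mulN1r ?oppr_le0; first exact: Rintegral_ge0.
  apply: (integrableS measurableT) => //.
  exact: (bmeas_integrable nu (bmeas_norm br)).
exists l, c; split.
- exact: c_le0.
- move=> A mA; rewrite diracE; have [/set_mem Al|nAl] := boolP (l \in A).
    have AE : A = [set l] `|` (A `\ l).
      by apply/seteqP; split => w; [move=> Aw; have [->|wl] := pselect (w = l); [left|right]|move=> [->|[]]].
    rewrite mule1 -cE {1}AE integral_setU_EFin//.
    + have mAl : measurable (A `\ l) by exact: measurableD.
      by rewrite (null _ mAl) ?adde0// => -[_]; exact.
    + exact: measurableD.
    + by apply: (measurable_funS measurableT) => //; have [] := br.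
    + by apply/disj_setPS => w [wl [_ nwl]]; exfalso; exact: nwl wl.
  by rewrite mule0 null// => Al; move: nAl; rewrite mem_set.
- have nl : \forall w \ae nu, w \in [set l] -> rho w 0 j * H l 0 j = 0.
    by apply: filterS ae_rho_hcirc => w /(_ j) + /set_mem/= wl; rewrite wl.
  rewrite /c mulrC -(RintegralZl _ ml (irA _ ml)) /Rintegral.
  rewrite (@ae_eq_integral _ _ _ nu _ (cst 0%E))//; first by rewrite integral0.
  + have := @measurable_funM _ _ _ [set l] (cst (H l 0 j)) (fun w => rho w 0 j).
    move=> h0; apply/measurable_EFinP; apply: h0 => //.
    by apply: (measurable_funS measurableT) => //; case: br.
  + by apply: filterS nl => w wl /mem_set/wl; rewrite mulrC => ->.
Qed.
End necessity.

(** * Entire quadratic maps *)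

Section quadratic_maps.
Context (R : realType) (n : nat).
Local Notation T := (borel (circle R)).
Implicit Types (a : 'I_n -> R[i]) (b : 'I_n -> R) (h : R[i]^o -> 'rV[R[i]]_n).

Lemma vdifferentiable_quadratic (V : normedModType R[i]) (A B C : V) (l : R[i]^o) :
  vdifferentiable (fun l : R[i]^o => A + l *: B + l ^+ 2 *: C) l.
Proof.
have did : differentiable (id : R[i]^o -> R[i]^o) l by [].
apply: differentiableD; last first.
  by apply: differentiableZl; exact: (differentiableX 1 did).
apply: differentiableD; first exact: differentiable_cst.
exact: differentiableZl.
Qed.

(** The gradient along [phi] lives only on the disc; its quadratic expression supplies the entire
    map that is asked for. *)
Definition quadratic_map a b : R[i]^o -> 'rV[R[i]]_n :=
  fun l => \row_j circle_quadratic (a j) (b j) l.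

Lemma quadratic_map_holomorphic a b : holomorphic_on setT (quadratic_map a b).
Proof.
move=> l _.
rewrite (_ : quadratic_map a b = fun l : R[i]^o => (\row_j a j) +
    l *: (\row_j (b j)%:C%C) + l ^+ 2 *: (\row_j (a j)^*%C)).
  exact: vdifferentiable_quadratic.
by apply/funext => l'; apply/rowP => j; rewrite !mxE /circle_quadratic; ring.
Qed.

Lemma circle_hcirc h (a : 'I_n -> R[i]) b z j :
  (forall j l, cmod l <= 1 -> h l 0 j = circle_quadratic (a j) (b j) l) ->
  unit_circle R z -> exists2 w : T, z = cval w & z^* * h z 0 j = (hcirc h w 0 j)%:C%C.
Proof.
move=> hq z1; have [w wz] : exists w : T, cval w = z.
  apply: circle_ex; move: z1; rewrite /unit_circle/= normc_cmod.
  by move=> /(congr1 (@complex.Re R)).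
by exists w => //; rewrite -(hcirc_circle hq) wz.
Qed.

Lemma quadratic_map_H_set a b : H_set (quadratic_map a b).
Proof.
split=> [|z z1 j]; first exact: quadratic_map_holomorphic.
have hq j' l : cmod l <= 1 -> quadratic_map a b l 0 j' = circle_quadratic (a j') (b j') l.
  by rewrite mxE.
have [w _ ->] := circle_hcirc j hq z1.
by rewrite realE !lecR -realE num_real.
Qed.

Lemma quadratic_map_H_plus a b : (forall w j, 0 <= hcirc (quadratic_map a b) w 0 j) ->
  H_plus (quadratic_map a b).
Proof.
move=> h0; split=> [|z z1 j]; first exact: quadratic_map_holomorphic.
have hq j' l : cmod l <= 1 -> quadratic_map a b l 0 j' = circle_quadratic (a j') (b j') l.
  by rewrite mxE.
have [w _ ->] := circle_hcirc j hq z1.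
by rewrite lecR.
Qed.
End quadratic_maps.

Section geodesic_conditions.
Context (R : realType) (n : nat).
Local Notation T := (borel (circle R)).
Local Notation L := (arc_length R).

Lemma geodesic_necessary (D : set 'rV[R[i]]_n) (hD : family_D D)
    (phi : R[i]^o -> 'rV[R[i]]_n) (hphi : holomorphic_on (unit_disc R) phi)
    (mu : 'I_n -> {charge set T -> \bar R})
    (hmu : is_boundary_measure phi mu) (g rho : T -> borel 'rV[R]_n)
    (nu : {finite_measure set T -> \bar R})
    (hdec : is_decomposition mu g rho nu) :
  complex_geodesic D phi ->
  exists h : R[i]^o -> 'rV[R[i]]_n,
    [/\ H_set h,
        exists z, h z != 0 &
    [/\ H_plus h,
        \forall w \ae L, P_set D (re_vec ((cval w)^* *: h (cval w))) (g w),
        \forall w \ae nu, forall j, rho w 0 j <= 0,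
        Re_base D (re_vec (phi 0)) &
        forall j, (exists z, h z 0 j != 0) ->
          exists (l : T) (a : R),
            [/\ a <= 0,
                forall A : set T, measurable A ->
                  (\int[nu]_(w in A) (rho w 0 j)%:E = a%:E * \d_l A)%E &
                a%:C%C * h (cval l) 0 j = 0]]].
Proof.
move=> [_ phiD0 [f [hf fD0 fphi]]].
have phiD l : unit_disc R l -> D (phi l) by move=> dl; apply: phiD0; exists l.
have fD z : D z -> unit_disc R (f z) by move=> Dz; apply: fD0; exists z.
pose a j := gradient f (phi 0) j.
have [b gradb] := left_inverse_gradient hD hphi phiD hf fD fphi.
have [j0 aj0] := left_inverse_gradient_neq0 hphi phiD hf fphi.
pose h := quadratic_map a b.
have hq j l : cmod l <= 1 -> h l 0 j = circle_quadratic (a j) (b j) l by rewrite mxE.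
have hgrad l j : cmod l < 1 -> h l 0 j = gradient f (phi l) j.
  by move=> l1; rewrite hq ?ltW// gradb.
have gen z l : D z -> l != 0 -> cmod l < 1 -> complex.Re (Ffield phi h z l / l) <=
    complex.Re (Ffield phi h z 0 / l - (Ffield phi h z 0)^*%C * l).
  move=> Dz l0 l1; have := left_inverse_generator hD hphi phiD hf fD fphi Dz l0 l1.
  have FE (l' : R[i]) : cmod l' < 1 -> Ffield phi h z l' =
      \sum_j gradient f (phi l') j * (z 0 j - phi l' 0 j).
    by move=> l'1; apply: eq_bigr => j _; rewrite hgrad.
  by rewrite -!FE ?cmod0.
have h0 : exists j, a j != 0 by exists j0.
have h_ge0 := hcirc_ge0 hD hmu hdec hq gen.
exists h; split; first exact: quadratic_map_H_set.
- exists 0; apply/eqP => h00; move: aj0; rewrite -/(a j0).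
  have := congr1 (fun x : 'rV_n => x 0 j0) h00; rewrite !mxE /circle_quadratic.
  by rewrite mulr0 expr0n mulr0 !addr0 => ->; rewrite eqxx.
split.
- exact: quadratic_map_H_plus.
- exact: (ae_P_set hD hmu hdec phiD hq gen h0).
- exact: (ae_rho_le0 hD hmu hdec phiD).
- have d0 : unit_disc R 0 by rewrite /unit_disc/= normr0.
  by exists (phi 0) => //; exact: phiD.
- move=> j [z hz].
  have ab : (a j != 0) || (b j != 0).
    apply: contraNT hz; rewrite negb_or !negbK => /andP[/eqP a0 /eqP b0].
    by rewrite mxE a0 b0 /circle_quadratic conjc0 !mul0r !addr0.
  have [l [c [c0 cA cH]]] := rho_dirac hD hmu hdec phiD hq gen ab.
  exists l, c; split => //.
  have z0 : (cval l)^*%C != 0 by rewrite -cmod_gt0 cmodJ cmod_cval.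
  apply: (mulfI z0); rewrite mulr0 mulrCA (hcirc_circle hq).
  by rewrite -realCM cH.
Qed.
End geodesic_conditions.

(** * Caratheodory's criterion for differentiability *)

Section caratheodory.
Context (R : realType).

Lemma flat_differentiable (V : normedModType R[i]) (q : V -> R[i]^o) (p : V) :
  (forall e : R, 0 < e -> exists2 d : R, 0 < d &
     forall k : V, `|k| < d%:C%C -> `|q (k + p) - q p| <= e%:C%C * `|k|) ->
  vdifferentiable q p.
Proof.
move=> qP; have oq : q \o shift p = cst (q p) + (\0%R : V -> R[i]^o) +o_ 0 id.
  apply/eqaddoP => e0 /gt0_realC[e e_gt0 ->].
  have [d d0 dP] := qP e e_gt0.
  apply/nbhs_norm0P; exists d%:C%C => /=; first by rewrite ltcR.
  move=> k kd; have := dP k kd; rewrite /=.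
  rewrite -![(_ + _ : _ -> _) _]/(_ + _) -![(- _ : _ -> _) _]/(- _) /cst /=.
  by rewrite addr0.
have c0 : continuous (\0%R : V -> R[i]^o) by move=> x; exact: cvg_cst.
have dq := diff_unique c0 oq.
by apply/diff_locallyP; rewrite dq.
Qed.

Lemma common_radius n (P : 'I_n -> R -> Prop) :
  (forall j (d d' : R), d' <= d -> P j d -> P j d') ->
  (forall j, exists2 d : R, 0 < d & P j d) -> exists2 d : R, 0 < d & forall j, P j d.
Proof.
move=> mono H.
have /choice[d dP] j : exists d : R, 0 < d /\ P j d by have [d ? ?] := H j; exists d.
exists (\big[Num.min/1]_j d j).
  by apply/bigmin_gtP; split => // j _; have [] := dP j.
move=> j; have [_] := dP j; apply: mono; exact: bigmin_le.
Qed.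

Variable n : nat.
Implicit Types (k z : 'rV[R[i]]_n).

Lemma cmod_coord_lt k (d : R) j : `|k| < d%:C%C -> cmod (k 0 j) < d.
Proof.
move=> kd; rewrite -ltcR -normc_cmod; apply: le_lt_trans kd.
rewrite [leRHS]/Num.Def.normr/= mx_normE -[leLHS]nngE num_le.
exact: (le_bigmax _ _ (0, j)).
Qed.

Lemma cmod_coord_le k j : (cmod (k 0 j))%:C%C <= `|k|.
Proof.
rewrite -normc_cmod [leRHS]/Num.Def.normr/= mx_normE -[leLHS]nngE num_le.
exact: (le_bigmax _ _ (0, j)).
Qed.

(** The increment has coefficients [u j (k + z)] that are merely continuous at [k = 0], and the
    derivative is the linear form with coefficients [u j z]. This suits an implicitly defined [f],
    since the coefficients may involve [f (k + z)] itself. *)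
Lemma caratheodory_differentiable (f : 'rV[R[i]]_n -> R[i]^o) z
    (u : 'I_n -> 'rV[R[i]]_n -> R[i]) (d0 : R) : 0 < d0 ->
  (forall k, `|k| < d0%:C%C -> f (k + z) = f z + \sum_j u j (k + z) * k 0 j) ->
  (forall j (e : R), 0 < e -> exists2 d : R, 0 < d &
     forall k, `|k| < d%:C%C -> cmod (u j (k + z) - u j z) <= e) ->
  vdifferentiable f z.
Proof.
move=> d00 fE uc; pose G k : R[i]^o := \sum_j u j z * k 0 j.
have dG : vdifferentiable (G : 'rV[R[i]]_n -> R[i]^o) z.
  rewrite /vdifferentiable (_ : G = \sum_j (fun k => u j z *: (k 0 j : R[i]^o))); last first.
    by apply/funext => k; rewrite fct_sumE.
  apply: differentiable_sum => j; apply: differentiableZ.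
  exact: differentiable_coord.
pose q k : R[i]^o := f k - G k.
have dq : vdifferentiable q z.
  apply: flat_differentiable => e e0.
  (* [n.+1] instead of [n] keeps the quotient meaningful for [n = 0]. *)
  pose e' := e / n.+1%:R; have e'0 : 0 < e' by rewrite divr_gt0// ltr0n.
  have [d dgt0 dP] : exists2 d : R, 0 < d & forall j k, `|k| < d%:C%C ->
      cmod (u j (k + z) - u j z) <= e'.
    apply: (@common_radius _ (fun j d => forall k, `|k| < d%:C%C ->
      cmod (u j (k + z) - u j z) <= e')) => [j d d' d'd dP k kd|j].
      by apply: dP; apply: lt_le_trans kd _; rewrite lecR.
    exact: uc.
  exists (Num.min d d0); first by rewrite lt_min dgt0.
  move=> k kd; have kd1 : `|k| < d%:C%C.
    by apply: lt_le_trans kd _; rewrite lecR ge_min lexx.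
  have kd0 : `|k| < d0%:C%C.
    by apply: lt_le_trans kd _; rewrite lecR ge_min lexx orbT.
  have -> : q (k + z) - q z = \sum_j (u j (k + z) - u j z) * k 0 j.
    rewrite /q fE//; have -> : G (k + z) = \sum_j u j z * k 0 j + G z.
      by rewrite -big_split; apply: eq_bigr => j _; rewrite mxE mulrDr.
    under [RHS]eq_bigr do rewrite mulrBl.
    by rewrite sumrB; ring.
  apply: (@le_trans _ _ (\sum_(j < n) e'%:C%C * `|k|)).
    apply: le_trans (ler_norm_sum _ _ _) _; apply: ler_sum => j _.
    rewrite normc_cmod cmodM realCM; apply: ler_pM; rewrite ?lecR//.
      by rewrite dP.
    exact: cmod_coord_le.
  rewrite sumr_const card_ord -mulrnAl ler_wpM2r// -rmorphMn/= lecR.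
  rewrite /e' -mulr_natr mulrAC ler_pdivrMr ?ltr0n// ler_wpM2l ?(ltW e0)//.
  by rewrite ler_nat.
rewrite (_ : f = (fun k => q k + G k)); last by apply/funext => k; rewrite /q subrK.
exact: differentiableD.
Qed.
End caratheodory.

(** * Holomorphic dependence of a zero on parameters *)

Section moving_zero.
Context (R : realType) (n : nat).
Local Notation Re := complex.Re.
Variables (D : set 'rV[R[i]]_n) (h phi : 'I_n -> R[i] -> R[i]) (K : R).
Implicit Types (z k : 'rV[R[i]]_n) (l m : R[i]).

Let F z l : R[i] := \sum_j h j l * (z 0 j - phi j l).

Hypothesis oD : forall z, D z -> exists2 e : R, 0 < e & forall k, `|k| < e%:C%C -> D (k + z).
Hypothesis dh : forall j l, cmod l < 1 -> cdifferentiable (h j) l.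
Hypothesis dphi : forall j l, cmod l < 1 -> cdifferentiable (phi j) l.
Hypothesis hK : forall j l, cmod l < 1 -> cmod (h j l) <= K.
Hypothesis inward : forall z, D z -> exists2 r0 : R, 0 < r0 < 1 &
  forall l, r0 <= cmod l -> cmod l < 1 -> Re (F z l * l^*%C) < 0.

Let dF z l : cmod l < 1 -> cdifferentiable (F z) l.
Proof.
move=> l1; rewrite /cdifferentiable.
rewrite (_ : (F z : R[i]^o -> R[i]^o) =
    \sum_j (fun l : R[i]^o => h j l * (z 0 j - phi j l) : R[i]^o)); last first.
  by apply/funext => l'; rewrite fct_sumE.
apply: differentiable_sum => j; apply: differentiableM; first exact: dh.
by apply: differentiableB; [exact: differentiable_cst|exact: dphi].
Qed.

Let radius z m : D z -> cmod m < 1 -> exists r : R, [/\ 0 < r < 1, cmod m < r &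
  forall l, cmod l = r -> Re (F z l * l^*%C) < 0].
Proof.
move=> Dz m1; have [r0 /andP[r00 r01] r0P] := inward Dz.
have mr : cmod m < Num.max r0 ((1 + cmod m) / 2) by rewrite lt_max; apply/orP; right; lra.
exists (Num.max r0 ((1 + cmod m) / 2)); split => //.
  rewrite lt_max r00/= gt_max r01/=; lra.
by move=> l lr; apply: r0P; rewrite lr ?le_max ?lexx// gt_max r01/=; lra.
Qed.

Lemma zero_unique z m m' : D z -> cmod m < 1 -> cmod m' < 1 ->
  F z m = 0 -> F z m' = 0 -> m = m'.
Proof.
move=> Dz m1 m'1 Fm Fm'.
have mm1 : cmod (Num.max (cmod m) (cmod m'))%:C%C < 1.
  by rewrite cmod_real ger0_norm ?le_max ?cmod_ge0// gt_max m1.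
have [r [/andP[r0 r1] mr rP]] := radius Dz mm1.
move: mr; rewrite cmod_real ger0_norm ?le_max ?cmod_ge0// gt_max => /andP[mr m'r].
have dFr l : cmod l <= r -> cdifferentiable (F z) l.
  by move=> lr; apply: dF; exact: le_lt_trans lr r1.
have [d [_ [c c0 cP]]] := inward_zero_quotient r0 dFr rP mr Fm.
have := ball_quotientK d Fm mr (ltW m'r); rewrite Fm' => /esym/eqP.
rewrite mulf_eq0 => /orP[/eqP Q0|].
  by have := cP _ (ltW m'r); rewrite Q0/= lerNr oppr0 leNgt c0.
rewrite mulf_eq0 => /orP[|/eqP B0]; first by rewrite subr_eq0 => /eqP.
by have := ball_denominator_neq0 (ltW m'r) mr; rewrite B0 eqxx.
Qed.

Lemma zero_exists z : D z -> exists m, cmod m < 1 /\ F z m = 0.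
Proof.
move=> Dz; have c0 : cmod (0 : R[i]) < 1 by rewrite cmod0.
have [r [/andP[r0 r1] _ rP]] := radius Dz c0.
have dFr l : cmod l <= r -> cdifferentiable (F z) l.
  by move=> lr; apply: dF; exact: le_lt_trans lr r1.
have [m mr Fm] := inward_zero_exists r0 dFr rP.
by exists m; split => //; exact: lt_trans mr r1.
Qed.

(** [F] is affine in [z]. Let [S] be the cofactor of [l - m] in [F z], where [m = f z]. At the zero
    [l] of [F (k + z)] one has [S l * (l - m) = - \sum_j h j l * k 0 j] with [S] bounded away from
    0, which bounds [l - m] by a multiple of [|k|] and is an expansion of Caratheodory's type with
    coefficients [- h j l / S l]. *)
Lemma moving_zero : exists f : 'rV[R[i]]_n -> R[i]^o,
  [/\ holomorphic_on D f, forall z, D z -> cmod (f z) < 1 &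
      forall z l, D z -> cmod l < 1 -> F z l = 0 -> f z = l].
Proof.
have /choice[f fP] z : exists m, D z -> cmod m < 1 /\ F z m = 0.
  have [Dz|nDz] := pselect (D z); last by exists 0.
  by have [m mP] := zero_exists Dz; exists m.
exists f; split; last 2 first.
- by move=> z /fP[].
- by move=> z l Dz l1 Fl; have [f1 Ff] := fP z Dz; exact: (zero_unique Dz).
move=> z Dz; have [m1 Fm] := fP z Dz; set m := f z in m1 Fm.
have [r [/andP[r0 r1] mr rP]] := radius Dz m1.
have dFr z' l : cmod l <= r -> cdifferentiable (F z') l.
  by move=> lr; apply: dF; exact: le_lt_trans lr r1.
have [d [Fd [c c0 cP]]] := inward_zero_quotient r0 (dFr z) rP mr Fm.
pose K1 := `|K| + 1; have K10 : 0 < K1 by rewrite ltr_wpDl.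
have hK1 j l : cmod l < 1 -> cmod (h j l) <= K1.
  by move=> l1; rewrite (le_trans (hK j l1))// (le_trans (ler_norm K))// lerDl.
pose N := n%:R + 1 : R; have N0 : 0 < N by rewrite ltr_wpDl.
have sumle (g : 'I_n -> R[i]) (C : R) : 0 <= C -> (forall j, cmod (g j) <= C) ->
    cmod (\sum_j g j) <= N * C.
  move=> C0 gC; apply: (@le_trans _ _ (\sum_(j < n) C)).
    rewrite -lecR -normc_cmod rmorph_sum/=; apply: le_trans (ler_norm_sum _ _ _) _.
    by apply: ler_sum => j _; rewrite normc_cmod lecR.
  by rewrite sumr_const card_ord -mulr_natl ler_wpM2r// lerDl.
have FD z' k l : F (k + z') l = F z' l + \sum_j h j l * k 0 j.
  rewrite -big_split; apply: eq_bigr => j _; rewrite mxE/=; ring.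
have [c' c'0 c'P] : exists2 c' : R, 0 < c' & forall l, cmod l = r -> Re (F z l / l) <= - c'.
  have l_neq0 l : cmod l = r -> l != 0 by move=> lr; rewrite -cmod_gt0 lr.
  apply: circle_max_lt0 => // l lr.
    apply: cdifferentiable_ccontinuous; apply: differentiableM.
      by apply: dFr; rewrite lr.
    by apply: differentiableV => //; exact: l_neq0.
  rewrite Re_divJ lr pmulr_llt0 ?invr_gt0 ?exprn_gt0//; exact: rP.
have [e e0 eD] := oD Dz.
(* For [|k| < d1] the perturbation of [Re (F z l / l)] is at most [c' / 2], so the perturbed field
   still points inward on the circle of radius [r] and its zero remains inside. *)
pose d1 := Num.min e (c' * r / (2 * (N * K1))).
have d10 : 0 < d1 by rewrite lt_min e0/= divr_gt0 ?mulr_gt0.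
have coordK k (s : R) l : `|k| < s%:C%C -> cmod l < 1 ->
    cmod (\sum_j h j l * k 0 j) <= N * (K1 * s).
  move=> ks l1; have s0 : 0 < s by rewrite -ltcR; exact: le_lt_trans ks.
  apply: sumle => [|j]; first by rewrite mulr_ge0// ltW.
  rewrite cmodM; apply: ler_pM; rewrite ?cmod_ge0 ?hK1//.
  exact/ltW/cmod_coord_lt.
have near k : `|k| < d1%:C%C -> [/\ D (k + z), cmod (f (k + z)) < r & F (k + z) (f (k + z)) = 0].
  move=> kd1; have Dk : D (k + z).
    by apply: eD; apply: lt_le_trans kd1 _; rewrite lecR ge_min lexx.
  have [f1 Ff] := fP _ Dk; split => //.
  have inw l : cmod l = r -> Re (F (k + z) l * l^*%C) < 0.
    move=> lr; have l0 : l != 0 by rewrite -cmod_gt0 lr.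
    suff : Re (F (k + z) l / l) < 0.
      by rewrite Re_divJ lr pmulr_llt0// invr_gt0 exprn_gt0.
    rewrite FD mulrDl ReD; have := c'P l lr.
    have l1 : cmod l < 1 by rewrite lr.
    have := coordK k d1 l kd1 l1; set s := \sum_j _ => sle.
    have : Re (s / l) <= N * (K1 * d1) / r.
      rewrite (le_trans (Re_le_cmod _))// cmodM cmodV lr.
      by rewrite ler_wpM2r// invr_ge0 ltW.
    have : N * (K1 * d1) / r <= c' / 2.
      rewrite ler_pdivrMr//.
      have : d1 * (2 * (N * K1)) <= c' * r.
        by rewrite -ler_pdivlMr ?mulr_gt0// ge_min lexx orbT.
      lra.
    lra.
  have [m' m'r Fm'] := inward_zero_exists r0 (dFr (k + z)) inw.
  by rewrite (zero_unique Dk f1 (lt_trans m'r r1) Ff Fm').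
pose S l := ball_quotient (F z) m d r l * ((r ^+ 2)%:C%C - m^*%C * l).
pose s0 := c * (r ^+ 2 - cmod m * r).
have s00 : 0 < s0.
  by rewrite mulr_gt0// subr_gt0 expr2 ltr_pM2r.
have Sge l : cmod l <= r -> s0 <= cmod (S l).
  move=> lr; rewrite cmodM; apply: ler_pM; first exact: ltW.
  - rewrite subr_ge0 expr2 ler_pM2r//; exact: ltW.
  - have := cP l lr; have := Re_le_cmod (- ball_quotient (F z) m d r l).
    by rewrite cmodN ReN; lra.
  - have := cmod_sub (r ^+ 2)%:C%C (m^*%C * l).
    rewrite cmod_real ger0_norm ?sqr_ge0// cmodM cmodJ.
    have : cmod m * cmod l <= cmod m * r by rewrite ler_wpM2l// cmod_ge0.
    lra.
have SF l : cmod l <= r -> F z l = S l * (l - m).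
  by move=> lr; rewrite (ball_quotientK d Fm mr lr) /S; ring.
have Sn0 l : cmod l <= r -> S l != 0.
  by move=> lr; rewrite -cmod_gt0; exact: lt_le_trans (Sge l lr).
pose U j l := - (h j l / S l).
have fE k : `|k| < d1%:C%C -> f (k + z) = m + \sum_j U j (f (k + z)) * k 0 j.
  move=> kd1; have [_ fr Ff] := near k kd1; set l := f (k + z) in fr Ff *.
  move: Ff; rewrite FD (SF _ (ltW fr)) => /eqP; rewrite addr_eq0 => /eqP FE.
  have Sl := Sn0 l (ltW fr); apply: (mulfI Sl); rewrite mulrDr mulr_sumr.
  rewrite (eq_bigr (fun j => - (h j l * k 0 j))); last first.
    by move=> j _; rewrite /U; field.
  by rewrite sumrN -FE; ring.
have fc (e1 : R) : 0 < e1 -> exists2 d2 : R, 0 < d2 & forall k, `|k| < d2%:C%C ->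
    `|k| < d1%:C%C /\ cmod (f (k + z) - m) <= e1.
  move=> e10; pose d2 := Num.min d1 (e1 * s0 / (N * K1)).
  have d20 : 0 < d2.
    by rewrite lt_min d10/=; apply: divr_gt0; apply: mulr_gt0.
  exists d2 => // k kd2; have kd1 : `|k| < d1%:C%C.
    by apply: lt_le_trans kd2 _; rewrite lecR ge_min lexx.
  split => //; have [_ fr Ff] := near k kd1; set l := f (k + z) in fr Ff *.
  have l1 := lt_trans fr r1.
  move: Ff; rewrite FD (SF _ (ltW fr)) => /eqP; rewrite addr_eq0 => /eqP FE.
  have := coordK k d2 l kd2 l1; rewrite -cmodN -FE cmodM => h1.
  have h2 : s0 * cmod (l - m) <= cmod (S l) * cmod (l - m).
    by rewrite ler_wpM2r ?cmod_ge0// Sge// ltW.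
  have h3 : d2 * (N * K1) <= e1 * s0.
    by rewrite -ler_pdivlMr ?mulr_gt0// ge_min lexx orbT.
  rewrite -(ler_pM2l s00); lra.
have Uc j : ccontinuous (U j) m.
  apply/ccontinuousP; apply: continuousN; apply: continuousM.
    by apply/ccontinuousP/cdifferentiable_ccontinuous/dh.
  apply: continuousV; first by apply: Sn0; exact: ltW.
  apply: continuousM.
    apply/ccontinuousP/ball_quotient_continuous => //; first exact: ltW.
    by apply: dFr; exact: ltW.
  apply/ccontinuousP/cdifferentiable_ccontinuous; apply: differentiableB.
    exact: differentiable_cst.
  by apply: differentiableM => //; exact: differentiable_cst.
apply: (@caratheodory_differentiable _ _ f z (fun j z' => U j (f z')) d1) => //.
move=> j e1 e10; have [d3 d30 d3P] := Uc j e1 e10.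
have [d2 d20 d2P] := fc d3 d30; exists d2 => // k kd2.
by have [_ kd3] := d2P k kd2; exact: d3P.
Qed.
End moving_zero.

(** * Comparison of integrals almost everywhere *)

Section almost_everywhere_integrals.
Context (R : realType).
Local Notation T := (borel (circle R)).
Local Notation L := (arc_length R).

Lemma ae_eq_Rintegral d (S : measurableType d) (m : {measure set S -> \bar R})
    (f k : S -> R) : m.-integrable setT (EFin \o f) -> m.-integrable setT (EFin \o k) ->
  (\forall x \ae m, f x = k x) -> \int[m]_x f x = \int[m]_x k x.
Proof.
move=> fi ki fk; congr fine; apply: ae_eq_integral => //.
- exact: measurable_int fi.
- exact: measurable_int ki.
- by apply: filterS fk => x fkx _ /=; rewrite fkx.
Qed.

Lemma ae_le_Rintegral d (S : measurableType d) (m : {measure set S -> \bar R})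
    (f k : S -> R) : m.-integrable setT (EFin \o f) -> m.-integrable setT (EFin \o k) ->
  (\forall x \ae m, f x <= k x) -> \int[m]_x f x <= \int[m]_x k x.
Proof.
move=> fi ki fk; rewrite -subr_ge0 -(RintegralB measurableT ki fi).
have di : m.-integrable setT (EFin \o (fun x => k x - f x)).
  rewrite (_ : EFin \o _ = fun x => ((k x)%:E - (f x)%:E)%E); first exact: integrableB.
  by apply/funext => x; rewrite /= EFinB.
rewrite (ae_eq_Rintegral (k := fun x => `|k x - f x|) di).
- exact: Rintegral_ge0.
- exact: integrable_norm.
- by apply: filterS fk => x fkx; rewrite ger0_norm// subr_ge0.
Qed.

Lemma ae_arc_length_ex (P : T -> Prop) : (\forall w \ae L, P w) -> exists w, P w.
Proof.
move=> [N [mN N0 PN]]; apply: contrapT => /forallNP nP.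
have NT : N = setT by apply/seteqP; split => // w _; apply: PN; exact: nP.
have := arc_lengthT R; rewrite -NT N0 => /(congr1 fine)/= p0.
by have := two_pi_gt0 R; rewrite -p0 ltxx.
Qed.

Lemma poisson_integral_ge (m : {finite_measure set T -> \bar R}) (k : T -> R) (l : R[i]) :
  m.-integrable setT (EFin \o k) -> (\forall w \ae m, 0 <= k w) -> cmod l < 1 ->
  (1 - cmod l) / (1 + cmod l) * \int[m]_w k w <= \int[m]_w (poisson l w * k w).
Proof.
move=> ki k0 l1; rewrite -(RintegralZl _ measurableT ki).
apply: ae_le_Rintegral.
- exact: (bmeas_integrableM (bmeas_cst _ _) ki).
- exact: (bmeas_integrableM (bmeas_poisson l1) ki).
- by apply: filterS k0 => w kw; rewrite ler_wpM2r// poisson_ge.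
Qed.
End almost_everywhere_integrals.

(** * Sufficiency of the conditions *)

Section sufficiency.
Context (R : realType) (n : nat).
Local Notation T := (borel (circle R)).
Local Notation L := (arc_length R).
Local Notation Re := complex.Re.
Local Notation Im := complex.Im.
Variables (D : set 'rV[R[i]]_n) (phi : R[i]^o -> 'rV[R[i]]_n)
  (mu : 'I_n -> {charge set T -> \bar R})
  (g rho : T -> borel 'rV[R]_n) (nu : {finite_measure set T -> \bar R})
  (h : R[i]^o -> 'rV[R[i]]_n).
Hypotheses (hD : family_D D) (hphi : holomorphic_on (unit_disc R) phi)
  (hmu : is_boundary_measure phi mu) (hdec : is_decomposition mu g rho nu)
  (hH : H_plus h)
  (hP : \forall w \ae L, P_set D (hcirc h w) (g w))
  (hr : \forall w \ae nu, forall j, rho w 0 j <= 0)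
  (hphi0 : Re_base D (re_vec (phi 0)))
  (hv : forall j, (exists z, h z 0 j != 0) ->
     exists (l : T) (c : R), [/\ c <= 0,
       forall A : set T, measurable A ->
         (\int[nu]_(w in A) (rho w 0 j)%:E = c%:E * \d_l A)%E &
       c%:C%C * h (cval l) 0 j = 0]).
Implicit Types (w : T) (j : 'I_n) (v x : 'rV[R]_n) (l : R[i]) (z : 'rV[R[i]]_n).
Local Notation H := (hcirc h).
Let U := Re_base D.

Lemma vdifferentiable_coord (f : R[i]^o -> 'rV[R[i]]_n) l j :
  vdifferentiable f (l : R[i]^o) -> cdifferentiable (fun l => f l 0 j) l.
Proof.
move=> df; exact: (differentiable_comp df (differentiable_coord (f l) 0 j)).
Qed.

Lemma H_plus_quadratic : exists b : 'I_n -> R, forall j l, cmod l <= 1 ->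
  h l 0 j = circle_quadratic (h 0 0 j) (b j) l.
Proof.
suff /choice[b bP] : forall j, exists b : R, forall l, cmod l <= 1 ->
    h l 0 j = circle_quadratic (h 0 0 j) b l by exists b.
move=> j; apply: (@real_on_circle_quadratic R (fun l => h l 0 j)) => l l1.
  by apply: vdifferentiable_coord; exact: hH.1.
have := hH.2 l _ j; rewrite /unit_circle/= normc_cmod l1 => /(_ erefl).
by rewrite lecE mulrC => /andP[/eqP].
Qed.

Let base0 : U !=set0. Proof. by have [] := Re_base_domain hD. Qed.
Let obase : open U. Proof. by have [] := Re_base_domain hD. Qed.

Lemma support_bound v (M : R) : (forall x, U x -> dotv x v <= M) ->
  (\forall w \ae L, dotv (g w) v <= M) /\ (\forall w \ae nu, dotv (rho w) v <= 0).
Proof.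
move=> UM; split.
  by apply: filterS hP => w [clg _]; exact: closure_halfspace UM clg.
have Wv : W_set D v by apply/(Re_base_sup hD); exists M.
apply: filterS hr => w rw; apply: sumr_le0 => j _.
by rewrite mulr_le0_ge0//; exact: (W_set_ge0 hD).
Qed.

Let integrable_cstB v (M : R) : L.-integrable setT (EFin \o (fun w => M - dotv (g w) v)).
Proof.
have c0 : cmod (0 : R[i]) < 1 by rewrite cmod0.
have [ig _ _] := Re_phi_dot hmu hdec v c0.
rewrite (_ : EFin \o _ = fun w => (M%:E - (dotv (g w) v)%:E)%E); last first.
  by apply/funext => w; rewrite /= EFinB.
by apply: integrableB => //; exact: (bmeas_integrable L (bmeas_cst _ M)).
Qed.

Let integrable_rhoN v : nu.-integrable setT (EFin \o (fun w => - dotv (rho w) v)).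
Proof.
have c0 : cmod (0 : R[i]) < 1 by rewrite cmod0.
have [_ ir _] := Re_phi_dot hmu hdec v c0.
rewrite (_ : EFin \o _ = (\- (EFin \o (fun w => dotv (rho w) v)))%E)//.
exact: integrableN.
Qed.

Let gap v (M : R) l : cmod l < 1 ->
  2 * pi * (M - dotv (re_vec (phi l)) v) =
  \int[L]_w (poisson l w * (M - dotv (g w) v)) +
  \int[nu]_w (poisson l w * - dotv (rho w) v).
Proof.
move=> l1; have [ig ir lE] := Re_phi_dot hmu hdec v l1.
have bP := bmeas_poisson l1.
have -> : \int[L]_w (poisson l w * (M - dotv (g w) v)) =
    M * (2 * pi) - \int[L]_w (poisson l w * dotv (g w) v).
  rewrite -(poisson_mean l1) -(RintegralZl _ measurableT (bmeas_integrable L bP)).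
  rewrite -(RintegralB measurableT (bmeas_integrable L (bmeasZ M bP)) (bmeas_integrableM bP ig)).
  by apply: eq_Rintegral => w _; rewrite mulrBr (mulrC M).
have -> : \int[nu]_w (poisson l w * - dotv (rho w) v) =
    -1 * \int[nu]_w (poisson l w * dotv (rho w) v).
  rewrite -(RintegralZl _ measurableT (bmeas_integrableM bP ir)).
  by apply: eq_Rintegral => w _; rewrite mulN1r mulrN.
by rewrite mulrBr lE; ring.
Qed.

(** Harnack's inequality makes the gap between [Re phi l] and each supporting half-space at least
    [c] times that of [Re phi 0]. So the point [p] with [Re phi l = (1 - c) p + c Re phi 0] lies in
    the closed base, and mixing it with the inner point [Re phi 0] leads into the open base. *)
Lemma phi_in_base l : cmod l < 1 -> U (re_vec (phi l)).
Proof.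
move=> l1; have [-> //|l0] := eqVneq l 0; have cl : 0 < cmod l by rewrite cmod_gt0.
have c0 : cmod (0 : R[i]) < 1 by rewrite cmod0.
pose c := (1 - cmod l) / (1 + cmod l).
have c_gt0 : 0 < c by rewrite divr_gt0//; lra.
have c_lt1 : c < 1 by rewrite /c ltr_pdivrMr//; lra.
have cn0 : 1 - c != 0 by rewrite subr_eq0 gt_eqF.
pose p := (1 - c)^-1 *: (re_vec (phi l) - c *: re_vec (phi 0)).
have -> : re_vec (phi l) = (1 - c) *: p + c *: re_vec (phi 0).
  by rewrite /p scalerA divff// scale1r subrK.
apply: (closure_mix obase (@Re_base_convex _ _ _ hD)); [|exact: hphi0|]; last first.
  by rewrite c_gt0 ltW.
have [Hs [HU clH]] := rational_halfspaces obase base0 (@Re_base_convex _ _ _ hD).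
apply: clH => q; move: (HU q); set v := (Hs q).1; set M := (Hs q).2 => UM.
have [b1 b2] := support_bound UM.
have k1 : \forall w \ae L, 0 <= M - dotv (g w) v.
  by apply: filterS b1 => w; rewrite subr_ge0.
have k2 : \forall w \ae nu, 0 <= - dotv (rho w) v.
  by apply: filterS b2 => w; rewrite oppr_ge0.
have := poisson_integral_ge (integrable_cstB v M) k1 l1.
have := poisson_integral_ge (integrable_rhoN v) k2 l1.
have := gap v M l1; have := gap v M c0.
have -> : \int[L]_w (poisson 0 w * (M - dotv (g w) v)) = \int[L]_w (M - dotv (g w) v).
  by apply: eq_Rintegral => w _; rewrite poisson0 mul1r.
have -> : \int[nu]_w (poisson 0 w * - dotv (rho w) v) = \int[nu]_w (- dotv (rho w) v).
  by apply: eq_Rintegral => w _; rewrite poisson0 mul1r.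
rewrite -/c; set I1 := \int[L]_w _; set I2 := \int[nu]_w _.
set I3 := \int[L]_w _; set I4 := \int[nu]_w _ => e0 e1 i1 i2.
have key : c * (2 * pi * (M - dotv (re_vec (phi 0)) v)) <=
    2 * pi * (M - dotv (re_vec (phi l)) v) by rewrite e0 e1 mulrDr; lra.
rewrite /p dotvZl dotvBl dotvZl mulrC ler_pdivrMr ?subr_gt0//.
move: key; rewrite mulrCA ler_pM2l ?two_pi_gt0//; lra.
Qed.

Lemma phi_in_D l : unit_disc R l -> D (phi l).
Proof.
rewrite /unit_disc/= normc_cmod ltcR => l1; rewrite (tube_baseE hD) /=.
exact: phi_in_base.
Qed.

Variable b : 'I_n -> R.
Hypothesis hq : forall j l, cmod l <= 1 -> h l 0 j = circle_quadratic (h 0 0 j) (b j) l.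

Let H_ge0 w j : 0 <= H w 0 j.
Proof.
have uw : unit_circle R (cval w) by exact: (set_valP (w : circle R)).
by have := hH.2 _ uw j; rewrite [_ * _](hcirc_circle hq) lecR.
Qed.

(** The products are nonpositive, so only the set [A] where one is negative matters. There [rho] is
    negative in that coordinate, yet its integral over [A] is 0: if the atom lies in [A] the trace
    is nonzero at it and its mass [c] vanishes. *)
Lemma ae_rho_pairing : \forall w \ae nu, forall j, rho w 0 j * H w 0 j = 0.
Proof.
apply: ae_forall_countable => j.
suff ge0 : \forall w \ae nu, 0 <= rho w 0 j * H w 0 j.
  apply: filterS2 hr ge0 => w rw ge; apply/eqP; rewrite eq_le ge andbT.
  by rewrite mulr_le0_ge0.
have [hj|hj] := pselect (exists z : R[i]^o, h z 0 j != 0); last first.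
  apply: aeW => w; rewrite (_ : H w 0 j = 0) ?mulr0//.
  have hw : h (cval w) 0 j = 0.
    by apply/eqP; apply: contrapT => /negP hw; apply: hj; exists (cval w).
  by have := hcirc_circle hq w j; rewrite hw mulr0 => /(congr1 (@complex.Re R)).
have [l [c [c0 cA ch]]] := hv hj.
have cH : c * H l 0 j = 0.
  have : (c * H l 0 j)%:C%C = 0 by rewrite realCM -(hcirc_circle hq) mulrCA ch mulr0.
  by move=> /(congr1 (@complex.Re R)).
have br := bmeas_rho hdec j; have bH := bmeas_hcirc hq j.
pose A := [set w | rho w 0 j * H w 0 j < 0].
have mA : measurable A.
  rewrite (_ : A = (fun w => rho w 0 j * H w 0 j) @^-1` `]-oo, 0[%classic).
    by rewrite -[X in measurable X]setTI; have [mf _] := bmeasM br bH; exact: mf.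
  by apply/seteqP; split => w; rewrite /A/= in_itv/=.
exists A; split => //; last by move=> w /= /negP; rewrite -ltNge.
have irA : nu.-integrable A (EFin \o (fun w => rho w 0 j)).
  exact: (integrableS measurableT mA (@subsetT _ _) (integrable_rho hdec j)).
apply: (@null_of_integral_le0 _ _ _ _ (fun w => - rho w 0 j)) => //.
- apply/measurable_EFinP; apply: (measurable_funS measurableT) => //.
  by have [] := bmeasN br.
- move=> w; rewrite /A/= => lt0; rewrite oppr_gt0 ltNge; apply/negP => r0.
  by move: lt0; rewrite ltNge mulr_ge0.
- have -> : (\int[nu]_(w in A) (- rho w 0 j)%:E = (-1)%:E * \int[nu]_(w in A) (rho w 0 j)%:E)%E.
    rewrite -(integralZl mA irA); apply: eq_integral => w _.
    by rewrite /= -EFinM mulN1r.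
  rewrite cA// diracE; have [/set_mem Al|_] := boolP (l \in A); last by rewrite !mule0.
  suff -> : c = 0 by rewrite mul0e mule0.
  apply/eqP; move/eqP: cH; rewrite mulf_eq0 => /orP[//|/eqP Hl].
  by move: Al; rewrite /A/= Hl mulr0 ltxx.
Qed.

Let F := Ffield phi h.

(** The strict inequality in [P_D] is not uniform in [w]. Applied to the shifted point
    [re_vec z + t *: const_mx 1] of the base, it gains [t] times the sum of the traces, hence at
    least [t * m] everywhere. *)
Lemma Ffield_bound z (t m : R) l : 0 <= t ->
  U (re_vec z + t *: const_mx 1) -> (forall w, m <= \sum_j H w 0 j) ->
  l != 0 -> cmod l < 1 ->
  Re (F z l / l) <= Re (F z 0 / l - (F z 0)^*%C * l) - t * m.
Proof.
move=> t0 Ut mH l0 l1; have p0 := two_pi_gt0 R; have bP := bmeas_poisson l1.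
have [i1 i2 E] := Re_Ffield hmu hdec hq z l0 l1.
rewrite -(ler_pM2l p0) -/F E mulrBr lerD2l.
have -> : \int[nu]_w (poisson l w * - dotv (rho w) (H w)) = 0.
  rewrite (@ae_eq_Rintegral _ _ _ nu _ (fun=> 0)) ?Rintegral_cst ?mul0r//.
  - exact: (bmeas_integrableM bP i2).
  - exact: (bmeas_integrable nu (bmeas_cst _ 0)).
  - by apply: filterS ae_rho_pairing => w rw; rewrite /dotv big1 ?oppr0 ?mulr0.
rewrite addr0 -mulrN mulrC -(poisson_mean l1).
rewrite -(RintegralZl _ measurableT (bmeas_integrable L bP)).
apply: ae_le_Rintegral.
- exact: (bmeas_integrableM bP i1).
- exact: (bmeas_integrable L (bmeasZ _ bP)).
apply: filterS hP => w [_ /(_ _ Ut)]; rewrite addrAC (dotvDl (re_vec z - g w)) dotvZl => lt.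
have sE : dotv (const_mx 1) (H w) = \sum_j H w 0 j.
  by apply: eq_bigr => j _; rewrite mxE mul1r.
rewrite [leRHS]mulrC ler_wpM2l ?(ltW (poisson_gt0 w l1))//.
have : t * m <= t * \sum_j H w 0 j by rewrite ler_wpM2l.
by rewrite -sE; lra.
Qed.

Let oD z : D z -> exists2 e : R, 0 < e & forall k : 'rV[R[i]]_n, `|k| < e%:C%C -> D (k + z).
Proof.
rewrite (tube_baseE hD) /= => Uz; have [e e0 eU] := open_rVP obase Uz.
exists e => // k ke; apply: eU.
have -> : re_vec z - re_vec (k + z) = - re_vec k.
  by apply/rowP => j; rewrite !mxE ReD; ring.
rewrite normrN; apply: norm_lt_coord => // j; rewrite mxE.
exact: le_lt_trans (ler_Re_cmod _) (cmod_coord_lt _ ke).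
Qed.

Let inward z (m : R) : 0 < m -> (forall w, m <= \sum_j H w 0 j) -> D z ->
  exists2 r0 : R, 0 < r0 < 1 &
  forall l, r0 <= cmod l -> cmod l < 1 -> Re (F z l * l^*%C) < 0.
Proof.
move=> m0 mH; rewrite {1}(tube_baseE hD) /= => Uz.
have [e e0 eU] := open_rVP obase Uz.
pose t := e / 2; have t0 : 0 < t by rewrite divr_gt0.
have Ut : U (re_vec z + t *: const_mx 1).
  apply: eU; rewrite opprD addrA subrr sub0r normrN; apply: norm_lt_coord => // j.
  by rewrite !mxE mulr1 gtr0_norm// ltr_pdivrMr// ltr_pMr// ltr1n.
pose B := cmod (F z 0) + 1; have B0 : 0 < B by rewrite ltr_wpDl ?cmod_ge0.
have tm : 0 < t * m by rewrite mulr_gt0.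
(* For [1 - r <= s] the tangent part contributes at most [2 B (1 - r) <= t m / 8], against a gain of
   at least [t m / 4] as [r >= 1 / 2]. *)
pose s := t * m / (16 * B); have s0 : 0 < s by rewrite divr_gt0// mulr_gt0.
have sB : s * (16 * B) = t * m by rewrite divfK// gt_eqF// mulr_gt0.
exists (Num.max (1 / 2) (1 - s)).
  by rewrite lt_max gt_max; apply/andP; split; [apply/orP; left; lra|apply/andP; split; lra].
move=> l; rewrite ge_max => /andP[r1 r2] l1; have lgt : 0 < cmod l by lra.
have l0 : l != 0 by rewrite -cmod_gt0.
have := Ffield_bound (ltW t0) Ut mH l0 l1.
rewrite ReB !Re_divJ.
have -> : Re ((F z 0)^*%C * l) = Re (F z 0 * l^*%C) by rewrite !ReImE; ring.
have : Re (F z 0 * l^*%C) <= B * cmod l.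
  rewrite (le_trans (Re_le_cmod _))// cmodM cmodJ ler_wpM2r ?cmod_ge0// /B; lra.
set X := Re (F z l * _); set Y := Re (F z 0 * _); set r := cmod l in r1 r2 l1 lgt * => YB.
have r20 : 0 < r ^+ 2 by rewrite exprn_gt0.
rewrite ler_pdivrMr// mulrBl mulrBl divfK ?gt_eqF// => XY.
clearbody X Y r.
have h1 : Y - Y * r ^+ 2 <= B * (2 * (1 - r)).
  have : Y * (1 - r ^+ 2) <= B * r * (1 - r ^+ 2) by rewrite ler_wpM2r//; nra.
  have h0 : r * (1 - r ^+ 2) <= 2 * (1 - r).
    have -> : r * (1 - r ^+ 2) = (r * (1 + r)) * (1 - r) by ring.
    by rewrite ler_wpM2r//; nra.
  have : B * (r * (1 - r ^+ 2)) <= B * (2 * (1 - r)) by rewrite ler_pM2l.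
  lra.
have h2 : B * (2 * (1 - r)) <= t * m / 8.
  have : B * (1 - r) <= B * s by rewrite ler_pM2l//; lra.
  lra.
have h3 : t * m / 4 <= t * m * r ^+ 2.
  by rewrite ler_pM2l//; nra.
lra.
Qed.

Lemma geodesic_of_positive_trace (m : R) : 0 < m -> (forall w, m <= \sum_j H w 0 j) ->
  complex_geodesic D phi.
Proof.
move=> m0 mH.
pose K := \sum_j (2 * cmod (h 0 0 j) + `|b j|).
have hK j l : cmod l < 1 -> cmod (h l 0 j) <= K.
  move=> l1; rewrite hq; last exact: ltW.
  apply: (@le_trans _ _ (2 * cmod (h 0 0 j) + `|b j|)).
    rewrite /circle_quadratic (le_trans (cmodD _ _))//.
    have := cmodD (h 0 0 j) ((b j)%:C%C * l).
    rewrite (cmodM (b j)%:C%C) (cmodM (h 0 0 j)^*%C) cmod_real cmodX cmodJ.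
    have : `|b j| * cmod l <= `|b j| by rewrite ler_piMr// ltW.
    have : cmod (h 0 0 j) * cmod l ^+ 2 <= cmod (h 0 0 j).
      by rewrite ler_piMr ?cmod_ge0// expr_le1 ?cmod_ge0// ltW.
    by lra.
  rewrite /K (bigD1 j)//= lerDl; apply: sumr_ge0 => i _.
  by rewrite addr_ge0// mulr_ge0// cmod_ge0.
have dphi j l : cmod l < 1 -> cdifferentiable (fun l => phi l 0 j) l.
  move=> l1; apply: vdifferentiable_coord; apply: hphi.
  by rewrite /unit_disc/= normc_cmod ltcR.
have [f [hf f1 fz]] := @moving_zero R n D (fun j l => h l 0 j) (fun j l => phi l 0 j) K
  oD (fun j l _ => vdifferentiable_coord j (hH.1 l I))
  dphi hK (fun z Dz => inward m0 mH Dz).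
split; [exact: hphi|by move=> _ [l dl <-]; exact: phi_in_D|exists f; split => //].
  by move=> _ [z Dz <-]; rewrite /unit_disc/= normc_cmod ltcR f1.
move=> l dl; apply: fz; first exact: phi_in_D.
  by move: dl; rewrite /unit_disc/= normc_cmod ltcR.
by rewrite big1// => j _; rewrite subrr mulr0.
Qed.

(** At a common zero [w0] the traces are [|w - w0|^2] times constants, so only the direction [cv]
    matters: [<g, cv>] is almost everywhere the supremum [M] over the base, and [<rho, cv>] lives on
    [w0]. Of the boundary measure of [<phi, cv>] there remain a constant density and one atom. *)
Lemma geodesic_of_zero_trace w0 : (forall j, H w0 0 j = 0) -> complex_geodesic D phi.
Proof.
move=> Hw0; have p0 := two_pi_gt0 R.
pose c j := cmod (h 0 0 j); pose cv : 'rV[R]_n := \row_j c j.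
have shape j : b j = 2 * c j /\ (h 0 0 j)^*%C * cval w0 = - (c j)%:C%C.
  apply: circle_trace_zeroE => [u|].
    by have := H_ge0 u j; rewrite (hcircE hq) mxE.
  by have := Hw0 j; rewrite (hcircE hq) mxE.
pose s w := 2 * (1 - Re ((cval w0)^*%C * cval w)).
have HE w : H w = s w *: cv.
  apply/rowP => j; rewrite (hcircE hq) !mxE; have [bE aE] := shape j.
  have aE' : (h 0 0 j)^*%C = - ((c j)%:C%C * (cval w0)^*%C).
    by rewrite -mulNr -aE -mulrA mulJc cmod_cval expr1n mulr1.
  by rewrite /circle_trace bE aE' mulNr ReN -mulrA ReZ /s; ring.
have sE w : s w = cmod (cval w - cval w0) ^+ 2.
  have := sqr_cmod (cval w); have := sqr_cmod (cval w0).
  rewrite !cmod_cval expr1n sqr_cmod /s !ReImE => h1 h2; lra.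
have s_gt0 w : w <> w0 -> 0 < s w.
  move=> ww0; rewrite sE exprn_gt0// cmod_gt0 subr_eq0.
  by apply/eqP => /cval_inj.
have ae_w0 : \forall w \ae L, w <> w0.
  exists [set w0]; split; [exact: measurable_circle1|exact: arc_length1|].
  by move=> w /contrapT.
have good : \forall w \ae L, closure U (g w) /\
    forall x, U x -> dotv x cv < dotv (g w) cv.
  apply: filterS2 hP ae_w0 => w [clg lt] ww0; split => // x Ux.
  by have := lt x Ux; rewrite HE dotvZr pmulr_rlt0 ?s_gt0// dotvBl subr_lt0.
have [w1 [clg1 lt1]] := ae_arc_length_ex good; set M := dotv (g w1) cv in lt1.
(* Each of [g w] and [g w1] bounds the base in direction [cv] and lies in its closure, so each
   dominates the other. *)
have gM : \forall w \ae L, dotv (g w) cv = M.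
  apply: filterS good => w [clg lt]; apply/eqP; rewrite eq_le; apply/andP; split.
    by apply: closure_halfspace clg => x Ux; exact: ltW (lt1 x Ux).
  by apply: closure_halfspace clg1 => x Ux; exact: ltW (lt x Ux).
pose al := \int[nu]_w dotv (rho w) cv.
have rho0 : \forall w \ae nu, w <> w0 -> dotv (rho w) cv = 0.
  apply: filterS ae_rho_pairing => w rw ww0; rewrite /dotv big1// => j _.
  have /eqP := rw j; rewrite HE mxE mulrCA mulf_eq0 gt_eqF ?s_gt0//=.
  by move=> /eqP.
have Jf (f : T -> R) : bmeas f ->
    \sum_j c j * bint g rho nu j f = M * \int[L]_w f w + f w0 * al.
  move=> bf; have bc j : bmeas (fun _ : T => c j) by exact: bmeas_cst.
  have [i1 i2 E] := integrable_dot hdec bc bf.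
  transitivity (\sum_j bint g rho nu j (fun w => f w * c j)).
    apply: eq_bigr => j _; rewrite -(bintZ hdec)//; congr bint.
    by apply/funext => w; rewrite mulrC.
  rewrite E; congr (_ + _).
    rewrite -(RintegralZl M measurableT (bmeas_integrable L bf)).
    apply: ae_eq_Rintegral; first exact: (bmeas_integrableM bf i1).
      exact: (bmeas_integrable L (bmeasZ M bf)).
    by apply: filterS gM => w gw; rewrite -/cv gw mulrC.
  rewrite /al -(RintegralZl (f w0) measurableT i2).
  apply: ae_eq_Rintegral; first exact: (bmeas_integrableM bf i2).
    exact: (bmeas_integrableM (bmeas_cst _ (f w0)) i2).
  apply: filterS rho0 => w rw; have [->//|/rw] := pselect (w = w0).
  by rewrite -/cv => ->; rewrite !mulr0.
have pn : 2 * pi != 0 :> R by rewrite gt_eqF.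
(* The value of [<Re phi, cv>] at 0 is [M + al / (2 pi)], and no point of the base attains [M]:
   condition (iv) provides the nonzero atom by which [W] divides. *)
have al0 : al < 0.
  have J1 := Jf (fun=> 1) (bmeas_cst _ 1).
  have := lt1 _ hphi0.
  have -> : dotv (re_vec (phi 0)) cv = (2 * pi)^-1 * \sum_j c j * bint g rho nu j (fun=> 1).
    rewrite mulr_sumr; apply: eq_bigr => j _.
    by rewrite !mxE (Re_phi0 hmu hdec) mulrAC mulrA.
  rewrite J1 Rintegral_cst// (congr1 fine (arc_lengthT R))/= !mul1r mulrDr.
  rewrite mulrCA mulVf// mulr1 gtrDl pmulr_rlt0// invr_gt0//.
have aln : al != 0 by rewrite lt_eqF.
pose be := \sum_j c j * Im (phi 0 0 j).
have sumRe (G : 'I_n -> R[i]) : Re (\sum_j G j) = \sum_j Re (G j).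
  by elim: (index_enum _) => [|j r IH]; rewrite ?big_nil// !big_cons ReD IH.
have sumIm (G : 'I_n -> R[i]) : Im (\sum_j G j) = \sum_j Im (G j).
  by elim: (index_enum _) => [|j r IH]; rewrite ?big_nil// !big_cons ImD IH.
pose Q z : R[i] := \sum_j (c j)%:C%C * z 0 j.
have phiE l : cmod l < 1 ->
    Q (phi l) = M%:C%C + ((2 * pi)^-1 * al)%:C%C * herglotz l w0 + 'i%C * be%:C%C.
  move=> l1; have [bRe bIm] := cbmeas_herglotz l1; have [m1 m2] := herglotz_mean l1.
  have ReE j : Re (phi l 0 j) = (2 * pi)^-1 * bint g rho nu j (fun w => Re (herglotz l w)).
    by rewrite (phi_bint hmu hdec j l1) !ReImE/=; ring.
  have ImE j : Im (phi l 0 j) =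
      (2 * pi)^-1 * bint g rho nu j (fun w => Im (herglotz l w)) + Im (phi 0 0 j).
    by rewrite (phi_bint hmu hdec j l1) !ReImE/=; ring.
  have JR := Jf _ bRe; have JI := Jf _ bIm; rewrite m1 in JR; rewrite m2 in JI.
  apply: eqcP.
    rewrite sumRe (eq_bigr (fun j => (2 * pi)^-1 *
      (c j * bint g rho nu j (fun w => Re (herglotz l w))))) => [|j _]; last first.
      by rewrite ReZ ReE mulrCA.
    rewrite -mulr_sumr JR !ReImE/=; move: (2 * pi) pn => p p_neq0; field; exact: p_neq0.
  rewrite sumIm (eq_bigr (fun j => (2 * pi)^-1 *
    (c j * bint g rho nu j (fun w => Im (herglotz l w))) + c j * Im (phi 0 0 j))) => [|j _]; last first.
    by rewrite ImZ ImE mulrDr mulrCA.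
  by rewrite big_split/= -mulr_sumr JI -/be !ReImE/=; ring.
pose W z : R[i] := (Q z - M%:C%C - 'i%C * be%:C%C) * (2 * pi / al)%:C%C.
have ReW z : D z -> 0 < Re (W z).
  rewrite {1}(tube_baseE hD)/= => Uz; rewrite /W mulrC ReZ.
  have -> : Re (Q z - M%:C%C - 'i%C * be%:C%C) = dotv (re_vec z) cv - M.
    rewrite !ReB sumRe !ReImE/= !(mul0r, mulr0, mul1r) subrr subr0; congr (_ - _).
    by apply: eq_bigr => j _; rewrite ReZ !mxE mulrC.
  have Mlt : dotv (re_vec z) cv - M < 0 by rewrite subr_lt0; exact: lt1.
  by rewrite nmulr_rgt0// pmulr_rlt0// invr_lt0.
have W1 z : D z -> W z + 1 != 0.
  move=> /ReW W0; apply/eqP => /(congr1 (@complex.Re R)); rewrite ReD/= => h1.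
  by have := W0; rewrite -(ltrD2r 1) h1 add0r ltr10.
(* [W] sends [D] into the right half-plane and [phi l] to the Herglotz kernel [(w0 + l) / (w0 - l)];
   this Cayley transform inverts that kernel. *)
pose f z : R[i]^o := cval w0 * (W z - 1) / (W z + 1).
have dQ z : vdifferentiable (Q : 'rV[R[i]]_n -> R[i]^o) z.
  rewrite /vdifferentiable.
  rewrite (_ : (Q : _ -> R[i]^o) = \sum_j (fun k : 'rV[R[i]]_n => (c j)%:C%C *: (k 0 j : R[i]^o))).
    apply: differentiable_sum => j; apply: differentiableZ.
    exact: differentiable_coord.
  by apply/funext => k; rewrite fct_sumE.
have dW z : vdifferentiable (W : 'rV[R[i]]_n -> R[i]^o) z.
  apply: differentiableM; last exact: differentiable_cst.
  apply: differentiableB; last exact: differentiable_cst.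
  by apply: differentiableB; [exact: dQ|exact: differentiable_cst].
split; [exact: hphi|by move=> _ [l dl <-]; exact: phi_in_D|exists f; split].
- move=> z Dz; apply: differentiableM.
    apply: differentiableM; first exact: differentiable_cst.
    by apply: differentiableB; [exact: dW|exact: differentiable_cst].
  apply: differentiableV; last exact: W1.
  by apply: differentiableD; [exact: dW|exact: differentiable_cst].
- move=> _ [z Dz <-]; rewrite /unit_disc/= normc_cmod ltcR.
  rewrite cmodM cmodM cmodV cmod_cval mul1r ltr_pdivrMr ?cmod_gt0 ?W1// mul1r.
  rewrite -(ltr_pXn2r (n := 2)) ?nnegrE ?cmod_ge0// !sqr_cmod.
  by move: (W z) (ReW z Dz) => v v0; rewrite !ReImE/=; lra.
- move=> l dl; have l1 : cmod l < 1 by move: dl; rewrite /unit_disc/= normc_cmod ltcR.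
  have WE : W (phi l) = herglotz l w0.
    rewrite /W phiE//.
    have -> : M%:C%C + ((2 * pi)^-1 * al)%:C%C * herglotz l w0 + 'i%C * be%:C%C - M%:C%C -
        'i%C * be%:C%C = ((2 * pi)^-1 * al)%:C%C * herglotz l w0 by ring.
    rewrite mulrAC -realCM.
    have -> : (2 * pi)^-1 * al * (2 * pi / al) = 1.
      by move: (2 * pi) pn => p p_neq0; field; rewrite p_neq0 aln.
    by rewrite mul1r.
  have wl := cval_sub_neq0 w0 l1.
  have w00 : (cval w0 : R[i]) != 0 by rewrite -cmod_gt0 cmod_cval.
  have := W1 _ (phi_in_D dl); rewrite /f WE /herglotz.
  set u := cval w0 in wl w00 *.
  have -> : (u + l) / (u - l) + 1 = 2 * u / (u - l) by field.
  have -> : (u + l) / (u - l) - 1 = 2 * l / (u - l) by field.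
  by move=> _; field; rewrite wl w00.
Qed.
End sufficiency.

(** * The dichotomy in the converse *)

Section sufficiency_conclusion.
Context (R : realType) (n : nat).
Local Notation T := (borel (circle R)).
Local Notation L := (arc_length R).

(** The sum of the traces is again a trace, with minimum [B - 2 |A|]. Since all traces are
    nonnegative, either this minimum is positive or every trace vanishes where it is attained. *)
Lemma geodesic_sufficient (D : set 'rV[R[i]]_n) (hD : family_D D)
    (phi : R[i]^o -> 'rV[R[i]]_n) (hphi : holomorphic_on (unit_disc R) phi)
    (mu : 'I_n -> {charge set T -> \bar R})
    (hmu : is_boundary_measure phi mu) (g rho : T -> borel 'rV[R]_n)
    (nu : {finite_measure set T -> \bar R})
    (hdec : is_decomposition mu g rho nu) (h : R[i]^o -> 'rV[R[i]]_n) :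
  H_plus h ->
  (\forall w \ae L, P_set D (hcirc h w) (g w)) ->
  (\forall w \ae nu, forall j, rho w 0 j <= 0) ->
  Re_base D (re_vec (phi 0)) ->
  (forall j, (exists z, h z 0 j != 0) ->
     exists (l : T) (c : R), [/\ c <= 0,
       forall A : set T, measurable A ->
         (\int[nu]_(w in A) (rho w 0 j)%:E = c%:E * \d_l A)%E &
       c%:C%C * h (cval l) 0 j = 0]) ->
  complex_geodesic D phi.
Proof.
move=> hH hP hr hphi0 hv; have [b hq] := H_plus_quadratic hH.
have H0 w j : 0 <= hcirc h w 0 j.
  have uw : unit_circle R (cval w) by exact: (set_valP (w : circle R)).
  by have := hH.2 _ uw j; rewrite [_ * _](hcirc_circle hq) lecR.
pose A := \sum_j h 0 0 j; pose B := \sum_j b j.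
have SE w : \sum_j hcirc h w 0 j = circle_trace A B w.
  rewrite /circle_trace /A /B rmorph_sum/= mulr_suml.
  have sumRe (G : 'I_n -> R[i]) : complex.Re (\sum_j G j) = \sum_j complex.Re (G j).
    by elim: (index_enum _) => [|j r IH]; rewrite ?big_nil// !big_cons ReD IH.
  rewrite sumRe mulr_sumr -big_split; apply: eq_bigr => j _.
  by rewrite (hcircE hq) mxE.
have [u uE] := circle_trace_argmin A B.
have : 0 <= B - 2 * cmod A by rewrite -uE -SE; apply: sumr_ge0.
rewrite le_eqVlt => /orP[/eqP u0|m0]; last first.
  apply: (geodesic_of_positive_trace hD hphi hmu hdec hH hP hr hphi0 hv hq m0) => w.
  by rewrite SE circle_trace_ge.
apply: (geodesic_of_zero_trace hD hphi hmu hdec hH hP hr hphi0 hv hq (w0 := u)) => j.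
have := SE u; rewrite uE -u0 => /psumr_eq0P; apply => // i _; exact: H0.
Qed.
End sufficiency_conclusion.

Theorem corollary3p4 (R : realType) (n : nat) (hn : (2 <= n)%N)
    (D : set 'rV[R[i]]_n) (hD : family_D D)
    (phi : R[i]^o -> 'rV[R[i]]_n) (hphi : holomorphic_on (unit_disc R) phi)
    (mu : 'I_n -> {charge set (borel (circle R)) -> \bar R})
    (hmu : is_boundary_measure phi mu)
    (g rho : borel (circle R) -> borel 'rV[R]_n)
    (nu : {finite_measure set (borel (circle R)) -> \bar R})
    (hdec : is_decomposition mu g rho nu) :
  (phi @` unit_disc R `<=` D /\ complex_geodesic D phi) <->
  exists h : R[i]^o -> 'rV[R[i]]_n,
    [/\ H_set h,
        exists z, h z != 0 &
    [/\           H_plus h,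
                   \forall w \ae arc_length R,
                     P_set D (re_vec ((cval w)^* *: h (cval w))) (g w),
                    \forall w \ae nu, forall j, rho w 0 j <= 0,
                   Re_base D (re_vec (phi 0)) &
                  forall j, (exists z, h z 0 j != 0) ->
          exists (l : borel (circle R)) (a : R),
            [/\ a <= 0,
                forall A : set (borel (circle R)), measurable A ->
                  (\int[nu]_(w in A) (rho w 0 j)%:E = a%:E * \d_l A)%E &
                a%:C%C * h (cval l) 0 j = 0]]].
Proof.
split=> [[_ geo]|[h [_ _ [hH hP hr h0 hv]]]].
  exact: (geodesic_necessary hD hphi hmu hdec geo).
have geo := geodesic_sufficient hD hphi hmu hdec hH hP hr h0 hv.
by split => //; have [_] := geo.
Qed.
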